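(* Let $f:\mathbb{R}^d\to\mathbb{R}$ be twice differentiable with $0\prec m_2\cdot I\preceq\nabla^2 f(x)\preceq M_2\cdot I$ for all $x\in\mathbb{R}^d$, let $\kappa=M_2/m_2$, and let $0<\epsilon<\sqrt d$. There is a randomized algorithm which, starting from $x^{(0)}$ equal to the minimizer of $f$ and given access to evaluations of $\nabla f$, outputs a random point $X$ such that, for $Y$ distributed with density proportional to $e^{-f}$, \[ W_2(X,Y)\le\frac{\epsilon}{\sqrt{m_2}}, \] using $O(\kappa^{1.5}\log(\frac d\epsilon))$ iterations, where each iteration takes $O\big(\frac{\kappa^{1/4}d^{3/2}}{\epsilon}\log(\frac{\kappa d}{\epsilon})\big)$ time and $O\big(\frac{\kappa^{1/4}d^{1/2}}{\epsilon}\log(\frac{\kappa d}{\epsilon})\big)$ evaluations of $\nabla f$, amortized over all iterations.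
   Context: $W_2$ denotes the 2-Wasserstein distance: $W_2(X,Y)=(\inf\mathbb{E}\|X-Y\|_2^2)^{1/2}$ over all couplings of the laws of $X$ and $Y$.
   Formalization: The logarithms in the O-bounds are read as max(1, log), since for d = 1, κ = 1 and ε → 1 the bound O(log(d/ε)) would permit no iteration at all, while the starting point itself violates the Wasserstein bound for a Gaussian. *)

(* Defs.v *)
From HB Require Import structures.
From mathcomp Require Import all_boot all_order all_algebra.
From mathcomp Require Import all_classical all_reals all_analysis.
Set Implicit Arguments.
Unset Strict Implicit.
Unset Printing Implicit Defensive.
Import Order.TTheory GRing.Theory Num.Theory.
Import numFieldNormedType.Exports.
Local Open Scope classical_set_scope.
Local Open Scope ring_scope.

(* R^n is 'rV[R]_n with the product sigma-algebra. The norm that the library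
   puts on 'rV[R]_n is the sup norm; it induces the same topology and the same
   differentiability as the Euclidean norm, which is written explicitly below. *)
Section measurable_rV.
Context {d : measure_display} {T : measurableType d}.
Variable n : nat.
Let coord (i : 'I_n) (v : 'rV[T]_n) : T := v ord0 i.

HB.instance Definition _ := @isMeasurable.Build (measure_tuple_display d)
  'rV[T]_n (g_sigma_preimage coord)
  (@sigma_algebra0 _ _ _) (@sigma_algebraC _ _) (@sigma_algebra_bigcup _ _ _).
End measurable_rV.

Lemma measurable_rV_coord d (T : measurableType d) n (i : 'I_n) :
  measurable_fun [set: 'rV[T]_n] (fun v => v ord0 i).
Proof.
move=> _ Y mY; rewrite setTI; apply: sub_sigma_algebra => /=.
rewrite -bigcup_seq/=; exists i => /=; first by rewrite mem_index_enum.
by exists Y => //; rewrite setTI.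
Qed.

Lemma measurable_fun_rVP d d' (T : measurableType d) (T' : measurableType d')
    n (f : T -> 'rV[T']_n) :
  (forall i, measurable_fun setT (fun x => f x ord0 i)) <-> measurable_fun setT f.
Proof.
split=> [mf|mf i]; last first.
  exact: (measurableT_comp (@measurable_rV_coord _ T' n i) mf).
move=> _ B mB; rewrite setTI.
have {mB} : <<s \big[setU/set0]_(i < n)
   preimage_set_system setT (fun v : 'rV[T']_n => v ord0 i) measurable >> B by [].
pose S := [set B | measurable (f @^-1` B)].
have sS : sigma_algebra setT S.
  split.
  - by rewrite /S /= preimage_set0.
  - by move=> A; rewrite /S /= setTD preimage_setC => ?; exact: measurableC.
  - by move=> A mA; rewrite /S /= preimage_bigcup; apply: bigcup_measurable => k _; exact: mA.
apply: smallest_sub sS _ B => A.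
rewrite -bigcup_seq => -[i _ [C mC <-]]; rewrite setTI /S /=.
by have := mf i measurableT C mC; rewrite setTI.
Qed.

Section lebesgue_rV.
Variable R : realType.

(* measurableTypeR R is R with the sigma-algebra carried by lebesgue_measure;
   it has the same measurable sets as R. *)
Definition rV_cons n (z : measurableTypeR R * 'rV[R]_n) : 'rV[R]_n.+1 :=
  row_mx (const_mx z.1 : 'rV_1) z.2.

Lemma measurable_rV_cons n : measurable_fun setT (@rV_cons n).
Proof.
apply/measurable_fun_rVP => i; rewrite /rV_cons.
under eq_fun do rewrite mxE.
case: split_ordP => j _; first by under eq_fun do rewrite mxE; exact: measurable_fst.
exact: (measurableT_comp (@measurable_rV_coord _ R n j) measurable_snd).
Qed.

HB.instance Definition _ n :=
  isMeasurableFun.Build _ _ _ _ (@rV_cons n) (@measurable_rV_cons n).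

Lemma rV_cons_sigma_finite n (mu : {sigma_finite_measure set 'rV[R]_n -> \bar R}) :
  sigma_finite setT (pushforward (@lebesgue_measure R \x mu)%E (@rV_cons n)).
Proof.
have /sigma_finiteP[F [FT ndF Foo]] := sigma_finiteT (@lebesgue_measure R).
have /sigma_finiteP[G [GT ndG Goo]] := sigma_finiteT mu.
pose uncons (v : 'rV[R]_n.+1) : measurableTypeR R * 'rV[R]_n := (v ord0 ord0, \row_i v ord0 (lift ord0 i)).
have unconsK z : uncons (rV_cons z) = z.
  case: z => x v; rewrite /uncons /rV_cons; congr pair.
    by rewrite mxE; case: split_ordP => j // _; rewrite mxE.
  apply/rowP => i; rewrite !mxE; case: split_ordP => j; first by move/(congr1 val); rewrite /= ord1.
  by move=> /(congr1 val) [] /val_inj ->.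
have mun : measurable_fun setT uncons.
  apply/measurable_fun_pairP; split; first exact: measurable_rV_coord.
  apply/measurable_fun_rVP => i /=; under eq_fun do rewrite mxE.
  exact: measurable_rV_coord.
exists (fun k => uncons @^-1` (F k `*` G k)) => [|k].
  apply/esym/seteqP; split=> // v _.
  have [i _ Fi] : (\bigcup_i F i) (uncons v).1 by rewrite -FT.
  have [j _ Gj] : (\bigcup_i G i) (uncons v).2 by rewrite -GT.
  exists (maxn i j) => //; split.
    by move: Fi; exact/subsetPset/ndF/leq_maxl.
  by move: Gj; exact/subsetPset/ndG/leq_maxr.
have [mF Fy] := Foo k; have [mG Gy] := Goo k.
split; first by rewrite -[X in measurable X]setTI; apply: mun => //; exact: measurableX.
rewrite /pushforward (_ : _ @^-1` _ = F k `*` G k); last first.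
  by apply/seteqP; split => z; rewrite /preimage /mkset unconsK.
by rewrite product_measure1E// lte_mul_pinfty// ge0_fin_numE.
Qed.

Definition lebesgue_rVS n (mu : {sigma_finite_measure set 'rV[R]_n -> \bar R}) :
  set 'rV[R]_n.+1 -> \bar R := pushforward (@lebesgue_measure R \x mu)%E (@rV_cons n).

Section lebesgue_rVS.
Variables (n : nat) (mu : {sigma_finite_measure set 'rV[R]_n -> \bar R}).
Let lebesgue_rVS0 : lebesgue_rVS mu set0 = 0%E.
Proof. by rewrite /lebesgue_rVS /pushforward preimage_set0 measure0. Qed.
Let lebesgue_rVS_ge0 A : (0 <= lebesgue_rVS mu A)%E.
Proof. exact: measure_ge0. Qed.
Let lebesgue_rVS_sigma_additive : semi_sigma_additive (lebesgue_rVS mu).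
Proof. apply: measure_semi_sigma_additive; exact: measurable_rV_cons. Qed.
HB.instance Definition _ := isMeasure.Build _ _ _ (lebesgue_rVS mu)
  lebesgue_rVS0 lebesgue_rVS_ge0 lebesgue_rVS_sigma_additive.
HB.instance Definition _ := Measure_isSigmaFinite.Build _ _ _ (lebesgue_rVS mu)
  (rV_cons_sigma_finite mu).
End lebesgue_rVS.

(* n-dimensional Lebesgue measure: the iterated product of the one-dimensional
   one. *)
Fixpoint lebesgue_rV n : {sigma_finite_measure set 'rV[R]_n -> \bar R} :=
  match n with
  | 0 => \d_(0 : 'rV[R]_0)
  | m.+1 => lebesgue_rVS (lebesgue_rV m)
  end.

End lebesgue_rV.

Lemma lebesgue_rV_box (R : realType) n (B : 'I_n -> set R) :
  (forall i, measurable (B i)) ->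
  lebesgue_rV R n [set v | forall i, B i (v ord0 i)] =
  (\prod_(i < n) lebesgue_measure (B i))%E.
Proof.
elim: n B => [|n IH] B mB /=.
  by rewrite big_ord0 diracE mem_set// => -[].
rewrite big_ord_recl /lebesgue_rVS /pushforward.
rewrite (_ : _ @^-1` _ = B ord0 `*`
    [set v : 'rV[R]_n | forall i, B (lift ord0 i) (v ord0 i)]).
  rewrite product_measure1E.
  - by congr (_ * _)%E; apply: IH => i; exact: mB.
  - exact: (mB ord0).
  - rewrite (_ : [set v | _] =
      \bigcap_(i in [set: 'I_n])
        ((fun v : 'rV[R]_n => v ord0 i) @^-1` B (lift ord0 i))).
      apply: fin_bigcap_measurable => [|i _]; first exact: finite_finset.
      by rewrite -[X in measurable X]setTI; exact: measurable_rV_coord.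
    by apply/seteqP; split=> v /= H i; [move=> _|]; apply: H.
apply/seteqP; split=> [[x v] /= H|[x v] /= [H0 H] i].
- split => [|i].
    have := H ord0; rewrite /rV_cons mxE; case: split_ordP => j // _; by rewrite mxE.
  have := H (lift ord0 i); rewrite /rV_cons mxE; case: split_ordP => j.
    by move/(congr1 val); rewrite /= ord1.
  by move=> /(congr1 val) [] /val_inj ->.
- rewrite /rV_cons mxE; case: split_ordP => j iE.
    by rewrite mxE (_ : i = ord0)//; apply: val_inj; rewrite iE /= ord1.
  by rewrite (_ : i = lift ord0 j)//; apply: val_inj; rewrite iE.
Qed.

Section calculus.
Variables (R : realType) (d : nat).
Implicit Types (f : 'rV[R]_d -> R) (x v : 'rV[R]_d) (A B : 'M[R]_d).

Definition gradient f x : 'rV[R]_d := \row_(i < d) 'D_(delta_mx ord0 i) f x.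

Definition hessian f x : 'M[R]_d := 'J (gradient f) x.

Definition twice_differentiable f :=
  (forall x, differentiable f x) /\ (forall x, differentiable (gradient f) x).

(* Loewner order. *)
Definition loewner_le A B := forall v, 0 <= (v *m (B - A) *m v^T) ord0 ord0.

Definition sqnorm2 v : R := \sum_(i < d) v ord0 i ^+ 2.

End calculus.

Section probability.
Variables (R : realType) (d : nat).

Definition is_coupling (mu nu : set 'rV[R]_d -> \bar R)
    (g : probability ('rV[R]_d * 'rV[R]_d)%type R) :=
  forall A, measurable A ->
    g (A `*` [set: 'rV[R]_d]) = mu A /\ g ([set: 'rV[R]_d] `*` A) = nu A.

(* 2-Wasserstein distance between the laws mu and nu. *)
Definition W2 (mu nu : set 'rV[R]_d -> \bar R) : \bar R :=
  (ereal_inf [set (\int[g]_z (sqnorm2 (z.1 - z.2))%:E)%E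
             | g in [set g | is_coupling mu nu g]] `^ (1 / 2))%E.

(* The constant c is determined by the total mass of the law of Y being 1. *)
Definition has_density_propto dO (O : measurableType dO) (Q : probability O R)
    (Y : {RV Q >-> 'rV[R]_d}) (p : 'rV[R]_d -> R) :=
  exists c : R, forall A : set 'rV[R]_d, measurable A ->
    distribution Q Y A = (\int[lebesgue_rV R d]_(y in A) (c * p y)%:E)%E.

(* xi_0, xi_1, ... are independent and each is N(0,1). *)
Definition iid_std_gaussian dO (O : measurableType dO) (P : probability O R)
    (xi : nat -> {RV P >-> R}) :=
  forall (n : nat) (B : nat -> set R), (forall i, measurable (B i)) ->
    P [set w | forall i, (i < n)%N -> B i (xi i w)] =
    (\prod_(i < n) normal_prob 0 1 (B i))%E.

End probability.

(* The model of computation is a real RAM with a random source and a gradient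
   oracle. It has registers n_0, n_1, ... holding natural numbers and cells
   r_0, r_1, ... holding reals. A program is a finite piece of syntax that
   mentions neither the dimension nor the function, so a single program has to
   serve all inputs. A real operand is addressed directly, Dir k denoting r_k,
   or indirectly, Ind i denoting the cell whose index is in n_i. Every operation
   and every test takes one unit of time, except that a gradient query takes d
   units, for reading a point of R^d and writing a vector of R^d. *)
Inductive addr := Dir of nat | Ind of nat.

Inductive binop := Add | Sub | Mul | Div.

Inductive unop := Sqrt | Exp | Ln.

Inductive instr :=
  | NatConst of nat & nat            (* n_i := k *)
  | NatAdd of nat & nat & nat        (* n_i := n_j + n_k *)
  | NatSub of nat & nat & nat        (* n_i := n_j - n_k, truncated *)
  | RealConst of addr & rat
  | RealOfNat of addr & nat
  | RealBin of binop & addr & addr & addr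
  | RealUn of unop & addr & addr
  | Gauss of addr                    (* a fresh sample of N(0,1) *)
  | Grad of addr & addr.             (* source block, target block *)

Inductive test := NatLt of nat & nat | RealLt of addr & addr.

Inductive cmd :=
  | Skip
  | Instr of instr
  | Seq of cmd & cmd
  | If of test & cmd & cmd
  | While of test & cmd.

(* An algorithm runs init and then, as long as guard holds, body; one execution
   of body is one iteration. *)
Record algorithm := Algorithm { init : cmd; guard : test; body : cmd }.

Section semantics.
Variables (R : realType) (d : nat).
Variable g : 'rV[R]_d -> 'rV[R]_d. (* the oracle *)
Variable w : nat -> R.             (* the stream of random samples *)

Record state := State {
  nreg : nat -> nat;
  rmem : nat -> R;
  draws : nat; (* number of samples consumed *)
  time : nat;
  queries : nat (* number of oracle calls *)
}.

Definition upd (T : Type) (m : nat -> T) (i : nat) (x : T) : nat -> T :=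
  fun j => if j == i then x else m j.

Definition store (m : nat -> R) (b : nat) (v : 'rV[R]_d) : nat -> R :=
  fun k => oapp (v ord0) (m k) (if (b <= k)%N then insub (k - b)%N else None).

Definition load (m : nat -> R) (b : nat) : 'rV[R]_d := \row_(j < d) m (b + j)%N.

Definition tick (t : nat) (s : state) : state :=
  State (nreg s) (rmem s) (draws s) (time s + t) (queries s).

Definition set_nat (s : state) (i k : nat) : state :=
  State (upd (nreg s) i k) (rmem s) (draws s) (time s) (queries s).

Definition loc (s : state) (a : addr) : nat :=
  match a with Dir k => k | Ind i => nreg s i end.

Definition get_real (s : state) (a : addr) : R := rmem s (loc s a).

Definition set_real (s : state) (a : addr) (x : R) : state :=
  State (nreg s) (upd (rmem s) (loc s a) x) (draws s) (time s) (queries s).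

Definition eval_binop (o : binop) (x y : R) : R :=
  match o with Add => x + y | Sub => x - y | Mul => x * y | Div => x / y end.

Definition eval_unop (o : unop) (x : R) : R :=
  match o with Sqrt => Num.sqrt x | Exp => expR x | Ln => ln x end.

Definition step (i : instr) (s : state) : state :=
  match i with
  | NatConst i k => tick 1 (set_nat s i k)
  | NatAdd i j k => tick 1 (set_nat s i (nreg s j + nreg s k))
  | NatSub i j k => tick 1 (set_nat s i (nreg s j - nreg s k))
  | RealConst a q => tick 1 (set_real s a (ratr q))
  | RealOfNat a i => tick 1 (set_real s a (nreg s i)%:R)
  | RealBin o a b c =>
      tick 1 (set_real s a (eval_binop o (get_real s b) (get_real s c)))
  | RealUn o a b => tick 1 (set_real s a (eval_unop o (get_real s b)))
  | Gauss a =>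
      let s' := set_real s a (w (draws s)) in
      State (nreg s') (rmem s') (draws s).+1 (time s).+1 (queries s)
  | Grad a b =>
      State (nreg s) (store (rmem s) (loc s b) (g (load (rmem s) (loc s a))))
            (draws s) (time s + d) (queries s).+1
  end.

Definition holds (b : test) (s : state) : bool :=
  match b with
  | NatLt i j => (nreg s i < nreg s j)%N
  | RealLt a b => get_real s a < get_real s b
  end.

(* exec c s s': started in state s, the program c halts in state s'. *)
Inductive exec : cmd -> state -> state -> Prop :=
  | exec_skip s : exec Skip s s
  | exec_instr i s : exec (Instr i) s (step i s)
  | exec_seq c1 c2 s s1 s2 :
      exec c1 s s1 -> exec c2 s1 s2 -> exec (Seq c1 c2) s s2
  | exec_if b c1 c2 s s' :
      exec (if holds b s then c1 else c2) (tick 1 s) s' ->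
      exec (If b c1 c2) s s'
  | exec_while_end b c s : ~~ holds b s -> exec (While b c) s (tick 1 s)
  | exec_while b c s s1 s2 :
      holds b s -> exec c (tick 1 s) s1 -> exec (While b c) s1 s2 ->
      exec (While b c) s s2.

(* As While, but recording the number of executions of the body. *)
Inductive main_loop (b : test) (c : cmd) : nat -> state -> state -> Prop :=
  | main_loop_end s : ~~ holds b s -> main_loop b c 0 s (tick 1 s)
  | main_loop_iter n s s1 s2 :
      holds b s -> exec c (tick 1 s) s1 -> main_loop b c n s1 s2 ->
      main_loop b c n.+1 s s2.

(* Input: d in n_0; eps, m2, M2 in r_0, r_1, r_2; the starting point in
   r_3, ..., r_(d+2). The output is read off this last block, so that this block
   holds the current iterate. *)
Definition input (eps m2 M2 : R) (x0 : 'rV[R]_d) : state :=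
  State (upd (fun=> 0%N) 0 d)
        (store (upd (upd (upd (fun=> 0) 0 eps) 1 m2) 2 M2) 3 x0) 0 0 0.

Definition output (s : state) : 'rV[R]_d := load (rmem s) 3.

(* Started in s, the algorithm halts in s' after exactly N iterations. *)
Definition run (A : algorithm) (s : state) (N : nat) (s' : state) :=
  exists2 s1, exec (init A) s s1 & main_loop (guard A) (body A) N s1 s'.

End semantics.

(* The logarithm inside an O-bound, which does not drop below 1: for d = 1 and
   eps close to 1 the quantity ln (d / eps) tends to 0, whereas an algorithm
   performs at least one iteration. *)
Definition logO (R : realType) (x : R) : R := Num.max 1 (ln x).

(* Main.v *)
(** Hamiltonian Monte Carlo with the Verlet integrator: an iteration draws a fresh
    gaussian velocity and performs K Verlet steps of size h = T / K, where
    T ^ 2 = 1 / (4 M sqrt kappa).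

    Contraction. The Verlet position is a discrete analogue of
    x(t) = x + t v - int_0^t (t - s) g(x(s)) ds, so by co-coercivity of the gradient g two
    Verlet trajectories with the same velocity satisfy
    |x_K - y_K|^2 <= (1 - m T^2 / 4) |x_0 - y_0|^2.

    Discretization. Halving the step size repeatedly moves the end point by at most
    M h T^2 (2 |v| + 2 T |g(x)|). The exact Hamiltonian flow, which
    preserves the Gibbs measure pi, is never used: it is replaced by the Metropolis
    adjustment of a Verlet integrator with step h / 2 ^ i, which preserves pi exactly for
    every i, because Verlet maps preserve volume and become involutions after a flip of the
    velocity. As i grows the energy error, hence the cost of the rejections, tends to 0.

    Starting from a coupling of the current law with pi, moving the two points with the same
    velocity therefore contracts the squared distance by 1 - m T^2 / 4, up to an error of
    order (M h T^2)^2 d. The initial cost is at most 4 d / m, by a scaling argument. *)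
From HB Require Import structures.
Require Import Defs.
From mathcomp Require Import all_boot all_order all_algebra.
From mathcomp Require Import all_classical all_reals all_analysis.
From mathcomp Require Import measurable_realfun.
From mathcomp Require Import ring lra zify.
Set Implicit Arguments.
Unset Strict Implicit.
Unset Printing Implicit Defensive.
Import Order.TTheory GRing.Theory Num.Theory.
Import numFieldNormedType.Exports.
Local Open Scope classical_set_scope.
Local Open Scope ring_scope.

(** * Calculus on R^n *)

(** The error of an iteration is measured along the trajectory that starts from the copy with law
    [pi], never along the one of the algorithm. Hence only moments of the Gibbs measure enter, and
    no moment bound has to be propagated along the chain. The Metropolis chain and its uniform
    variables belong to the analysis alone; the program runs the unadjusted integrator.

    Successive halvings of the step cost less and less, geometrically, so that their total is
    bounded uniformly in their number. The refinement level can therefore be fixed last, once the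
    tolerated cost of rejections is known.

    The choice of [T] is a balance. With T^2 = a / M the squared distance contracts at a rate of
    order a / kappa, so the number of iterations is of order kappa / a, up to the logarithm. Young's
    inequality divides the error of one iteration by the rate, and summing over iterations divides
    by it once more, which leaves a squared error of order kappa a d / (m K^2), so that K is of
    order sqrt (kappa a d) / eps. Taking a of order kappa^(-1/2) gives the exponents 3/2 and 1/4 of
    kappa. *)

Section dot.
Variables (R : realType) (d : nat).
Implicit Types (u v x y : 'rV[R]_d) (a b t : R).

Definition dotv u v : R := \sum_(i < d) u ord0 i * v ord0 i.

Lemma dotvC u v : dotv u v = dotv v u.
Proof. by apply: eq_bigr => i _; rewrite mulrC. Qed.

Lemma dotvDl u v x : dotv (u + v) x = dotv u x + dotv v x.
Proof. by rewrite -big_split; apply: eq_bigr => i _; rewrite mxE mulrDl. Qed.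

Lemma dotvZl a u x : dotv (a *: u) x = a * dotv u x.
Proof. by rewrite big_distrr; apply: eq_bigr => i _; rewrite mxE /= mulrA. Qed.

Lemma dotvNl u x : dotv (- u) x = - dotv u x.
Proof. by rewrite -scaleN1r dotvZl mulN1r. Qed.

Lemma dotvBl u v x : dotv (u - v) x = dotv u x - dotv v x.
Proof. by rewrite dotvDl dotvNl. Qed.

Lemma dotv0l x : dotv 0 x = 0.
Proof. by rewrite -(scale0r 0) dotvZl mul0r. Qed.

Lemma dotvDr u v x : dotv x (u + v) = dotv x u + dotv x v.
Proof. by rewrite !(dotvC x) dotvDl. Qed.

Lemma dotvZr a u x : dotv x (a *: u) = a * dotv x u.
Proof. by rewrite !(dotvC x) dotvZl. Qed.

Lemma dotvNr u x : dotv x (- u) = - dotv x u.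
Proof. by rewrite !(dotvC x) dotvNl. Qed.

Lemma dotvBr u v x : dotv x (u - v) = dotv x u - dotv x v.
Proof. by rewrite !(dotvC x) dotvBl. Qed.

Lemma dotv0r x : dotv x 0 = 0.
Proof. by rewrite dotvC dotv0l. Qed.

Lemma dotv_sumr (n : nat) (F : nat -> 'rV[R]_d) x :
  dotv x (\sum_(i < n) F i) = \sum_(i < n) dotv x (F i).
Proof.
elim: n => [|n IH]; first by rewrite !big_ord0 dotv0r.
by rewrite !big_ord_recr dotvDr IH.
Qed.

Lemma sqnorm2E v : sqnorm2 v = dotv v v.
Proof. by apply: eq_bigr => i _; rewrite expr2. Qed.

Lemma sqnorm2_ge0 v : 0 <= sqnorm2 v.
Proof. by apply: sumr_ge0 => i _; exact: sqr_ge0. Qed.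

Lemma sqnorm2_eq0 v : sqnorm2 v = 0 -> v = 0.
Proof.
move/eqP; rewrite psumr_eq0 => [/allP vv|i _]; last exact: sqr_ge0.
apply/rowP => i; rewrite mxE; apply/eqP.
by rewrite -sqrf_eq0; exact: (implyP (vv i (mem_index_enum _))).
Qed.

Lemma sqnorm20 : sqnorm2 (0 : 'rV[R]_d) = 0.
Proof. by rewrite sqnorm2E dotv0l. Qed.

Lemma sqnorm2Z a v : sqnorm2 (a *: v) = a ^+ 2 * sqnorm2 v.
Proof. by rewrite !sqnorm2E dotvZl dotvZr mulrA. Qed.

Lemma sqnorm2N v : sqnorm2 (- v) = sqnorm2 v.
Proof. by rewrite -scaleN1r sqnorm2Z sqrrN expr1n mul1r. Qed.

Lemma sqnorm2D u v : sqnorm2 (u + v) = sqnorm2 u + 2 * dotv u v + sqnorm2 v.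
Proof. rewrite !sqnorm2E dotvDl !dotvDr (dotvC v u); ring. Qed.

Lemma sqnorm2B u v : sqnorm2 (u - v) = sqnorm2 u - 2 * dotv u v + sqnorm2 v.
Proof. by rewrite sqnorm2D sqnorm2N dotvNr mulrN. Qed.

Lemma dotv_young u v : 2 * `|dotv u v| <= sqnorm2 u + sqnorm2 v.
Proof.
have := sqnorm2_ge0 (u + v); have := sqnorm2_ge0 (u - v).
rewrite sqnorm2B sqnorm2D; case: (ger0P (dotv u v)) => _; lra.
Qed.

(** Expand t^-1 |t u - v|^2 >= 0. The parameter is later taken to be half the contraction rate, so
    that the factor 1 + t does not destroy the contraction. *)
Lemma sqnorm2D_young t u v : 0 < t ->
  sqnorm2 (u + v) <= (1 + t) * sqnorm2 u + (1 + t^-1) * sqnorm2 v.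
Proof.
move=> t0; rewrite sqnorm2D.
have : 0 <= t^-1 * sqnorm2 (t *: u - v).
  by rewrite mulr_ge0 ?sqnorm2_ge0// invr_ge0 ltW.
rewrite sqnorm2B sqnorm2Z dotvZl mulrDr mulrBr expr2 -mulrA mulKf ?gt_eqF//.
rewrite (_ : t^-1 * (2 * (t * dotv u v)) = 2 * dotv u v); last first.
  by field; rewrite gt_eqF.
by lra.
Qed.

Lemma sqnorm2D_le u v : sqnorm2 (u + v) <= 2 * (sqnorm2 u + sqnorm2 v).
Proof. by have := @sqnorm2D_young 1 u v ltr01; rewrite invr1; lra. Qed.

Definition enorm v : R := Num.sqrt (sqnorm2 v).

Lemma enorm_ge0 v : 0 <= enorm v. Proof. exact: sqrtr_ge0. Qed.

Lemma sqr_enorm v : enorm v ^+ 2 = sqnorm2 v.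
Proof. by rewrite sqr_sqrtr// sqnorm2_ge0. Qed.

Lemma enorm0 : enorm (0 : 'rV[R]_d) = 0.
Proof. by rewrite /enorm sqnorm20 sqrtr0. Qed.

Lemma enormZ a v : enorm (a *: v) = `|a| * enorm v.
Proof. by rewrite /enorm sqnorm2Z sqrtrM ?sqr_ge0// sqrtr_sqr. Qed.

Lemma enormN v : enorm (- v) = enorm v.
Proof. by rewrite /enorm sqnorm2N. Qed.

Lemma enormB u v : enorm (u - v) = enorm (v - u).
Proof. by rewrite -opprB enormN. Qed.

Lemma enorm_le v a : 0 <= a -> sqnorm2 v <= a ^+ 2 -> enorm v <= a.
Proof. by move=> a0 va; rewrite -(ler_pXn2r (n := 2)) ?nnegrE ?enorm_ge0// sqr_enorm. Qed.

(** Cauchy-Schwarz, from the nonnegativity of the squared norm of |v|^2 u - (u . v) v. *)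
Lemma dotv_le_enorm u v : `|dotv u v| <= enorm u * enorm v.
Proof.
have [/eqP v0|v0] := boolP (sqnorm2 v == 0).
  by rewrite (sqnorm2_eq0 v0) dotv0r enorm0 normr0 mulr0.
have vp : 0 < sqnorm2 v by rewrite lt_neqAle eq_sym v0 sqnorm2_ge0.
rewrite -(ler_pXn2r (n := 2)) ?nnegrE ?mulr_ge0 ?enorm_ge0//.
rewrite exprMn !sqr_enorm real_normK ?num_real//.
have := sqnorm2_ge0 (sqnorm2 v *: u - dotv u v *: v).
rewrite sqnorm2B !sqnorm2Z dotvZl dotvZr.
rewrite (_ : _ + _ = sqnorm2 v * (sqnorm2 u * sqnorm2 v - dotv u v ^+ 2)).
  by rewrite pmulr_rge0// subr_ge0.
by ring.
Qed.

Lemma enormD u v : enorm (u + v) <= enorm u + enorm v.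
Proof.
apply: enorm_le; first by rewrite addr_ge0 ?enorm_ge0.
rewrite sqnorm2D sqrrD !sqr_enorm.
have := le_trans (ler_norm _) (dotv_le_enorm u v); lra.
Qed.

Lemma enormBD u v : enorm (u - v) <= enorm u + enorm v.
Proof. by rewrite -(enormN v) enormD. Qed.

Lemma enorm_sum (n : nat) (F : nat -> 'rV[R]_d) :
  enorm (\sum_(i < n) F i) <= \sum_(i < n) enorm (F i).
Proof.
elim: n => [|n IH]; first by rewrite !big_ord0 enorm0.
by rewrite !big_ord_recr /= (le_trans (enormD _ _))// lerD2r.
Qed.

(** Jensen's inequality for the squared norm with unnormalized weights; by induction, with Young's
    inequality on the cross terms. *)
Lemma sqnorm2_wsum (n : nat) (c : nat -> R) (F : nat -> 'rV[R]_d) :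
  (forall i, (i < n)%N -> 0 <= c i) ->
  sqnorm2 (\sum_(i < n) c i *: F i) <=
  (\sum_(i < n) c i) * (\sum_(i < n) c i * sqnorm2 (F i)).
Proof.
elim: n => [|n IH] c0; first by rewrite !big_ord0 sqnorm20 mul0r.
have {IH} := IH (fun i lin => c0 i (ltnW lin)).
have cn0 := c0 n (ltnSn n).
rewrite !big_ord_recr /= sqnorm2D sqnorm2Z dotvC dotvZl (dotv_sumr n (fun i => c i *: F i)).
have : 2 * (\sum_(i < n) dotv (F n) (c i *: F i)) <=
    (\sum_(i < n) c i) * sqnorm2 (F n) + \sum_(i < n) c i * sqnorm2 (F i).
  rewrite mulr_sumr mulr_suml -big_split; apply: ler_sum => /= i _.
  rewrite dotvZr mulrCA -mulrDr; apply: ler_wpM2l.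
    by apply: c0; exact: ltnW (ltn_ord i).
  apply: le_trans (dotv_young _ _); apply: ler_wpM2l => //; exact: ler_norm.
by move=> /(ler_wpM2l cn0); lra.
Qed.

End dot.

(** * Quadratic bounds on a function from bounds on its Hessian *)

Section calculus.
Variables (R : realType) (d : nat).
Implicit Types (x v : 'rV[R]_d).

Lemma is_derive_line (W : normedModType R) (f : 'rV[R]_d -> W) x v (t : R) :
  differentiable f (x + t *: v) ->
  is_derive t 1 (fun s : R => f (x + s *: v)) ('D_v f (x + t *: v)).
Proof.
move=> /(@diff_derivable _ _ _ _ _ v) df.
have E : (fun h : R => h^-1 *: (((fun s : R => f (x + s *: v)) \o shift t) (h *: 1) -
    f (x + t *: v))) =
  (fun h : R => h^-1 *: ((f \o shift (x + t *: v)) (h *: v) - f (x + t *: v))).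
  apply/funext => h /=; congr (_ *: (f _ - _)).
  by rewrite [_%:A]mulr1 scalerDl addrCA.
by split; rewrite ?/derivable ?/derive E.
Qed.

Lemma is_derive_coord n (F : R -> 'rV[R]_n) (t : R) (D : 'rV[R]_n) i :
  is_derive t 1 F D -> is_derive t 1 (fun s => F s ord0 i) (D ord0 i).
Proof.
move=> [dF <-].
have E : (fun h : R => h^-1 *: (((fun s => F s ord0 i) \o shift t) (h *: 1) - F t ord0 i)) =
  (fun M : 'rV_n => M ord0 i) \o (fun h : R => h^-1 *: ((F \o shift t) (h *: 1) - F t)).
  by apply/funext => h /=; rewrite !mxE.
have C : (fun h : R => h^-1 *: (((fun s => F s ord0 i) \o shift t) (h *: 1) - F t ord0 i)) @ 0^'
    --> ('D_1 F t) ord0 i.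
  rewrite E; apply: (@cvg_comp _ _ _ _ _ _ (nbhs ('D_1 F t))) => //.
  exact: coord_continuous.
split; first by apply/cvg_ex; eexists; exact: C.
exact: cvg_lim C.
Qed.

Variable (f : 'rV[R]_d -> R).
Hypothesis df2 : twice_differentiable f.

Lemma derive_gradient x v : 'D_v f x = dotv (gradient f x) v.
Proof.
have df := df2.1 x.
rewrite deriveE// {1}(row_sum_delta v) linear_sum; apply: eq_bigr => i _.
by rewrite linearZ /= mxE deriveE// mulrC.
Qed.

Lemma is_derive_fline x v (t : R) :
  is_derive t 1 (fun s : R => f (x + s *: v)) (dotv (gradient f (x + t *: v)) v).
Proof. by rewrite -derive_gradient; apply: is_derive_line; exact: df2.1. Qed.

Lemma is_derive_gline x v (t : R) :
  is_derive t 1 (fun s : R => dotv (gradient f (x + s *: v)) v)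
    ((v *m hessian f (x + t *: v) *m v^T) ord0 ord0).
Proof.
have H := is_derive_line (df2.2 (x + t *: v)).
rewrite deriveEjacobian in H; last exact: df2.2.
rewrite mxE.
under eq_bigr do rewrite [_^T _ _]mxE.
pose h (i : 'I_d) (s : R) := gradient f (x + s *: v) ord0 i * v ord0 i.
have -> : (fun s : R => dotv (gradient f (x + s *: v)) v) = \sum_(i < d) h i.
  by apply/funext => s; rewrite fct_sumE.
apply: is_derive_sum => i.
have Hi := is_derive_coord i H.
rewrite mulrC.
have -> : h i = (v ord0 i) \*: (fun s => gradient f (x + s *: v) ord0 i).
  by apply/funext => s; rewrite /h /= mulrC.
exact: is_deriveZ.
Qed.

Variables (m M : R).
Hypothesis mM : forall x,
  loewner_le m%:M (hessian f x) /\ loewner_le (hessian f x) M%:M.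

Lemma quad_scalar (a : R) v : (v *m a%:M *m v^T) ord0 ord0 = a * sqnorm2 v.
Proof.
rewrite mul_mx_scalar -scalemxAl mxE; congr (_ * _).
by rewrite mxE; apply: eq_bigr => i _; rewrite mxE expr2.
Qed.

Lemma hessian_bounds x v :
  m * sqnorm2 v <= (v *m hessian f x *m v^T) ord0 ord0 <= M * sqnorm2 v.
Proof.
have [/(_ v) + /(_ v)] := mM x.
have sub (A B : 'M[R]_1) : (A - B) ord0 ord0 = A ord0 ord0 - B ord0 ord0.
  by rewrite mxE [(- B) _ _]mxE.
rewrite !mulmxBr !mulmxBl !sub !quad_scalar.
by lra.
Qed.

Lemma within_continuous_is_derive (h dh : R -> R) (a b : R) :
  (forall t : R, is_derive t (1 : R) h (dh t)) -> {within `[a, b], continuous h}.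
Proof.
move=> dh'; apply: derivable_within_continuous => t _.
exact: ex_derive.
Qed.

Lemma gradient_monotone x v (t : R) : 0 <= t ->
  m * sqnorm2 v * t <= dotv (gradient f (x + t *: v)) v - dotv (gradient f x) v
    <= M * sqnorm2 v * t.
Proof.
move=> t0.
have := @MVT_segment R (fun s : R => dotv (gradient f (x + s *: v)) v) _ 0 t t0
  (fun s _ => @is_derive_gline x v s)
  (within_continuous_is_derive (@is_derive_gline x v)).
rewrite scale0r addr0 subr0 => -[c _ ->].
have /andP[? ?] := hessian_bounds (x + c *: v) v.
by rewrite !ler_wpM2r.
Qed.

(** The Taylor remainder along a line, with [a] standing for m |v|^2 or M |v|^2. Since
    [gradient_monotone] gives the sign of its derivative, one application of the mean value theorem
    yields each quadratic bound. *)
Lemma line_taylor (a : R) x v (t : R) :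
  is_derive t 1 (fun s : R => f (x + s *: v) - dotv (gradient f x) v * s
      - a / 2 * (s * s))
    (dotv (gradient f (x + t *: v)) v - dotv (gradient f x) v - a * t).
Proof.
have H1 := @is_derive_fline x v t.
have H2 : is_derive t 1 (fun s : R => s) (1 : R) by exact: is_derive_id.
have H3 : is_derive t 1 (fun s : R => s * s) (t * 1 + t * 1 : R) by exact: is_deriveM.
have H4 := @is_deriveZ _ _ _ _ (dotv (gradient f x) v) t 1 _ H2.
have H5 := @is_deriveZ _ _ _ _ (a / 2) t 1 _ H3.
have := @is_deriveB _ _ _ _ _ _ _ _ _ (@is_deriveB _ _ _ _ _ _ _ _ _ H1 H4) H5.
move=> H; apply: is_derive_eq H _.
rewrite [_ *: 1]mulr1 -[a / 2 *: _]/(a / 2 * _) !mulr1; by lra.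
Qed.

Lemma strong_convexity x y :
  m / 2 * sqnorm2 (y - x) <= f y - f x - dotv (gradient f x) (y - x).
Proof.
set v := y - x.
have [] := @MVT_segment R _ _ 0 1 ler01
  (fun s _ => @line_taylor (m * sqnorm2 v) x v s)
  (within_continuous_is_derive (@line_taylor (m * sqnorm2 v) x v)).
move=> c /[!in_itv]/= /andP[c0 _].
rewrite scale0r addr0 scale1r {1}/v (addrC x) subrK.
have /andP[+ _] := gradient_monotone x v c0.
by lra.
Qed.

Lemma descent x y :
  f y - f x - dotv (gradient f x) (y - x) <= M / 2 * sqnorm2 (y - x).
Proof.
set v := y - x.
have [] := @MVT_segment R _ _ 0 1 ler01
  (fun s _ => @line_taylor (M * sqnorm2 v) x v s)
  (within_continuous_is_derive (@line_taylor (M * sqnorm2 v) x v)).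
move=> c /[!in_itv]/= /andP[c0 _].
rewrite scale0r addr0 scale1r {1}/v (addrC x) subrK.
have /andP[_ +] := gradient_monotone x v c0.
by lra.
Qed.

End calculus.

(** * Smooth strongly convex functions and the Verlet integrator *)

Section smooth_convex.
Variables (R : realType) (d : nat) (f : 'rV[R]_d -> R) (g : 'rV[R]_d -> 'rV[R]_d).
Variables (m M : R).
Implicit Types x y : 'rV[R]_d.

(** All that the analysis retains of the Hessian: a two-sided bound on the Bregman divergence, with
    [g] tied to [f] by nothing else. The gaussian potential satisfies it too, with m = M = 1 and the
    identity as gradient. *)
Definition smooth_strongly_convex :=
  [/\ 0 < m, m <= M & forall x y, m / 2 * sqnorm2 (y - x) <=
    f y - f x - dotv (g x) (y - x) <= M / 2 * sqnorm2 (y - x)].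

Hypothesis fg : smooth_strongly_convex.

Let m0 : 0 < m. Proof. by case: fg. Qed.
Let M0 : 0 < M. Proof. by case: fg => ? ? _; lra. Qed.
Let lo x y : m / 2 * sqnorm2 (y - x) <= f y - f x - dotv (g x) (y - x).
Proof. by case: fg => _ _ /(_ x y)/andP[]. Qed.
Let hi x y : f y - f x - dotv (g x) (y - x) <= M / 2 * sqnorm2 (y - x).
Proof. by case: fg => _ _ /(_ x y)/andP[]. Qed.

Lemma gradient_strongly_monotone x y :
  m * sqnorm2 (y - x) <= dotv (g y - g x) (y - x).
Proof.
have := lo x y; have := lo y x.
rewrite -opprB sqnorm2N dotvNr dotvBl; lra.
Qed.

Lemma bregman_ge x y :
  sqnorm2 (g y - g x) / (2 * M) <= f y - f x - dotv (g x) (y - x).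
Proof.
(* [p] minimizes the quadratic upper model at [y] of the convex function that maps z to f z - g x .
   z, whose minimum is at [x]. *)
set b := g y - g x; pose p := y - M^-1 *: b.
have := lo x p; have := hi y p.
have -> : p - y = - (M^-1 *: b) by rewrite /p addrAC subrr add0r.
have -> : p - x = (y - x) - M^-1 *: b by rewrite /p addrAC.
rewrite sqnorm2N sqnorm2Z dotvNr (dotvBr (y - x)) !dotvZr => H1 H2.
have H3 : dotv (g y) b - dotv (g x) b = sqnorm2 b by rewrite -dotvBl -sqnorm2E.
have : 0 <= m / 2 * sqnorm2 (y - x - M^-1 *: b) by rewrite mulr_ge0 ?sqnorm2_ge0//; have := m0; lra.
have E1 : M / 2 * (M^-1 ^+ 2 * sqnorm2 b) = sqnorm2 b / (2 * M) by field; have := M0; lra.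
have E2 : M^-1 * dotv (g y) b - M^-1 * dotv (g x) b = 2 * (sqnorm2 b / (2 * M)).
  by rewrite -mulrBr H3; field; have := M0; lra.
move: E2 H1 H2; rewrite E1 => {E1}; move: (_ / (2 * M)) => q.
by move: (M^-1 * _) (M^-1 * _) => a c; lra.
Qed.

(** Baillon-Haddad: add the Bregman bounds for (x, y) and (y, x). *)
Lemma gradient_cocoercive x y :
  sqnorm2 (g y - g x) <= M * dotv (g y - g x) (y - x).
Proof.
have H1 := bregman_ge x y; have H2 := bregman_ge y x.
have E : sqnorm2 (g y - g x) / (2 * M) * (2 * M) = sqnorm2 (g y - g x) by field; have := M0; lra.
have : 0 <= (dotv (g y - g x) (y - x) - 2 * (sqnorm2 (g y - g x) / (2 * M))) * M.
  apply: mulr_ge0; last exact: ltW M0.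
  move: H1 H2; rewrite -(opprB (g y)) -(opprB y) !sqnorm2N dotvNr !dotvBl.
  by move: (_ / (2 * M)) => q; lra.
by move: E; lra.
Qed.

Lemma gradient_lipschitz x y : enorm (g y - g x) <= M * enorm (y - x).
Proof.
have := gradient_cocoercive x y.
have := le_trans (ler_norm _) (dotv_le_enorm (g y - g x) (y - x)).
rewrite -sqr_enorm; have := enorm_ge0 (g y - g x).
set a := enorm (g y - g x); have := enorm_ge0 (y - x); set b := enorm (y - x).
move=> b0 a0 H1 H2; case: (ltrP 0 a) => [ap|]; last first.
  by move=> /le_trans; apply; rewrite mulr_ge0// ltW// M0.
rewrite -(ler_pM2r ap) -mulrA (mulrC b) -expr2 (le_trans H2)// ler_pM2l//.
Qed.

Variable x0 : 'rV[R]_d.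
Hypothesis x0min : forall y, f x0 <= f y.

(** A gradient step of length 1 / M from [y] cannot fall below the minimum. *)
Lemma sqnorm2_gradient_le y : sqnorm2 (g y) <= 2 * M * (f y - f x0).
Proof.
pose p := y - M^-1 *: g y.
have := hi y p; have := x0min p.
have -> : p - y = - (M^-1 *: g y) by rewrite /p addrAC subrr add0r.
rewrite sqnorm2N sqnorm2Z dotvNr dotvZr -sqnorm2E => H1 H2.
have E1 : M / 2 * (M^-1 ^+ 2 * sqnorm2 (g y)) = M^-1 * (sqnorm2 (g y) / 2) by field; have := M0; lra.
have : 0 <= (f y - f x0 - M^-1 * (sqnorm2 (g y) / 2)) * (2 * M).
  by apply: mulr_ge0; move: H2; rewrite ?E1; have := M0; lra.
rewrite mulrBl (_ : M^-1 * _ * _ = sqnorm2 (g y)); last by field; have := M0; lra.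
by lra.
Qed.

Lemma gradient_argmin : g x0 = 0.
Proof.
apply: sqnorm2_eq0; have := sqnorm2_gradient_le x0; have := sqnorm2_ge0 (g x0).
rewrite subrr mulr0; lra.
Qed.

Lemma sqdist_argmin_le y : m * sqnorm2 (y - x0) <= 2 * (f y - f x0).
Proof. by have := lo x0 y; rewrite gradient_argmin dotv0l; lra. Qed.

End smooth_convex.

(** * The Verlet integrator as a discrete integral equation *)

Section verlet.
Variables (R : realType) (d : nat) (g : 'rV[R]_d -> 'rV[R]_d).
Implicit Types (p : 'rV[R]_d * 'rV[R]_d) (h : R) (k j n : nat).

Definition kick h p := (p.1, p.2 - h *: g p.1).
Definition drift h p := (p.1 + h *: p.2, p.2).
Definition vstep h p := kick (h / 2) (drift h (kick (h / 2) p)).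
Definition verlet h k p := iter k (vstep h) p.

(* The weights of the discrete form of x(t) = x + t v - int_0^t (t - s) g(x(s)) ds;
   the end point s = 0 has the trapezoidal weight 1/2. *)
Definition wt k j : R := if j == 0%N then k%:R / 2 else k%:R - j%:R.

Lemma wt_ge0 k j : (j <= k)%N -> 0 <= wt k j.
Proof.
rewrite /wt; case: eqP => _; first by rewrite divr_ge0.
by rewrite -(ler_nat R) subr_ge0.
Qed.

Lemma wt_le n k j : (k <= n)%N -> wt k j <= wt n j.
Proof. by rewrite -(ler_nat R) /wt; case: eqP => _; lra. Qed.

Lemma sum_wt k : \sum_(j < k) wt k j = k%:R ^+ 2 / 2.
Proof.
case: k => [|k]; first by rewrite big_ord0 expr0n mul0r.
rewrite big_ord_recl /= /wt /=.
have -> : \sum_(i < k) (k.+1%:R - (lift ord0 i)%:R) = k%:R * (k%:R + 1) / 2 :> R.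
  elim: k => [|k IH]; first by rewrite big_ord0 !mul0r.
  rewrite big_ord_recl /= /bump /= (eq_bigr (fun i : 'I_k => k.+1%:R - (lift ord0 i)%:R)).
    by rewrite IH -!natr1; field.
  by move=> i _; rewrite /= /bump /= !add1n -!natr1; lra.
by rewrite -natr1; field.
Qed.

(* First differences of [\sum_(j < k) wt k j *: G j]. *)
Definition wt_diff (V : lmodType R) (G : nat -> V) k :=
  2^-1 *: G 0%N + \sum_(i < k) G i.+1.

Lemma sum_wtS (V : lmodType R) (G : nat -> V) k :
  \sum_(j < k.+1) wt k.+1 j *: G j = \sum_(j < k) wt k j *: G j + wt_diff G k.
Proof.
(* The increments of the weights are the coefficients of [wt_diff]; since [wt k k] vanishes, the old
   sum may be read as running up to j = k. *)
have wtS j : wt k.+1 j = wt k j + (if j == 0%N then 2^-1 else 1).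
  by rewrite /wt; case: eqP => _; rewrite -natr1; lra.
have wtkk : wt k k = 0 by rewrite /wt; case: eqP => [->|_]; lra.
under eq_bigr do rewrite wtS scalerDl.
rewrite big_split /= big_ord_recr /= wtkk scale0r addr0; congr (_ + _).
rewrite big_ord_recl /=; congr (_ + _).
by apply: eq_bigr => i _; rewrite scale1r.
Qed.

Variables (h : R) (p : 'rV[R]_d * 'rV[R]_d).
Let X k := (verlet h k p).1.
Let V k := (verlet h k p).2.
Let G k := g (X k).

Lemma verletS k : X k.+1 = X k + h *: (V k - (h / 2) *: G k) /\
  V k.+1 = V k - (h / 2) *: (G k + G k.+1).
Proof.
rewrite /X /V /G /verlet /= /vstep /kick /drift /=; split => //.
by rewrite (scalerDr (h / 2)) opprD addrA.
Qed.

(** The velocity in the middle of step k. The two half kicks at an inner position merge into a full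
    one, so only the first gradient keeps the weight 1/2. *)
Lemma verlet_velocity k : V k - (h / 2) *: G k = p.2 - h *: wt_diff G k.
Proof.
elim: k => [|k IH].
  by rewrite /wt_diff big_ord0 addr0 scalerA.
rewrite (verletS k).2 scalerDr opprD addrA IH -addrA -opprD -scalerDl -splitr.
by rewrite -addrA -opprD -scalerDr /wt_diff big_ord_recr /= addrA.
Qed.

(** Obtained by summing the mid-step velocities. Only gradients at earlier positions occur, which
    permits strong induction, and the initial velocity enters additively, so it cancels between
    trajectories that share it. *)
Lemma verlet_position k :
  X k = p.1 + (k%:R * h) *: p.2 - h ^+ 2 *: \sum_(j < k) wt k j *: G j.
Proof.
elim: k => [|k IH]; first by rewrite big_ord0 scaler0 mul0r scale0r subr0 addr0.
rewrite (verletS k).1 verlet_velocity IH sum_wtS scalerBr scalerA -expr2.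
rewrite -natr1 mulrDl mul1r scalerDl (scalerDr (h ^+ 2) (\sum_(j < k) _)).
by rewrite (addrA p.1) opprD addrACA.
Qed.

End verlet.

(** * Contraction of discrete integral equations with a co-coercive field *)

Section contraction.
Variables (R : realType) (d : nat).

(** Here [D] is the difference of two trajectories and [a] that of their gradients. Expanding |D
    n|^2 gives |D 0|^2 - 2 Q + 3 W S, where co-coercivity bounds S by M Q. The smallness of W M
    makes 3 W S at most Q / 2, and strong monotonicity bounds Q from below by nearly m W |D 0|^2 /
    2. *)
Lemma wsum_contraction (n : nat) (w : nat -> nat -> R) (D a : nat -> 'rV[R]_d)
    (m M W : R) :
  0 < m -> m <= M -> W = \sum_(j < n) w n j -> W * M <= 6^-1 ->
  (forall k j, (j < k)%N -> (k <= n)%N -> 0 <= w k j <= w n j) ->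
  (forall k, (k <= n)%N -> D k = D 0%N - \sum_(j < k) w k j *: a j) ->
  (forall j, sqnorm2 (a j) <= M * dotv (a j) (D j)) ->
  (forall j, m * sqnorm2 (D j) <= dotv (a j) (D j)) ->
  sqnorm2 (D n) <= (1 - m * W / 2) * sqnorm2 (D 0%N).
Proof.
move=> m0 mM WE WM w0 DE aM aD.
have w0n (j : 'I_n) : 0 <= w n j by have /andP[] := w0 n j (ltn_ord j) (leqnn n).
have W0 : 0 <= W by rewrite WE; apply: sumr_ge0 => j _; exact: w0n.
pose S := \sum_(j < n) w n j * sqnorm2 (a j).
pose Q := \sum_(j < n) w n j * dotv (a j) (D j).
have S0 : 0 <= S by apply: sumr_ge0 => j _; rewrite mulr_ge0 ?sqnorm2_ge0.
have SQ : S <= M * Q.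
  rewrite mulr_sumr; apply: ler_sum => j _; rewrite mulrCA; exact: ler_wpM2l.
have widen k (F : nat -> R) : (k <= n)%N -> (forall j, 0 <= F j) ->
    \sum_(j < k) w k j * F j <= \sum_(j < n) w n j * F j.
  move=> kn F0; rewrite (big_ord_widen _ (fun j => w k j * F j) kn) big_mkcond /=.
  apply: ler_sum => j _; case: ifP => jk; last by rewrite mulr_ge0.
  by apply: ler_wpM2r => //; have /andP[] := w0 _ _ jk kn.
have widen1 k : (k <= n)%N -> \sum_(j < k) w k j <= W.
  move=> kn; have := widen k (fun=> 1) kn (fun=> ler01).
  by under eq_bigr do rewrite mulr1; under [X in _ <= X]eq_bigr do rewrite mulr1; rewrite -WE.
(* The displacement up to any intermediate time, by Jensen and the domination of the weights [w k]
   by [w n]. *)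
have B k : (k <= n)%N -> sqnorm2 (D 0%N - D k) <= W * S.
  move=> kn; rewrite [D k]DE// opprB addrCA subrr addr0.
  have wk0 j : (j < k)%N -> 0 <= w k j by move=> jk; have /andP[] := w0 _ _ jk kn.
  apply: (le_trans (sqnorm2_wsum a wk0)).
  apply: ler_pM; [| |exact: widen1|].
  - by apply: sumr_ge0 => j _; exact: wk0.
  - by apply: sumr_ge0 => j _; rewrite mulr_ge0 ?sqnorm2_ge0 ?wk0.
  - by apply: (widen k (fun j => sqnorm2 (a j))) => // j; exact: sqnorm2_ge0.
(* The expansion of |D n|^2 pairs [a j] with [D 0], but monotonicity and co-coercivity concern its
   pairing with [D j]. The difference consists of products of [a j] with earlier [a i], which
   Young's inequality absorbs. *)
have C (j : 'I_n) : dotv (a j) (D j) - 2^-1 * (W * sqnorm2 (a j) + S) <= dotv (a j) (D 0%N).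
  have -> : D 0%N = D j + \sum_(i < j) w j i *: a i by rewrite [D j]DE ?subrK// ltnW.
  rewrite dotvDr lerD2l (dotv_sumr j (fun i => w j i *: a i)).
  have : - \sum_(i < j) dotv (a j) (w j i *: a i) <=
      \sum_(i < j) w j i * (2^-1 * (sqnorm2 (a j) + sqnorm2 (a i))).
    rewrite -sumrN; apply: ler_sum => i _; rewrite dotvZr -mulrN.
    apply: ler_wpM2l; first by have /andP[] := w0 _ _ (ltn_ord i) (ltnW (ltn_ord j)).
    have := dotv_young (a j) (a i); have := ler_norm (- dotv (a j) (a i)).
    by rewrite normrN; lra.
  have := widen j (fun i => 2^-1 * (sqnorm2 (a j) + sqnorm2 (a i))) (ltnW (ltn_ord j)).
  have E : \sum_(i < n) w n i * (2^-1 * (sqnorm2 (a j) + sqnorm2 (a i))) =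
      2^-1 * (W * sqnorm2 (a j) + S).
    under eq_bigr do rewrite mulrCA mulrDr.
    by rewrite -mulr_sumr big_split /= -mulr_suml -WE.
  rewrite E => H1 H2; rewrite lerNl (le_trans H2)// H1// => i.
  by rewrite mulr_ge0// addr_ge0 ?sqnorm2_ge0.
have E0 : sqnorm2 (D n) <= sqnorm2 (D 0%N) - 2 * (Q - W * S) + W * S.
  have H := B n (leqnn n).
  have EDn : D 0%N - D n = \sum_(j < n) w n j *: a j.
    by rewrite [D n]DE// opprB addrCA subrr addr0.
  have -> : sqnorm2 (D n) = sqnorm2 (D 0%N - (D 0%N - D n)).
    by rewrite opprB addrCA subrr addr0.
  rewrite sqnorm2B; apply: lerD => //; rewrite EDn (dotv_sumr n (fun i => w n i *: a i)).
  rewrite lerD2l lerN2; apply: ler_wpM2l => //.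
  rewrite (_ : Q - W * S =
      \sum_(j < n) w n j * (dotv (a j) (D j) - 2^-1 * (W * sqnorm2 (a j) + S))).
    by apply: ler_sum => j _; rewrite dotvZr (dotvC (D 0%N)); apply: ler_wpM2l; [exact: w0n|exact: C].
  under [RHS]eq_bigr do rewrite mulrBr.
  rewrite sumrB; congr (_ - _).
  under eq_bigr do rewrite mulrCA mulrDr mulrCA.
  rewrite -mulr_sumr big_split /= -mulr_sumr -/S -mulr_suml -WE; lra.
(* From |D 0|^2 <= 2 |D j|^2 + 2 |D 0 - D j|^2 and the displacement bound. *)
have LQ : W * (m * (sqnorm2 (D 0%N) / 2 - W * S)) <= Q.
  rewrite {1}WE mulr_suml; apply: ler_sum => j _; apply: ler_wpM2l => //.
  apply: le_trans (aD j); apply: ler_wpM2l; first exact: ltW.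
  have := sqnorm2D_le (D j) (D 0%N - D j); have := B j (ltnW (ltn_ord j)).
  by rewrite addrCA subrr addr0; lra.
have N0 := sqnorm2_ge0 (D 0%N); move: (sqnorm2 (D 0%N)) (sqnorm2 (D n)) N0 E0 LQ.
move=> z zn z0 E0 LQ.
have Q0 : 0 <= Q.
  by have := le_trans S0 SQ; rewrite pmulr_rge0//; lra.
(* The constant 1/6 enters here: |D n|^2 <= |D 0|^2 - 3 Q / 2, while (1 + 1/36) Q >= m W |D 0|^2 /
   2. *)
have WS : W * S <= Q / 6.
  by apply: le_trans (ler_wpM2l W0 SQ) _; rewrite mulrA mulrC; exact: ler_wpM2l.
have Wm : W * m <= 6^-1 by apply: le_trans WM; exact: ler_wpM2l.
have Wm0 : 0 <= W * m by rewrite mulr_ge0// ltW.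
have : W * m * (z / 2) - W * m * (Q / 6) <= Q.
  by apply: le_trans LQ; rewrite -mulrBr -mulrA; apply: ler_wpM2l => //; apply: ler_wpM2l; lra.
have : W * m * (Q / 6) <= Q / 36 by nra.
lra.
Qed.

End contraction.

Section verlet_contraction.
Variables (R : realType) (d : nat) (f : 'rV[R]_d -> R) (g : 'rV[R]_d -> 'rV[R]_d).
Variables (m M : R).
Hypothesis fg : smooth_strongly_convex f g m M.

(** The shared velocity cancels, so the difference solves the equation of [wsum_contraction] with
    weights h^2 [wt]. Their total is (n h)^2 / 2, which turns 1/6 into 1/3. *)
Lemma verlet_contraction (n : nat) (h : R) x y z :
  (n%:R * h) ^+ 2 * M <= 3^-1 ->
  sqnorm2 ((verlet g h n (x, z)).1 - (verlet g h n (y, z)).1) <=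
  (1 - m * (n%:R * h) ^+ 2 / 4) * sqnorm2 (x - y).
Proof.
move=> TM; have [m0 mM _] := fg.
pose X k := (verlet g h k (x, z)).1; pose Y k := (verlet g h k (y, z)).1.
pose W : R := (n%:R * h) ^+ 2 / 2.
have -> : m * (n%:R * h) ^+ 2 / 4 = m * W / 2 by rewrite /W; field.
apply: (@wsum_contraction _ _ n (fun k j => h ^+ 2 * wt R k j) (fun k => X k - Y k)
  (fun k => g (X k) - g (Y k)) m M W) => //.
- by rewrite -mulr_sumr sum_wt /W; field.
- by rewrite /W; lra.
- move=> k j jk kn; rewrite mulr_ge0 ?sqr_ge0 ?wt_ge0 ?(ltnW jk)//=.
  by rewrite ler_wpM2l ?sqr_ge0// wt_le.
- move=> k _; rewrite /X /Y !verlet_position /= -!/(X _) -!/(Y _).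
  under [X in _ = _ - X]eq_bigr do rewrite -scalerA scalerBr scalerBr.
  rewrite sumrB -!scaler_sumr opprB !opprD !opprK !addrA.
  by apply/rowP => i; rewrite !mxE; ring.
- by move=> j; exact: gradient_cocoercive fg _ _.
- by move=> j; exact: gradient_strongly_monotone fg _ _.
Qed.

End verlet_contraction.

(** * Comparison of two quadrature rules, one of half the step *)

Section wt_double.
Variable R : realType.

(** The rule with nodes 0, ..., 2k against the rule on the even nodes; the factor 4 is the squared
    ratio of the step sizes. Their difference sees [s] only through its deviation from linear
    interpolation at odd nodes and its total variation between the end points, both small when
    consecutive values are close. *)
Lemma sum_wt_double (s : nat -> R) k :
  \sum_(j < k.*2) wt R k.*2 j * s j - 4 * \sum_(i < k) wt R k i * s i.*2 =
  \sum_(i < k) (2 * (k%:R - i%:R) - 1) * (s i.*2.+1 - (s i.*2 + s i.*2.+2) / 2) +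
  (s k.*2 - s 0%N) / 2.
Proof.
pose c i := s i.*2.+1 - (s i.*2 + s i.*2.+2) / 2.
pose wtd (s : nat -> R) k := 2^-1 * s 0%N + \sum_(i < k) s i.+1.
have SS (t : nat -> R) l :
    \sum_(j < l.+1) wt R l.+1 j * t j = \sum_(j < l) wt R l j * t j + wtd t l.
  exact: (@sum_wtS _ R^o t l).
(* The same comparison for first differences, which drives the induction. *)
have A l : wtd s l.*2 = \sum_(i < l) c i + 2 * wtd (fun i => s i.*2) l - s l.*2 / 2.
  elim: l => [|l IH]; first by rewrite /wtd !big_ord0; lra.
  move: IH; rewrite /wtd doubleS !big_ord_recr /= /c doubleS; lra.
rewrite -/c; elim: k => [|k IH]; first by rewrite !big_ord0; lra.
rewrite doubleS (SS s) (SS s k.*2) (SS (fun i => s i.*2)).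
have -> : wtd s k.*2.+1 = wtd s k.*2 + s k.*2.+1 by rewrite /wtd big_ord_recr /= addrA.
rewrite A [in RHS]big_ord_recr /=.
have -> : \sum_(i < k) (2 * (k.+1%:R - i%:R) - 1) * c i =
    \sum_(i < k) (2 * (k%:R - i%:R) - 1) * c i + 2 * \sum_(i < k) c i.
  rewrite mulr_sumr -big_split; apply: eq_bigr => i _ /=.
  by rewrite -natr1; ring.
by move: IH; rewrite -natr1 /c; lra.
Qed.

Lemma sum_odd_wt (k : nat) : \sum_(i < k) (2 * (k%:R - i%:R) - 1) = k%:R ^+ 2 :> R.
Proof.
elim: k => [|k IH]; first by rewrite big_ord0 expr0n.
rewrite big_ord_recr /= -[in RHS]natr1 sqrrD1 -IH.
have -> : \sum_(i < k) (2 * (k.+1%:R - i%:R) - 1) =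
    \sum_(i < k) (2 * (k%:R - i%:R) - 1) + k%:R * 2 :> R.
  have -> : k%:R * 2 = \sum_(i < k) 2 :> R by rewrite sumr_const card_ord mulr_natl.
  by rewrite -big_split; apply: eq_bigr => i _ /=; rewrite -natr1; ring.
by rewrite -natr1; ring.
Qed.

End wt_double.

(** * A priori bounds on Verlet trajectories and the effect of halving the step *)

Section verlet_bounds.
Variables (R : realType) (d : nat) (g : 'rV[R]_d -> 'rV[R]_d) (M T : R).
Hypothesis M0 : 0 < M.
Hypothesis gL : forall x y, enorm (g y - g x) <= M * enorm (y - x).
Hypothesis T0 : 0 <= T.
Hypothesis MT : M * T ^+ 2 <= 4^-1.
Variables (x v : 'rV[R]_d).

(** With [verlet_speed], a bound on gradients and velocities along every Verlet trajectory of
    duration at most [T], whatever the step size. The factors 2 leave room for the feedback of the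
    force, which M T^2 <= 1/4 keeps small. *)
Let G0 : R := 2 * (enorm (g x) + M * T * enorm v).
Definition verlet_speed : R := 2 * (enorm v + T * enorm (g x)).

Let G00 : 0 <= G0.
Proof. by rewrite mulr_ge0// addr_ge0 ?mulr_ge0 ?enorm_ge0// ltW. Qed.

Let speedE : enorm v + T * G0 <= verlet_speed.
Proof.
rewrite /G0 /verlet_speed.
have : M * T ^+ 2 * enorm v <= 4^-1 * enorm v by rewrite ler_wpM2r ?enorm_ge0.
have := enorm_ge0 v; lra.
Qed.

Lemma verlet_speed_ge0 : 0 <= verlet_speed.
Proof. by rewrite mulr_ge0// addr_ge0 ?mulr_ge0 ?enorm_ge0. Qed.

Section step_size.
Variables (h : R) (n : nat).
Hypothesis h0 : 0 <= h.
Hypothesis nhT : n%:R * h <= T.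
Let X k := (verlet g h k (x, v)).1.
Let V k := (verlet g h k (x, v)).2.

Let jhT j : (j <= n)%N -> j%:R * h <= T.
Proof. by move=> jn; apply: le_trans nhT; rewrite ler_wpM2r// ler_nat. Qed.

(** Strong induction through the integral form. It closes because |g x| + M T |v| is half of [G0]
    and the remaining M T^2 / 2 times [G0] is at most an eighth of it. *)
Lemma verlet_bound j : (j <= n)%N ->
  enorm (X j - x) <= T * enorm v + T ^+ 2 / 2 * G0 /\ enorm (g (X j)) <= G0.
Proof.
elim/ltn_ind: j => j IH jn.
have B : enorm (X j - x) <= T * enorm v + T ^+ 2 / 2 * G0.
  rewrite /X verlet_position /= -[x + _ - _]addrA (addrC x) addrK.
  apply: le_trans (enormBD _ _) _; rewrite !enormZ; apply: lerD.
    rewrite ler_wpM2r ?enorm_ge0// ger0_norm ?mulr_ge0//; exact: jhT.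
  rewrite ger0_norm ?sqr_ge0//.
  apply: le_trans (ler_wpM2l (sqr_ge0 h) (enorm_sum _ (fun i => wt R j i *: g (X i)))) _.
  have H : \sum_(i < j) enorm (wt R j i *: g (X i)) <= \sum_(i < j) wt R j i * G0.
    apply: ler_sum => i _; rewrite enormZ ger0_norm ?wt_ge0 ?(ltnW (ltn_ord i))//.
    rewrite ler_wpM2l ?wt_ge0 ?(ltnW (ltn_ord i))//.
    by have [] := IH i (ltn_ord i) (ltnW (leq_trans (ltn_ord i) jn)).
  apply: le_trans (ler_wpM2l (sqr_ge0 h) H) _.
  rewrite -mulr_suml sum_wt.
  have jT : (j%:R * h) ^+ 2 <= T ^+ 2 by rewrite ler_sqr ?nnegrE ?mulr_ge0// jhT.
  by have := ler_wpM2r G00 jT; lra.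
split => //.
have -> : g (X j) = g x + (g (X j) - g x) by rewrite addrC subrK.
apply: le_trans (enormD _ _) _.
have := le_trans (gL x (X j)) (ler_wpM2l (ltW M0) B).
have : M * T ^+ 2 * G0 <= 4^-1 * G0 by rewrite ler_wpM2r.
have : G0 = 2 * (enorm (g x) + M * T * enorm v) by []. move: G00; lra.
Qed.

Lemma verlet_velocity_bound j : (j < n)%N ->
  enorm (V j - (h / 2) *: g (X j)) <= verlet_speed.
Proof.
move=> jn; rewrite /V /X (verlet_velocity g h (x, v) j) /=; apply: le_trans speedE.
apply: le_trans (enormBD _ _) _; rewrite lerD2l enormZ ger0_norm//.
apply: (@le_trans _ _ (h * ((j%:R + 2^-1) * G0))); last first.
  have jT : (j%:R + 2^-1) * h <= T by have := jhT jn; have := h0; rewrite -natr1; lra.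
  by have := ler_wpM2r G00 jT; lra.
rewrite ler_wpM2l//; apply: le_trans (enormD _ _) _.
rewrite enormZ ger0_norm ?invr_ge0// mulrDl addrC lerD//; last first.
  by rewrite ler_wpM2l ?invr_ge0//; have [] := @verlet_bound 0%N isT.
apply: le_trans (enorm_sum _ (fun i => g (X i.+1))) _.
have -> : j%:R * G0 = \sum_(i < j) G0 by rewrite sumr_const card_ord mulr_natl.
by apply: ler_sum => i _; have [] := @verlet_bound i.+1 (leq_trans (ltn_ord i) (ltnW jn)).
Qed.

Lemma verlet_step_bound j : (j < n)%N -> enorm (X j.+1 - X j) <= h * verlet_speed.
Proof.
move=> jn; rewrite /X (verletS g h (x, v) j).1 addrAC subrr add0r enormZ ger0_norm//.
by rewrite ler_wpM2l// verlet_velocity_bound.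
Qed.

Lemma verlet_gradient_step j : (j < n)%N ->
  enorm (g (X j.+1) - g (X j)) <= M * (h * verlet_speed).
Proof. by move=> jn; rewrite (le_trans (gL _ _))// ler_pM2l// verlet_step_bound. Qed.

Lemma verlet_displacement k : (k <= n)%N -> enorm (X k - x) <= k%:R * (h * verlet_speed).
Proof.
elim: k => [|k IH] kn; first by rewrite /X subrr enorm0 mul0r.
have -> : X k.+1 - x = (X k.+1 - X k) + (X k - x) by rewrite addrA subrK.
rewrite (le_trans (enormD _ _))// -natr1 mulrDl mul1r addrC lerD ?IH ?(ltnW kn)//.
exact: verlet_step_bound.
Qed.

End step_size.

(** Consistency and stability. With B = M h speed T^2, the quadrature defect along the fine
    trajectory is at most B / 4; the difference of the gradients feeds back at most M T^2 / 2 times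
    M-free B / 2, by strong induction on k, which is again below B / 4. *)
Lemma verlet_halving (h : R) (n k : nat) : 0 <= h -> n%:R * h <= T -> (k <= n)%N ->
  enorm ((verlet g h k (x, v)).1 - (verlet g (h / 2) k.*2 (x, v)).1) <=
  M * h * verlet_speed * T ^+ 2 / 2.
Proof.
move=> h0 nhT.
pose X k := (verlet g h k (x, v)).1; pose Y k := (verlet g (h / 2) k (x, v)).1.
have nhT' : n.*2%:R * (h / 2) <= T.
  by rewrite -muln2 natrM; apply: le_trans nhT; rewrite le_eqVlt; apply/orP; left; apply/eqP; field.
have h20 : 0 <= h / 2 by rewrite divr_ge0.
have S0 := verlet_speed_ge0.
pose c i := g (Y i.*2.+1) - 2^-1 *: (g (Y i.*2) + g (Y i.*2.+2)).
have dbl i : (i < n)%N -> (i.*2.+1 < n.*2)%N by lia.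
have step j : (j < n.*2)%N -> enorm (g (Y j.+1) - g (Y j)) <= M * (h / 2 * verlet_speed).
  exact: verlet_gradient_step.
have cb i : (i < n)%N -> enorm (c i) <= M * (h / 2 * verlet_speed).
  move=> ilt.
  have -> : c i = 2^-1 *: (g (Y i.*2.+1) - g (Y i.*2)) +
      2^-1 *: (g (Y i.*2.+1) - g (Y i.*2.+2)).
    by apply/rowP => l; rewrite !mxE; lra.
  apply: le_trans (enormD _ _) _; rewrite !enormZ ger0_norm ?invr_ge0//.
  have := step _ (dbl i ilt); have := step _ (ltnW (dbl i ilt)).
  by rewrite (enormB (g (Y i.*2.+2))); lra.
have drift j : (j <= n.*2)%N ->
    enorm (g (Y j) - g x) <= j%:R * (M * (h / 2 * verlet_speed)).
  move=> jn; apply: le_trans (gL _ _) _; rewrite mulrCA; apply: ler_wpM2l; first exact: ltW.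
  exact: (verlet_displacement h20 nhT' jn).
have kT j : (j <= n)%N -> j%:R * h <= T.
  by move=> jn; apply: le_trans nhT; rewrite ler_wpM2r// ler_nat.
elim/ltn_ind: k => k IH kn; rewrite -/(X k) -/(Y k.*2).
(* The quadrature defect, evaluated on the fine trajectory [Y]. *)
pose E := (h ^+ 2 / 4) *: (\sum_(i < k) (2 * (k%:R - i%:R) - 1) *: c i +
  2^-1 *: (g (Y k.*2) - g x)).
have DE : X k - Y k.*2 = E - h ^+ 2 *: \sum_(i < k) wt R k i *: (g (X i) - g (Y i.*2)).
  rewrite /X /Y !verlet_position /= -!/(X _) -!/(Y _) /E.
  have -> : k.*2%:R * (h / 2) = k%:R * h by rewrite -muln2 natrM; field.
  apply/rowP => l; rewrite !(mxE, summxE).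
  have := sum_wt_double (fun j => g (Y j) ord0 l) k.
  have -> : \sum_(i < k) (wt R k i *: (g (X i) - g (Y i.*2))) ord0 l =
    \sum_(i < k) wt R k i * g (X i) ord0 l - \sum_(i < k) wt R k i * g (Y i.*2) ord0 l.
    by rewrite -sumrB; apply: eq_bigr => i _; rewrite !mxE; ring.
  have -> : \sum_(i < k) (wt R k i *: g (X i)) ord0 l = \sum_(i < k) wt R k i * g (X i) ord0 l.
    by apply: eq_bigr => i _; rewrite !mxE.
  have -> : \sum_(i < k.*2) (wt R k.*2 i *: g (Y i)) ord0 l =
      \sum_(i < k.*2) wt R k.*2 i * g (Y i) ord0 l.
    by apply: eq_bigr => i _; rewrite !mxE.
  have -> : \sum_(i < k) ((2 * (k%:R - i%:R) - 1) *: c i) ord0 l =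
    \sum_(i < k) (2 * (k%:R - i%:R) - 1) * (g (Y i.*2.+1) ord0 l -
      (g (Y i.*2) ord0 l + g (Y i.*2.+2) ord0 l) / 2).
    by apply: eq_bigr => i _; rewrite !mxE; ring.
  rewrite -[g (Y 0%N)]/(g x).
  set S1 := \sum_(i < k.*2) _; set S2 := \sum_(i < k) wt R k i * g (Y i.*2) ord0 l.
  set S3 := \sum_(i < k) _ => H.
  have -> : S1 = 4 * S2 + S3 + (g (Y k.*2) ord0 l - g x ord0 l) / 2 by lra.
  by field.
have k0 : (0:R) <= k%:R by [].
have Eb : enorm E <= M * h * verlet_speed * T ^+ 2 / 4.
  rewrite /E enormZ ger0_norm ?divr_ge0 ?sqr_ge0//.
  have H1 : enorm (\sum_(i < k) (2 * (k%:R - i%:R) - 1) *: c i) <=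
      k%:R ^+ 2 * (M * (h / 2 * verlet_speed)).
    apply: le_trans (enorm_sum _ (fun i => (2 * (k%:R - i%:R) - 1) *: c i)) _.
    rewrite -sum_odd_wt mulr_suml; apply: ler_sum => i _.
    have : i.+1%:R <= k%:R :> R by rewrite ler_nat.
    rewrite -natr1 => ik; rewrite enormZ ger0_norm; last by lra.
    apply: ler_wpM2l; first by lra.
    exact: cb (leq_trans (ltn_ord i) kn).
  have H2 : enorm (2^-1 *: (g (Y k.*2) - g x)) <= k%:R * (M * (h / 2 * verlet_speed)).
    rewrite enormZ ger0_norm ?invr_ge0//.
    have : (k.*2 <= n.*2)%N by rewrite leq_double.
    have k2 : k.*2%:R = k%:R * 2 :> R by rewrite -muln2 natrM.
    by move=> /drift; rewrite k2; lra.
  have q0 : 0 <= M * (h / 2 * verlet_speed) by do 2?[apply: mulr_ge0 => //]; exact: ltW.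
  have kk : k%:R <= k%:R ^+ 2 :> R by rewrite -natrX ler_nat; case: (k) => // k'; rewrite -mulnn leq_pmulr.
  have H3 := ler_wpM2r q0 kk.
  have H4 : enorm (\sum_(i < k) (2 * (k%:R - i%:R) - 1) *: c i + 2^-1 *: (g (Y k.*2) - g x))
    <= 2 * (k%:R ^+ 2 * (M * (h / 2 * verlet_speed))).
    apply: le_trans (enormD _ _) _; lra.
  have h40 : 0 <= h ^+ 2 / 4 by rewrite divr_ge0 ?sqr_ge0.
  apply: le_trans (ler_wpM2l h40 H4) _.
  have : (k%:R * h) ^+ 2 <= T ^+ 2 by rewrite ler_sqr ?nnegrE ?mulr_ge0// kT.
  move=> /(ler_wpM2r q0); lra.
rewrite DE; apply: le_trans (enormBD _ _) _.
set B := M * h * verlet_speed * T ^+ 2 in Eb *.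
have B0 : 0 <= B.
  by apply: mulr_ge0; [apply: mulr_ge0 => //; apply: mulr_ge0 => //; exact: ltW|exact: sqr_ge0].
suff : enorm (h ^+ 2 *: \sum_(i < k) wt R k i *: (g (X i) - g (Y i.*2))) <= B / 4 by lra.
rewrite enormZ ger0_norm ?sqr_ge0//.
apply: le_trans (ler_wpM2l (sqr_ge0 h)
  (enorm_sum _ (fun i => wt R k i *: (g (X i) - g (Y i.*2))))) _.
have H : \sum_(i < k) enorm (wt R k i *: (g (X i) - g (Y i.*2))) <=
    \sum_(i < k) wt R k i * (M * (B / 2)).
  apply: ler_sum => i _; rewrite enormZ ger0_norm ?wt_ge0 ?(ltnW (ltn_ord i))//.
  rewrite ler_wpM2l ?wt_ge0 ?(ltnW (ltn_ord i))//.
  apply: le_trans (gL _ _) _; rewrite ler_pM2l//.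
  exact: IH (ltn_ord i) (ltnW (leq_trans (ltn_ord i) kn)).
apply: le_trans (ler_wpM2l (sqr_ge0 h) H) _.
rewrite -mulr_suml sum_wt.
have : (k%:R * h) ^+ 2 <= T ^+ 2 by rewrite ler_sqr ?nnegrE ?mulr_ge0// kT.
have MB0 : 0 <= M * B by apply: mulr_ge0 => //; exact: ltW.
move=> /(ler_wpM2r MB0).
have := ler_wpM2r B0 MT.
lra.
Qed.

(** Each halving costs half as much as the one before. The geometric series keeps the bound uniform
    in [i], which leaves [i] free for making rejections rare. *)
Lemma verlet_refine (h : R) (n i : nat) : 0 <= h -> n%:R * h <= T ->
  enorm ((verlet g h n (x, v)).1 - (verlet g (h / 2 ^+ i) (n * 2 ^ i) (x, v)).1) <=
  M * h * verlet_speed * T ^+ 2 * (1 - (2 ^+ i)^-1).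
Proof.
move=> h0 nhT; elim: i => [|i IH].
  by rewrite expr0 expn0 muln1 divr1 subrr enorm0 invr1 subrr mulr0.
set X := (verlet g h n _).1 in IH *.
set Y := (verlet g (h / 2 ^+ i) _ _).1 in IH *.
set Z := (verlet g _ _ _).1.
have -> : X - Z = (X - Y) + (Y - Z) by rewrite addrA subrK.
apply: le_trans (enormD _ _) _.
have p0 : 0 < 2 ^+ i :> R by rewrite exprn_gt0.
have H : enorm (Y - Z) <= M * (h / 2 ^+ i) * verlet_speed * T ^+ 2 / 2.
  have -> : Z = (verlet g (h / 2 ^+ i / 2) (n * 2 ^ i).*2 (x, v)).1.
    rewrite /Z exprS expnS invfM; congr (verlet _ _ _ _).1; last by lia.
    by rewrite mulrA mulrAC.
  apply: (@verlet_halving _ (n * 2 ^ i)) => //; first by rewrite divr_ge0// ltW.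
  by rewrite natrM natrX; apply: le_trans nhT; rewrite le_eqVlt; apply/orP; left; apply/eqP; field; lra.
apply: le_trans (lerD IH H) _.
rewrite (exprS 2 i) invfM; move: ((2 ^+ i)^-1) => a.
by rewrite le_eqVlt; apply/orP; left; apply/eqP; field.
Qed.

End verlet_bounds.

(** * Reversibility and energy error of the Verlet integrator *)

Section verlet_energy.
Variables (R : realType) (d : nat) (f : 'rV[R]_d -> R) (g : 'rV[R]_d -> 'rV[R]_d).
Implicit Types p : 'rV[R]_d * 'rV[R]_d.

Definition flip p : 'rV[R]_d * 'rV[R]_d := (p.1, - p.2).

Lemma flipK : involutive flip.
Proof. by case=> x v; rewrite /flip opprK. Qed.

(** A step is a palindrome of kicks and drifts, and each of them is undone by its conjugate under
    the velocity flip. *)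
Lemma vstep_flip h p : vstep g h (flip (vstep g h p)) = flip p.
Proof.
case: p => x v; rewrite /flip /vstep /kick /drift /=.
set u := v - (h / 2) *: g x.
have -> : - (u - (h / 2) *: g (x + h *: u)) - (h / 2) *: g (x + h *: u) = - u.
  by rewrite opprB addrAC subrr add0r.
by rewrite scalerN addrK /u opprB addrAC subrr add0r.
Qed.

Lemma verlet_flip h n p : verlet g h n (flip (verlet g h n p)) = flip p.
Proof.
elim: n p => [//|n IH] p.
by rewrite {1}/verlet iterSr {1}/verlet iterS vstep_flip -/(verlet g h n _) IH.
Qed.

Definition energy p : R := f p.1 + sqnorm2 p.2 / 2.

Lemma energy_flip p : energy (flip p) = energy p.
Proof. by rewrite /energy /= sqnorm2N. Qed.

Variables (m M T : R).
Hypothesis fg : smooth_strongly_convex f g m M.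
Hypothesis T0 : 0 <= T.
Hypothesis MT : M * T ^+ 2 <= 4^-1.
Variables (x v : 'rV[R]_d).

(** A local error of order h^2 is enough: over n steps with n h <= T it sums to order T h, which
    vanishes under refinement. *)
Lemma verlet_energy (h : R) (n : nat) : 0 <= h -> n%:R * h <= T ->
  `|energy (verlet g h n (x, v)) - energy (x, v)| <=
  n%:R * (h ^+ 2 * (M * verlet_speed g T x v ^+ 2 +
    (2 * (enorm (g x) + M * T * enorm v)) ^+ 2)).
Proof.
move=> h0 nhT; have [m0 mM fb] := fg.
have M0 : 0 < M by lra.
have gL := gradient_lipschitz fg.
set s := verlet_speed _ _ _ _; set G0 := 2 * _.
set C := _ + _ ^+ 2.
pose X k := (verlet g h k (x, v)).1; pose V k := (verlet g h k (x, v)).2.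
have step k : (k < n)%N ->
    `|energy (verlet g h k.+1 (x, v)) - energy (verlet g h k (x, v))| <= h ^+ 2 * C.
  move=> kn; rewrite /energy -!/(X _) -!/(V _).
  have [XS VS] := verletS g h (x, v) k; rewrite -!/(X _) -!/(V _) in XS VS.
  (* In terms of the mid-step velocity, the energy change is the Bregman divergence of the drift,
     plus h/2 times the product of [u] with the decrease of the gradient, plus h^2/8 times the
     increase of its squared norm; these are [e1], [e2] and [e3]. *)
  pose u := V k - (h / 2) *: g (X k).
  have Vk : V k = u + (h / 2) *: g (X k) by rewrite subrK.
  have VSk : V k.+1 = u - (h / 2) *: g (X k.+1).
    by rewrite VS /u scalerDr opprD addrA.
  have dX : X k.+1 - X k = h *: u by rewrite XS addrAC subrr add0r.
  have us : enorm u <= s := verlet_velocity_bound M0 gL T0 MT x v h0 nhT kn.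
  have ga : enorm (g (X k)) <= G0 := (verlet_bound M0 gL T0 MT x v h0 nhT (ltnW kn)).2.
  have gb : enorm (g (X k.+1)) <= G0 := (verlet_bound M0 gL T0 MT x v h0 nhT kn).2.
  have gd : enorm (g (X k.+1) - g (X k)) <= M * (h * s) :=
    verlet_gradient_step M0 gL T0 MT x v h0 nhT kn.
  have := fb (X k) (X k.+1); rewrite dX dotvZr sqnorm2Z => /andP[lo hi].
  clearbody u; rewrite Vk VSk sqnorm2B sqnorm2D !dotvZr !sqnorm2Z.
  have usq : sqnorm2 u <= s ^+ 2 by rewrite -sqr_enorm ler_sqr ?nnegrE ?enorm_ge0// (le_trans (enorm_ge0 u) us).
  have G00 : 0 <= G0 := le_trans (enorm_ge0 _) ga.
  have asq : sqnorm2 (g (X k)) <= G0 ^+ 2 by rewrite -sqr_enorm ler_sqr ?nnegrE ?enorm_ge0.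
  have bsq : sqnorm2 (g (X k.+1)) <= G0 ^+ 2 by rewrite -sqr_enorm ler_sqr ?nnegrE ?enorm_ge0.
  have dd : `|dotv u (g (X k.+1) - g (X k))| <= s * (M * (h * s)).
    by apply: le_trans (dotv_le_enorm _ _) _; apply: ler_pM; rewrite ?enorm_ge0.
  rewrite dotvBr ler_norml in dd; case/andP: dd => d1 d2.
  have := sqnorm2_ge0 u; have := sqnorm2_ge0 (g (X k)); have := sqnorm2_ge0 (g (X k.+1)).
  rewrite (dotvC (g (X k))) in lo hi.
  move: (sqnorm2 u) (sqnorm2 (g (X k))) (sqnorm2 (g (X k.+1)))
    (dotv u (g (X k))) (dotv u (g (X k.+1))) (f (X k)) (f (X k.+1)) usq asq bsq lo hi d1 d2.
  move=> U A B da db fa fb' usq asq bsq lo hi d1 d2 B0 A0 U0.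
  have h20 : 0 <= h ^+ 2 := sqr_ge0 h.
  have e1 : `|fb' - fa - h * da| <= h ^+ 2 * (M * s ^+ 2 / 2).
    rewrite ler_norml; apply/andP; split.
      apply: le_trans lo; apply: (@le_trans _ _ 0).
        rewrite oppr_le0; apply: mulr_ge0 => //; apply: divr_ge0 => //.
        by apply: mulr_ge0; [exact: ltW|exact: sqr_ge0].
      by apply: mulr_ge0; [lra|exact: mulr_ge0].
    apply: le_trans hi _; rewrite mulrCA; apply: ler_wpM2l => //.
    by rewrite mulrAC ler_wpM2r//; apply: ler_wpM2l => //; lra.
  have e2 : `|h / 2 * (da - db)| <= h ^+ 2 * (M * s ^+ 2 / 2).
    rewrite normrM ger0_norm ?divr_ge0//.
    have -> : h ^+ 2 * (M * s ^+ 2 / 2) = h / 2 * (s * (M * (h * s))) by field.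
    by apply: ler_wpM2l; rewrite ?divr_ge0// ler_norml; apply/andP; split; lra.
  have e3 : `|h ^+ 2 * ((B - A) / 8)| <= h ^+ 2 * (G0 ^+ 2).
    rewrite normrM ger0_norm//; apply: ler_wpM2l => //.
    by rewrite ler_norml; apply/andP; split; lra.
  rewrite [X in `|X| <= _](_ : _ = (fb' - fa - h * da) + h / 2 * (da - db) + h ^+ 2 * ((B - A) / 8)); last by field.
  apply: le_trans (ler_normD _ _) _; apply: le_trans (lerD (ler_normD _ _) (lexx _)) _.
  apply: le_trans (lerD (lerD e1 e2) e3) _.
  by rewrite le_eqVlt; apply/orP; left; apply/eqP; rewrite /C; field.
suff H k : (k <= n)%N ->
    `|energy (verlet g h k (x, v)) - energy (x, v)| <= k%:R * (h ^+ 2 * C) by exact: H.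
elim: k => [|k IH] kn; first by rewrite subrr normr0 mul0r.
apply: le_trans (ler_distD (energy (verlet g h k (x, v))) _ _) _.
rewrite -natr1 mulrDl mul1r [leRHS]addrC.
by apply: lerD; [exact: step|exact: IH (ltnW kn)].
Qed.

End verlet_energy.

(** * Measures on R^n *)

Section transfer.
Local Open Scope ereal_scope.
Context d1 d2 (S : measurableType d1) (T : measurableType d2) (R : realType).

Definition mfun_of (phi : S -> T) (mphi : measurable_fun setT phi) : {mfun S >-> T} :=
  HB.pack phi (isMeasurableFun.Build _ _ _ _ phi mphi).

Section image_measure.
Variables (phi : S -> T) (mphi : measurable_fun setT phi).
Variable (mu : {measure set S -> \bar R}).

(** The proof of measurability is carried by the term so that the measure structure can be inferred
    from it; likewise for [density_measure]. *)
Definition image_measure of measurable_fun setT phi := pushforward mu phi.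

Let image0 : image_measure mphi set0 = 0.
Proof. by rewrite /image_measure /pushforward preimage_set0 measure0. Qed.

Let image_ge0 A : 0 <= image_measure mphi A.
Proof. exact: measure_ge0. Qed.

Let image_sigma_additive : semi_sigma_additive (image_measure mphi).
Proof. exact: (measure_semi_sigma_additive (s := pushforward mu (mfun_of mphi))). Qed.

HB.instance Definition _ := isMeasure.Build _ _ _ (image_measure mphi)
  image0 image_ge0 image_sigma_additive.

End image_measure.

(** Change of variables when [nu] is known to be the image of [mu] only through its values on
    measurable sets, as happens for laws and marginals. *)
Lemma ge0_integral_law (phi : S -> T) (mu : {measure set S -> \bar R})
    (nu : {measure set T -> \bar R}) (F : T -> \bar R) :
  measurable_fun setT phi ->
  (forall A, measurable A -> nu A = mu (phi @^-1` A)) ->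
  measurable_fun setT F -> (forall y, 0 <= F y) ->
  \int[nu]_y F y = \int[mu]_x F (phi x).
Proof.
move=> mphi nuE mF F0.
have := @ge0_integral_pushforward _ _ S T R phi mphi mu setT F measurableT mF.
rewrite preimage_setT => <-; last by move=> y _; exact: F0.
pose X := mfun_of mphi.
by apply: (@eq_measure_integral _ _ _ _ (pushforward mu X)) => A mA _; exact: nuE.
Qed.

End transfer.

(** * Integration against a measure given by a density *)

Section density.
Import HBNNSimple.
Local Open Scope ereal_scope.
Context d (T : measurableType d) (R : realType) (mu : {measure set T -> \bar R}).
Variable p : T -> R.
Hypothesis mp : measurable_fun setT p.
Hypothesis p0 : forall x, (0 <= p x)%R.

Definition density_measure of measurable_fun setT p & (forall x, (0 <= p x)%R) :=
  fun A : set T => \int[mu]_(x in A) (p x)%:E.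

Let density0 : density_measure mp p0 set0 = 0.
Proof. exact: integral_set0. Qed.

Let density_ge0 A : 0 <= density_measure mp p0 A.
Proof. by apply: integral_ge0 => x _; rewrite lee_fin. Qed.

Let density_sigma_additive : semi_sigma_additive (density_measure mp p0).
Proof.
move=> /= F mF tF mUF; rewrite /density_measure; apply: cvg_toP.
  apply: ereal_nondecreasing_is_cvgn => m n mn.
  by apply: lee_sum_nneg_natr => // k _ _; exact: density_ge0.
rewrite ge0_integral_bigcup//=.
- by apply: measurable_funTS; exact/measurable_EFinP.
- by move=> x _; rewrite lee_fin.
Qed.

HB.instance Definition _ := isMeasure.Build _ _ _ (density_measure mp p0)
  density0 density_ge0 density_sigma_additive.

(** Both sides are monotone limits along the same simple functions, which reduces the claim to
    indicators. *)
Lemma ge0_integral_density (nu : {measure set T -> \bar R}) (F : T -> \bar R) :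
  (forall A, measurable A -> nu A = \int[mu]_(x in A) (p x)%:E) ->
  measurable_fun setT F -> (forall x, 0 <= F x) ->
  \int[nu]_x F x = \int[mu]_x (F x * (p x)%:E).
Proof.
move=> nuE mF F0.
have mpE : measurable_fun setT (fun x => (p x)%:E) by exact/measurable_EFinP.
pose F_ := nnsfun_approx measurableT mF.
have F_ge0 n x : 0 <= (F_ n x)%:E :> \bar R by rewrite lee_fin.
have mF_ n : measurable_fun setT (fun x => (F_ n x)%:E).
  exact/measurable_EFinP/measurable_funP.
have ndF x : {homo (fun n => (F_ n x)%:E) : a b / (a <= b)%N >-> a <= b}.
  by move=> a b ab; rewrite lee_fin; exact/lefP/nd_nnsfun_approx.
have cF x : (F_ n x)%:E @[n --> \oo] --> F x.
  by apply: cvg_nnsfun_approx => // *; exact: F0.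
have E1 : \int[nu]_x F x = limn (fun n => \int[nu]_x (F_ n x)%:E).
  rewrite -monotone_convergence//; apply: eq_integral => x _.
  exact/esym/cvg_lim.
have E2 : \int[mu]_x (F x * (p x)%:E) = limn (fun n => \int[mu]_x ((F_ n x)%:E * (p x)%:E)).
  rewrite -monotone_convergence//.
  - apply: eq_integral => x _; apply/esym/cvg_lim => //.
    by apply: cvgeZr => //; exact: cF.
  - by move=> n; apply: emeasurable_funM.
  - by move=> n x _; rewrite mule_ge0// lee_fin.
  - by move=> x _ a b ab; rewrite lee_wpmul2r ?lee_fin//; exact: ndF.
rewrite E1 E2; apply: congr_lim; apply/funext => n.
rewrite integralT_nnsfun sintegralE fsbig_finite//=.
pose s : seq R := finmap.enum_fset (fset_set (range (F_ n))).
pose h y x := (y * \1_(F_ n @^-1` [set y]) x * p x)%R.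
have mA y : measurable (F_ n @^-1` [set y]).
  by rewrite -[X in measurable X]setTI; exact: measurable_funP.
have mI y : measurable_fun setT (fun x => (\1_(F_ n @^-1` [set y]) x * p x)%R).
  by apply: measurable_funM => //; exact: measurable_indic.
have hE x : (F_ n x)%:E * (p x)%:E = \sum_(y <- s) (h y x)%:E.
  by rewrite -EFinM sumEFin -mulr_suml fimfunE fsbig_finite.
have h0 y x : 0 <= (h y x)%:E.
  by rewrite lee_fin /h mulr_ge0// -lee_fin EFinM; exact: nnfun_muleindic_ge0.
under [RHS]eq_integral do rewrite hE.
rewrite ge0_integral_sum//; last first.
  move=> y; apply/measurable_EFinP; rewrite /h.
  under eq_fun do rewrite -mulrA.
  exact: measurable_funM.
rewrite [LHS]big_seq [RHS]big_seq; apply: eq_bigr => y.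
rewrite in_fset_set// inE => -[t _ yE].
have y0 : (0 <= y)%R by rewrite -yE.
under eq_integral do rewrite /h -mulrA EFinM.
rewrite ge0_integralZl ?lee_fin//.
- congr (_ * _); rewrite nuE// integral_mkcond; apply: eq_integral => x _.
  rewrite /patch indicE; case: ifPn => _; first by rewrite mul1r.
  by rewrite mul0r.
- exact/measurable_EFinP.
- by move=> x _; rewrite lee_fin mulr_ge0.
Qed.

End density.

Section rV_measurable.
Context d (T : measurableType d) (R : realType).
Variable n : nat.
Implicit Types F G : T -> 'rV[R]_n.

Lemma measurable_rV_add F G : measurable_fun setT F -> measurable_fun setT G ->
  measurable_fun setT (fun x => F x + G x).
Proof.
move=> /measurable_fun_rVP mF /measurable_fun_rVP mG.
apply/measurable_fun_rVP => i; under eq_fun do rewrite mxE.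
exact: measurable_funD.
Qed.

Lemma measurable_rV_scale (a : R) F : measurable_fun setT F ->
  measurable_fun setT (fun x => a *: F x).
Proof.
move=> /measurable_fun_rVP mF; apply/measurable_fun_rVP => i.
under eq_fun do rewrite mxE; exact: measurable_funM.
Qed.

Lemma measurable_rV_opp F : measurable_fun setT F -> measurable_fun setT (fun x => - F x).
Proof. by move=> mF; under eq_fun do rewrite -scaleN1r; exact: measurable_rV_scale. Qed.

Lemma measurable_sqnorm2 F : measurable_fun setT F ->
  measurable_fun setT (fun x => sqnorm2 (F x)).
Proof.
by move=> /measurable_fun_rVP mF; apply: measurable_sum => i; exact: measurable_funX.
Qed.

End rV_measurable.

(** * Measures on R^n are determined by their values on boxes *)

Section rV_unique.
Variables (R : realType) (n : nat).

Definition rV_box (B : 'I_n -> set R) : set 'rV[R]_n := [set v | forall i, B i (v ord0 i)].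

Lemma rV_boxE B : rV_box B =
  \bigcap_(i in [set: 'I_n]) ((fun v : 'rV[R]_n => v ord0 i) @^-1` B i).
Proof. by apply/seteqP; split=> v /= H i; [move=> _|]; exact: H. Qed.

Lemma measurable_rV_box B : (forall i, measurable (B i)) -> measurable (rV_box B).
Proof.
move=> mB; rewrite rV_boxE; apply: fin_bigcap_measurable => [|i _]; first exact: finite_finset.
by rewrite -[X in measurable X]setTI; exact: measurable_rV_coord.
Qed.

Definition rV_boxes : set (set 'rV[R]_n) :=
  [set A | exists2 B : 'I_n -> set R, (forall i, measurable (B i)) & A = rV_box B].

Lemma measurable_rVE : measurable = <<s rV_boxes >> :> set (set 'rV[R]_n).
Proof.
apply/seteqP; split=> A.
  move=> mA; have {mA} : <<s \big[setU/set0]_(i < n)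
      preimage_set_system setT (fun v : 'rV[R]_n => v ord0 i) measurable >> A by [].
  apply: smallest_sub; first exact: smallest_sigma_algebra.
  move=> B; rewrite -bigcup_seq => -[i _ [C mC <-]]; rewrite setTI.
  apply: sub_sigma_algebra; exists (fun j => if j == i then C else setT).
    by move=> j; case: ifP.
  apply/seteqP; split => v /=.
    by move=> Cv j; case: eqP => // ->.
  by move=> /(_ i); rewrite eqxx.
apply: smallest_sub; first exact: sigma_algebra_measurable.
by move=> _ [B mB ->]; exact: measurable_rV_box.
Qed.

Let cube (k : nat) : set 'rV[R]_n := rV_box (fun=> `[- k%:R, k%:R]%classic).

(** Boxes form a pi-system that generates the sigma-algebra, and the cubes exhaust the space with
    finite measure. *)
Lemma rV_measure_unique (m1 m2 : {measure set 'rV[R]_n -> \bar R}) :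
  (forall k, (m1 (cube k) < +oo)%E) ->
  (forall B, (forall i, measurable (B i)) -> m1 (rV_box B) = m2 (rV_box B)) ->
  forall A, measurable A -> m1 A = m2 A.
Proof.
move=> m1oo m12 A mA.
apply: (measure_unique rV_boxes cube) => //.
- exact: measurable_rVE.
- move=> _ _ [B mB ->] [C mC ->]; exists (fun i => B i `&` C i).
    by move=> i; exact: measurableI.
  apply/seteqP; split => v /=; first by move=> [? ?] i; split.
  by move=> H; split => i; have [] := H i.
- by move=> k; exists (fun=> `[- k%:R, k%:R]%classic).
- apply/seteqP; split => // v _.
  pose s := \sum_(i < n) `|v ord0 i|.
  exists (Num.bound s) => // i.
  have H : `|v ord0 i| <= s by rewrite /s (bigD1 i)//= lerDl sumr_ge0.
  have s0 : 0 <= s by apply: le_trans H.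
  have sb := ltW (archi_boundP s0).
  by rewrite /= in_itv /= -ler_norml (le_trans H).
- by move=> _ [B mB ->]; exact: m12.
Qed.

Lemma rV_probability_unique (m1 m2 : {measure set 'rV[R]_n -> \bar R}) :
  (m1 setT < +oo)%E ->
  (forall B, (forall i, measurable (B i)) -> m1 (rV_box B) = m2 (rV_box B)) ->
  forall A, measurable A -> m1 A = m2 A.
Proof.
move=> m1oo; apply: rV_measure_unique => k.
apply: le_lt_trans m1oo; apply: le_measure; rewrite ?inE//.
by apply: measurable_rV_box => i.
Qed.

Lemma lebesgue_rV_unique (m : {measure set 'rV[R]_n -> \bar R}) :
  (forall B, (forall i, measurable (B i)) ->
    m (rV_box B) = (\prod_(i < n) lebesgue_measure (B i))%E) ->
  forall A, measurable A -> m A = lebesgue_rV R n A.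
Proof.
have bE B : (forall i, measurable (B i)) ->
    (lebesgue_rV R n : {measure set 'rV[R]_n -> \bar R}) (rV_box B) =
    (\prod_(i < n) lebesgue_measure (B i))%E.
  exact: lebesgue_rV_box.
move=> mE A mA; apply/esym; move: A mA; apply: rV_measure_unique => [k|B mB]; last first.
  exact: etrans (bE _ mB) (esym (mE _ mB)).
have mI (i : 'I_n) : measurable (`[- k%:R, k%:R]%classic : set R) by [].
rewrite (bE _ mI).
have [r ->] : exists r, lebesgue_measure `[(- k%:R : R), k%:R]%classic = r%:E.
  by rewrite lebesgue_measure_itv /= lte_fin; case: ifP => _; eexists; rewrite ?EFinB.
by rewrite prodEFin ltry.
Qed.

End rV_unique.

(** * Lebesgue measure under homotheties and translations *)

Section lebesgue_affine.
Variable R : realType.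

Let affine (c a : R) : measurableTypeR R -> measurableTypeR R := fun x => c * x + a.

Let maffine c a : measurable_fun setT (affine c a).
Proof. by apply: measurable_funD => //; exact: measurable_funM. Qed.

Lemma lebesgue_measure_affine (c a : R) (A : set R) : c != 0 -> measurable A ->
  lebesgue_measure A = (`|c|%:E * lebesgue_measure ((fun x : R => (c * x + a)%R) @^-1` A))%E.
Proof.
move=> c0 mA.
pose X := affine c a.
pose m := mscale (NngNum (normr_ge0 c)) (image_measure (@lebesgue_measure R) (maffine c a)).
rewrite (@lebesgue_measure_unique R m)// => B /ocitvP[->|[[u v] /= uv ->]].
  by rewrite !measure0.
rewrite /m /mscale /= /image_measure /pushforward lebesgue_measure_itv /= lte_fin uv.
have [cp|cn] : c > 0 \/ c < 0 by case: (ltgtP c 0) c0 => // ? _; [right|left].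
- have iv (x : R) : (u < c * x + a <= v) = ((u - a) / c < x <= (v - a) / c).
    by rewrite ltr_pdivrMr// ler_pdivlMr// ltrBlDr lerBrDr (mulrC x).
  have -> : X @^-1` `]u, v]%classic = `](u - a) / c, (v - a) / c]%classic.
    by apply/seteqP; split => x /=; rewrite !in_itv /= -iv.
  rewrite lebesgue_measure_itv /= lte_fin ltr_pM2r ?invr_gt0// ltrD2r uv gtr0_norm//.
  by rewrite -EFinB -EFinM; congr EFin; field; rewrite gt_eqF.
- have iv (x : R) : (u < c * x + a <= v) = ((v - a) / c <= x < (u - a) / c).
    by rewrite ltr_ndivlMr// ler_ndivrMr// ltrBlDr lerBrDr (mulrC x) andbC.
  have -> : X @^-1` `]u, v]%classic = `[(v - a) / c, (u - a) / c[%classic.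
    by apply/seteqP; split => x /=; rewrite !in_itv /= -iv.
  rewrite lebesgue_measure_itv /= lte_fin ltr_nM2r ?invr_lt0// ltrD2r uv ltr0_norm//.
  by rewrite -EFinB -EFinM; congr EFin; field; rewrite lt_eqF.
Qed.

Variable n : nat.

Let rV_affine (c : R) (a : 'rV[R]_n) (x : 'rV[R]_n) := c *: x + a.

Let mrV_affine c a : measurable_fun setT (rV_affine c a).
Proof. by apply: measurable_rV_add => //; exact: measurable_rV_scale. Qed.

Lemma lebesgue_rV_affine (c : R) (a : 'rV[R]_n) (A : set 'rV[R]_n) :
  c != 0 -> measurable A ->
  lebesgue_rV R n A =
    ((`|c| ^+ n)%:E * lebesgue_rV R n ((fun x => (c *: x + a)%R) @^-1` A))%E.
Proof.
move=> c0 mA.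
pose X := rV_affine c a.
pose m := mscale (NngNum (exprn_ge0 n (normr_ge0 c))) (image_measure (lebesgue_rV R n) (mrV_affine c a)).
rewrite -(@lebesgue_rV_unique R n m)// => B mB.
rewrite /m /mscale /= /image_measure /pushforward.
rewrite /mscale /=.
have -> : rV_affine c a @^-1` rV_box B = rV_box (fun i => (fun t => c * t + a ord0 i) @^-1` B i).
  by apply/seteqP; split => x /= H i; have := H i; rewrite /rV_affine !mxE.
rewrite [X in (_ * X)%E]lebesgue_rV_box; last first.
  by move=> i; rewrite -[X in measurable X]setTI; exact: (@maffine c (a ord0 i) measurableT (B i) (mB i)).
under [RHS]eq_bigr => i _ do rewrite (lebesgue_measure_affine (a ord0 i) c0 (mB i)).
by rewrite big_split /= prodEFin prodr_const card_ord.
Qed.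

(** Serves with c = 1 for kicks and drifts, with c = -1 for the flip and with c = 1/2 for the
    moments of the Gibbs measure. *)
Lemma ge0_integral_rV_affine (c : R) (a : 'rV[R]_n) (F : 'rV[R]_n -> \bar R) :
  c != 0 -> measurable_fun setT F -> (forall x, 0 <= F x)%E ->
  (\int[lebesgue_rV R n]_x F x =
    (`|c| ^+ n)%:E * \int[lebesgue_rV R n]_x F (c *: x + a)%R)%E.
Proof.
move=> c0 mF F0.
pose m := mscale (NngNum (exprn_ge0 n (normr_ge0 c))) (lebesgue_rV R n).
rewrite (@ge0_integral_law _ _ _ _ R (rV_affine c a) m)//.
- rewrite ge0_integral_mscale//; exact: measurableT_comp.
- by move=> A mA; exact: (lebesgue_rV_affine a c0 mA).
Qed.

End lebesgue_affine.

Section lebesgue_prod.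
Local Open Scope ereal_scope.
Variable R : realType.

Lemma ge0_integral_lebesgue_rVS n (F : 'rV[R]_n.+1 -> \bar R) :
  measurable_fun setT F -> (forall x, 0 <= F x) ->
  \int[lebesgue_rV R n.+1]_x F x =
  \int[@lebesgue_measure R]_t \int[lebesgue_rV R n]_v F (rV_cons (t, v)).
Proof.
move=> mF F0.
rewrite (@ge0_integral_law _ _ _ _ R (@rV_cons R n)
  (@lebesgue_measure R \x lebesgue_rV R n)%E)//.
by rewrite fubini_tonelli1//; exact: measurableT_comp.
Qed.

Lemma ge0_integral_rV_prod n (q : 'I_n -> R -> R) :
  (forall i, measurable_fun setT (q i)) -> (forall i x, (0 <= q i x)%R) ->
  \int[lebesgue_rV R n]_v (\prod_(i < n) q i (v ord0 i))%:E =
  \prod_(i < n) \int[lebesgue_measure]_x (q i x)%:E.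
Proof.
elim: n q => [|n IH] q mq q0.
  under eq_integral do rewrite big_ord0.
  by rewrite big_ord0 /= integral_dirac//= diracT mul1e.
rewrite ge0_integral_lebesgue_rVS//; last 2 first.
- apply/measurable_EFinP; apply: measurable_prod => i _.
  exact: (measurableT_comp (mq i) (@measurable_rV_coord _ _ _ i)).
- by move=> v; rewrite lee_fin; exact: prodr_ge0.
rewrite big_ord_recl -IH//.
have E t v : (\prod_(i < n.+1) q i (rV_cons (t, v) ord0 i))%:E =
    (q ord0 t)%:E * (\prod_(i < n) q (lift ord0 i) (v ord0 i))%:E.
  rewrite -EFinM big_ord_recl /rV_cons; congr (_ * _)%:E.
    by rewrite mxE; case: split_ordP => j // _; rewrite mxE.
  apply: eq_bigr => i _; rewrite mxE; case: split_ordP => j.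
    by move/(congr1 val); rewrite /= ord1.
  by move=> /(congr1 val) [] /val_inj ->.
under eq_integral => t _.
  under eq_integral do rewrite E.
  rewrite ge0_integralZl ?lee_fin//; last 2 first.
  - apply/measurable_EFinP; apply: measurable_prod => i _.
    exact: (measurableT_comp (mq _) (@measurable_rV_coord _ _ _ i)).
  - by move=> v _; rewrite lee_fin; exact: prodr_ge0.
  over.
rewrite ge0_integralZr//.
- by apply/measurable_EFinP; exact: mq.
- by move=> t _; rewrite lee_fin.
- by apply: integral_ge0 => v _; rewrite lee_fin; exact: prodr_ge0.
Qed.

End lebesgue_prod.

(** * Measurability of continuous functions for the product sigma-algebra *)

Section continuous_rV_measurable.
Variables (R : realType) (n : nat).

Let cell (k : nat) (x : 'rV[R]_n) : 'rV[int]_n := \row_i Num.floor (k.+1%:R * x ord0 i).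

Let grid (k : nat) (z : 'rV[int]_n) : 'rV[R]_n := \row_i ((z ord0 i)%:~R / k.+1%:R).

(** [F] is the pointwise limit of its values at points rounded down to the lattice of mesh 1 / (k +
    1). Each approximation is constant on countably many cells, and the cells are boxes. *)
Lemma continuous_rV_measurable (F : 'rV[R]_n -> R) :
  continuous F -> measurable_fun setT F.
Proof.
move=> cF; apply: (@measurable_fun_cvg _ _ _ _ (fun k x => F (grid k (cell k x)))).
  move=> k _ B mB; rewrite setTI.
  rewrite (_ : _ @^-1` B =
      \bigcup_z ((cell k @^-1` [set z]) `&` [set x | B (F (grid k z))])); last first.
    apply/seteqP; split => x /=; first by move=> Bx; exists (cell k x).
    by move=> [z _ /= [<-]].
  apply: countable_bigcupT_measurable => [|z]; first exact: countableP.
  apply: measurableI; last first.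
    case: (pselect (B (F (grid k z)))) => Bz.
      by rewrite (_ : [set x | _] = setT)//; apply/seteqP; split.
    by rewrite (_ : [set x | _] = set0)//; apply/seteqP; split.
  rewrite (_ : _ @^-1` _ = rV_box (fun i => [set t : R | Num.floor (k.+1%:R * t) = z ord0 i])).
    apply: measurable_rV_box => i.
    rewrite (_ : [set t | _] = `[(z ord0 i)%:~R / k.+1%:R, (z ord0 i + 1)%:~R / k.+1%:R[%classic).
      by [].
    apply/seteqP; split => t /=; rewrite in_itv /= ler_pdivrMr// ltr_pdivlMr// (mulrC t).
      by move=> <-; exact: floor_itv.
    by move=> H; exact: floor_def H.
  apply/seteqP; split => x /=.
    by move=> /rowP zE i; rewrite -zE mxE.
  by move=> H; apply/rowP => i; rewrite mxE; exact: H.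
move=> x _; apply: (@cvg_comp _ _ _ _ F _ (nbhs x)); last exact: cF.
apply/cvgrPdist_le => e e0; near=> k.
rewrite /Num.norm /= mx_normrE; apply: bigmax_le => [|[i j] _]; first exact: ltW.
rewrite ord1 /= !mxE.
have /andP[lo hi] := floor_itv (k.+1%:R * x ord0 j).
set q := (Num.floor _)%:~R in lo *.
have k0 : 0 < k.+1%:R :> R by [].
have E : x ord0 j - q / k.+1%:R = (k.+1%:R * x ord0 j - q) / k.+1%:R by field.
rewrite E ger0_norm; last by rewrite divr_ge0 ?subr_ge0.
apply: (@le_trans _ _ (1 / k.+1%:R)).
  by rewrite ler_pM2r ?invr_gt0// lerBlDl ltW// (lt_le_trans hi)// intrD.
rewrite div1r; apply/ltW.
by near: k; exact: (near_infty_natSinv_lt (PosNum e0)).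
Unshelve. all: by end_near. Qed.

End continuous_rV_measurable.

(** * Metropolized Hamiltonian dynamics *)

Section hamiltonian_measure.
Local Open Scope ereal_scope.
Variables (R : realType) (n : nat) (g : 'rV[R]_n -> 'rV[R]_n).
Hypothesis mg : measurable_fun setT g.
Notation leb := (lebesgue_rV R n).
Notation phase := ('rV[R]_n * 'rV[R]_n)%type.

Lemma measurable_kick h : measurable_fun setT (@kick R n g h).
Proof.
apply/measurable_fun_pairP; split; first exact: measurable_fst.
apply: measurable_rV_add; first exact: measurable_snd.
apply: measurable_rV_opp; apply: measurable_rV_scale.
exact: (measurableT_comp mg measurable_fst).
Qed.

Lemma measurable_drift h : measurable_fun setT (@drift R n h).
Proof.
apply/measurable_fun_pairP; split; last exact: measurable_snd.
apply: measurable_rV_add; first exact: measurable_fst.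
by apply: measurable_rV_scale; exact: measurable_snd.
Qed.

Lemma measurable_vstep h : measurable_fun setT (@vstep R n g h).
Proof.
apply: (measurableT_comp (measurable_kick _)).
exact: (measurableT_comp (measurable_drift _) (measurable_kick _)).
Qed.

Lemma measurable_verlet h k : measurable_fun setT (@verlet R n g h k).
Proof.
elim: k => [|k IH]; first exact: measurable_id.
exact: (measurableT_comp (measurable_vstep h) IH).
Qed.

Lemma measurable_flip : measurable_fun setT (@flip R n).
Proof.
apply/measurable_fun_pairP; split; first exact: measurable_fst.
by apply: measurable_rV_opp; exact: measurable_snd.
Qed.

(** Stated for integrals, so that Tonelli's theorem applies directly and compositions are
    immediate. *)
Definition volume_preserving (phi : phase -> phase) :=
  measurable_fun setT phi /\ forall F : phase -> \bar R,
    measurable_fun setT F -> (forall w, 0 <= F w) ->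
    \int[leb \x leb]_w F (phi w) = \int[leb \x leb]_w F w.

Lemma volume_preserving_comp phi psi :
  volume_preserving phi -> volume_preserving psi -> volume_preserving (phi \o psi).
Proof.
move=> [m1 v1] [m2 v2]; split; first exact: measurableT_comp.
move=> F mF F0; rewrite -(v1 F mF F0) -(v2 (F \o phi))// => [|w]; last exact: F0.
exact: measurableT_comp.
Qed.

(** At a fixed position a kick is a translation of the velocity; no Jacobian of [g] is involved. *)
Lemma volume_preserving_kick h : volume_preserving (kick g h).
Proof.
split; first exact: measurable_kick.
move=> F mF F0; have mFk : measurable_fun setT (fun w => F (kick g h w)).
  by apply: measurableT_comp => //; exact: measurable_kick.
rewrite !fubini_tonelli1//; apply: eq_integral => x _; rewrite /fubini_F.
have mFx : measurable_fun setT (fun v => F (x, v)) by exact: measurableT_comp.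
rewrite (@ge0_integral_rV_affine _ _ 1 (- (h *: g x)) (fun v => F (x, v))) ?oner_neq0//.
by rewrite normr1 expr1n mul1e; apply: eq_integral => v _; rewrite scale1r.
Qed.

Lemma volume_preserving_drift h : volume_preserving (drift h).
Proof.
split; first exact: measurable_drift.
move=> F mF F0; have mFk : measurable_fun setT (fun w => F (drift h w)).
  by apply: measurableT_comp => //; exact: measurable_drift.
rewrite !fubini_tonelli2//; apply: eq_integral => v _; rewrite /fubini_G.
have mFx : measurable_fun setT (fun x => F (x, v)) by exact: measurableT_comp.
rewrite (@ge0_integral_rV_affine _ _ 1 (h *: v) (fun x => F (x, v))) ?oner_neq0//.
by rewrite normr1 expr1n mul1e; apply: eq_integral => x _; rewrite scale1r.
Qed.

Lemma volume_preserving_flip : volume_preserving (@flip R n).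
Proof.
split; first exact: measurable_flip.
move=> F mF F0; have mFk : measurable_fun setT (fun w => F (flip w)).
  by apply: measurableT_comp => //; exact: measurable_flip.
rewrite !fubini_tonelli1//; apply: eq_integral => x _; rewrite /fubini_F.
have mFx : measurable_fun setT (fun v => F (x, v)) by exact: measurableT_comp.
rewrite (@ge0_integral_rV_affine _ _ (-1) 0 (fun v => F (x, v))) ?oppr_eq0 ?oner_neq0//.
rewrite normrN1 expr1n mul1e; apply: eq_integral => v _.
by rewrite scaleN1r addr0.
Qed.

Lemma volume_preserving_verlet h k : volume_preserving (verlet g h k).
Proof.
elim: k => [|k IH]; first by split => //; exact: measurable_id.
apply: (volume_preserving_comp _ IH); apply: (volume_preserving_comp (volume_preserving_kick _)).
exact: (volume_preserving_comp (volume_preserving_drift _) (volume_preserving_kick _)).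
Qed.

Variable f : 'rV[R]_n -> R.
Hypothesis mf : measurable_fun setT f.

Lemma measurable_energy : measurable_fun setT (energy f).
Proof.
apply: measurable_funD; first exact: (measurableT_comp mf measurable_fst).
apply: measurable_funM => //; apply: measurable_sqnorm2; exact: measurable_snd.
Qed.

Variables (h : R) (k : nat).

(* The Metropolis proposal; composing with the flip makes it an involution. *)
Definition proposal (w : phase) : phase := flip (verlet g h k w).

Lemma proposalK : involutive proposal.
Proof. by move=> w; rewrite /proposal verlet_flip flipK. Qed.

Lemma volume_preserving_proposal : volume_preserving proposal.
Proof. exact: (volume_preserving_comp volume_preserving_flip (volume_preserving_verlet h k)). Qed.

Definition accept (w : phase) : R :=
  Num.min 1%R (expR (energy f w - energy f (proposal w))).

Lemma accept_ge0 w : (0 <= accept w)%R.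
Proof. by rewrite le_min ler01 expR_ge0. Qed.

Lemma accept_le1 w : (accept w <= 1)%R.
Proof. by rewrite ge_min lexx. Qed.

Lemma measurable_proposal : measurable_fun setT proposal.
Proof. exact: volume_preserving_proposal.1. Qed.

Lemma measurable_accept : measurable_fun setT accept.
Proof.
have mD : measurable_fun setT (fun w => energy f w - energy f (proposal w))%R.
  apply: measurable_funB; first exact: measurable_energy.
  exact: (measurableT_comp measurable_energy measurable_proposal).
apply: measurable_minr; first exact: measurable_cst.
exact: (measurableT_comp (@measurable_expR R) mD).
Qed.

(** Detailed balance: as the proposal is an involution, both sides are the minimum of the two
    Boltzmann weights. *)
Let accept_symm w : (accept (proposal w) * expR (- energy f (proposal w)) =
  accept w * expR (- energy f w))%R.
Proof.
rewrite /accept proposalK !minr_pMl ?expR_ge0// !mul1r -!expRD.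
by rewrite minC; congr Num.min; congr expR; ring.
Qed.

(** By detailed balance the accepted mass is a function composed with the proposal, and volume
    preservation removes the composition; it then recombines with the rejected mass. Only the
    position is tested, since the velocity is drawn afresh at each iteration. *)
Lemma metropolis_stationary (A : set 'rV[R]_n) : measurable A ->
  \int[leb \x leb]_w ((accept w * \1_A (proposal w).1 +
    (1 - accept w) * \1_A w.1) * expR (- energy f w))%:E =
  \int[leb \x leb]_w (\1_A w.1 * expR (- energy f w))%:E.
Proof.
move=> mA.
pose B w : R := (accept w * expR (- energy f w) * \1_A w.1)%R.
pose C w : R := ((1 - accept w) * expR (- energy f w) * \1_A w.1)%R.
have mI : measurable_fun setT (fun w : phase => \1_A w.1 : R).
  by apply: measurableT_comp => //; exact: measurable_fst.
have mE : measurable_fun setT (fun w : phase => expR (- energy f w)).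
  have mN : measurable_fun setT (fun w : phase => - energy f w)%R.
    by apply: measurableT_comp => //; exact: measurable_energy.
  exact: (measurableT_comp (@measurable_expR R) mN).
have mB : measurable_fun setT B.
  by apply: measurable_funM => //; apply: measurable_funM => //; exact: measurable_accept.
have mC : measurable_fun setT C.
  apply: measurable_funM => //; apply: measurable_funM => //.
  by apply: measurable_funB => //; exact: measurable_accept.
have B0 w : (0 <= B w)%R by rewrite !mulr_ge0 ?accept_ge0 ?expR_ge0.
have C0 w : (0 <= C w)%R by rewrite !mulr_ge0 ?subr_ge0 ?accept_le1 ?expR_ge0.
have mBp : measurable_fun setT (fun w => B (proposal w)).
  by apply: measurableT_comp => //; exact: measurable_proposal.
have mBE : measurable_fun setT (fun w => (B w)%:E) by apply/measurable_EFinP.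
have mCE : measurable_fun setT (fun w => (C w)%:E) by apply/measurable_EFinP.
have mBpE : measurable_fun setT (fun w => (B (proposal w))%:E) by apply/measurable_EFinP.
have B0E w : 0 <= (B w)%:E by rewrite lee_fin.
have C0E w : 0 <= (C w)%:E by rewrite lee_fin.
transitivity (\int[leb \x leb]_w ((B (proposal w))%:E + (C w)%:E)).
  by apply: eq_integral => w _; rewrite -EFinD /B accept_symm /C; congr EFin; ring.
rewrite ge0_integralD// (volume_preserving_proposal.2 (fun w => (B w)%:E))//.
rewrite -ge0_integralD//.
by apply: eq_integral => w _; rewrite -EFinD /B /C; congr EFin; ring.
Qed.

End hamiltonian_measure.

(** * Gibbs measures and their moments *)

Section gibbs.
Local Open Scope ereal_scope.
Variables (R : realType) (n : nat).
Notation leb := (lebesgue_rV R n).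
Notation phase := ('rV[R]_n * 'rV[R]_n)%type.

Definition is_gibbs (f : 'rV[R]_n -> R) (c : R) (mu : set 'rV[R]_n -> \bar R) :=
  forall A, measurable A -> mu A = \int[leb]_(y in A) (c * expR (- f y))%:E.

Section moments.
Variables (f : 'rV[R]_n -> R) (c : R) (mu : probability 'rV[R]_n R).
Hypothesis mf : measurable_fun setT f.
Hypothesis muE : is_gibbs f c mu.

Let mexp : measurable_fun setT (fun y => expR (- f y)).
Proof.
have mN : measurable_fun setT (fun y => - f y)%R by exact: measurableT_comp.
exact: (measurableT_comp (@measurable_expR R) mN).
Qed.

Lemma measurable_gibbs_density : measurable_fun setT (fun y => c * expR (- f y))%R.
Proof. exact: measurable_funM. Qed.

(** The sign of the normalizing constant follows from the total mass being 1: a negative one would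
    give a mass that is not positive. *)
Lemma gibbs_const_ge0 : (0 <= c)%R.
Proof.
rewrite leNgt; apply/negP => c0.
have := muE measurableT; rewrite probability_setT.
have -> : \int[leb]_y (c * expR (- f y))%:E = - \int[leb]_y (- c * expR (- f y))%:E.
  rewrite -integral_ge0N; first by apply: eq_integral => y _; rewrite -EFinN mulNr opprK.
  by move=> y _; rewrite lee_fin mulr_ge0 ?expR_ge0// oppr_ge0 ltW.
move/eqP; rewrite eq_sym eqe_oppLR => /eqP E.
have : 0 <= \int[leb]_y (- c * expR (- f y))%:E.
  by apply: integral_ge0 => y _; rewrite lee_fin mulr_ge0 ?expR_ge0// oppr_ge0 ltW.
by rewrite E lee_fin oppr_ge0 ler10.
Qed.

Lemma gibbs_density_ge0 y : (0 <= c * expR (- f y))%R.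
Proof. by rewrite mulr_ge0 ?expR_ge0 ?gibbs_const_ge0. Qed.

Lemma ge0_integral_gibbs1 (F : 'rV[R]_n -> \bar R) : measurable_fun setT F ->
  (forall y, 0 <= F y) ->
  \int[mu]_y F y = \int[leb]_y (F y * (c * expR (- f y))%:E).
Proof.
by move=> mF F0; apply: ge0_integral_density => //;
  [exact: measurable_gibbs_density|exact: gibbs_density_ge0].
Qed.

Variables (g : 'rV[R]_n -> 'rV[R]_n) (m M : R) (x0 : 'rV[R]_n).
Hypothesis fg : smooth_strongly_convex f g m M.
Hypothesis x0min : forall y, (f x0 <= f y)%R.

Let midpoint y : (f (2^-1 *: y + 2^-1 *: x0) <= (f y + f x0) / 2)%R.
Proof.
have [m0 _ fb] := fg; set p := (_ + _)%R.
have /andP[+ _] := fb p y; have /andP[+ _] := fb p x0.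
have -> : (y - p = 2^-1 *: (y - x0))%R by apply/rowP => i; rewrite !mxE; lra.
have -> : (x0 - p = - (2^-1 *: (y - x0)))%R by apply/rowP => i; rewrite !mxE; lra.
rewrite dotvNr; move: (dotv _ _) => D.
have s0 (z : 'rV[R]_n) : (0 <= m / 2 * sqnorm2 z)%R by rewrite mulr_ge0 ?sqnorm2_ge0// divr_ge0// ltW.
have := s0 (- (2^-1 *: (y - x0)))%R; have := s0 (2^-1 *: (y - x0))%R.
move: (_ / _ * sqnorm2 _)%R (_ / _ * sqnorm2 _)%R => a b; lra.
Qed.

(* Comparing the masses of [f] and of its contraction by 1/2 towards [x0],
   [E exp ((f - f x0) / 2) <= 2 ^ n], while [exp t >= e ^ n (1 + t - n)]. *)
Lemma gibbs_moment : \int[mu]_y (f y - f x0)%:E <= (2 * n%:R)%:E.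
Proof.
pose t y : R := ((f y - f x0) / 2)%R.
have t0 y : (0 <= t y)%R by rewrite divr_ge0// subr_ge0.
have mt : measurable_fun setT t by apply: measurable_funM => //; exact: measurable_funB.
have -> : \int[mu]_y (f y - f x0)%:E = 2%:E * \int[mu]_y (t y)%:E.
  rewrite -ge0_integralZl//.
  - by apply: eq_integral => y _; rewrite -EFinM /t mulrC divfK.
  - exact/measurable_EFinP.
  - by move=> y _; rewrite lee_fin.
rewrite EFinM lee_pmul2l//.
have mtE : measurable_fun setT (fun y => (t y)%:E) by apply/measurable_EFinP.
have t0E y : 0 <= (t y)%:E by rewrite lee_fin.
rewrite ge0_integral_gibbs1//.
pose q y : R := (c * expR (- f y))%R.
have q0 y : (0 <= q y)%R by exact: gibbs_density_ge0.
have mq : measurable_fun setT q := measurable_gibbs_density.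
have I1 : \int[leb]_y (q y)%:E = 1.
  by rewrite -(muE measurableT) probability_setT.
pose e := expR n%:R : R.
have e0 : (0 < e)%R by exact: expR_gt0.
pose mid y : 'rV[R]_n := (2^-1 *: y + 2^-1 *: x0)%R.
have scal : \int[leb]_y (q (mid y))%:E = (2 ^+ n)%:E.
  have := @ge0_integral_rV_affine R n (2^-1) (2^-1 *: x0) (fun y => (q y)%:E).
  rewrite I1 ger0_norm ?invr_ge0// => /(_ _ _ _) E.
  have {E} E : 1 = (2^-1 ^+ n)%:E * \int[leb]_y (q (mid y))%:E.
    apply: E => [||y].
    - by rewrite invr_neq0// pnatr_eq0.
    - exact/measurable_EFinP.
    - by rewrite lee_fin.
  rewrite -[LHS]mul1e -[in LHS](_ : ((2 : R) ^+ n * 2^-1 ^+ n)%R%:E = 1); last first.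
    by rewrite -exprMn divff// expr1n.
  by rewrite EFinM -muleA -E mule1.
have mqm : measurable_fun setT (fun y => q (mid y)).
  apply: (measurableT_comp mq); apply: measurable_rV_add => //.
  exact: measurable_rV_scale.
(* The tangent of exp at n, multiplied by the density and written without subtraction, so that only
   integrals of nonnegative functions occur. *)
have pw y : (e * (t y * q y) + e * q y <= q (mid y) + e * n%:R * q y)%R.
  have H : (e * (1 + (t y - n%:R)) <= expR (t y))%R.
    have -> : (expR (t y) = e * expR (t y - n%:R))%R by rewrite -expRD addrC subrK.
    by rewrite ler_pM2l//; exact: expR_ge1Dx.
  have H2 : (q y * expR (t y) <= q (mid y))%R.
    rewrite /q -mulrA -expRD; apply: ler_wpM2l; first exact: gibbs_const_ge0.
    by rewrite ler_expR; have := midpoint y; rewrite /t; lra.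
  have := ler_wpM2l (q0 y) H; rewrite -/(q y); lra.
have I2 : \int[leb]_y (e * (t y * q y) + e * q y)%:E =
    e%:E * \int[leb]_y ((t y)%:E * (q y)%:E) + e%:E.
  under eq_integral => y _.
    rewrite (_ : _%:E = e%:E * ((t y)%:E * (q y)%:E) + e%:E * (q y)%:E)//; over.
  have mtq : measurable_fun setT (fun y => (t y)%:E * (q y)%:E).
    by apply: emeasurable_funM => //; exact/measurable_EFinP.
  have tq0 y : 0 <= (t y)%:E * (q y)%:E by rewrite mule_ge0// lee_fin.
  have mqE : measurable_fun setT (fun y => (q y)%:E) by apply/measurable_EFinP.
  have q0E y : 0 <= (q y)%:E by rewrite lee_fin.
  rewrite ge0_integralD//.
  - by rewrite ge0_integralZl ?lee_fin ?ltW// ge0_integralZl ?lee_fin ?ltW// I1 mule1.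
  - by move=> y _; rewrite mule_ge0// lee_fin ltW.
  - exact: emeasurable_funM.
  - by move=> y _; rewrite mule_ge0// lee_fin ltW.
  - exact: emeasurable_funM.
have I3 : \int[leb]_y (q (mid y) + e * n%:R * q y)%:E =
    (2 ^+ n)%:E + (e * n%:R)%:E.
  under eq_integral => y _.
    rewrite (_ : _%:E = (q (mid y))%:E + (e * n%:R)%:E * (q y)%:E)//; over.
  have mqE : measurable_fun setT (fun y => (q y)%:E) by apply/measurable_EFinP.
  have q0E y : 0 <= (q y)%:E by rewrite lee_fin.
  have en0 : 0 <= (e * n%:R)%:E by rewrite lee_fin mulr_ge0// ltW.
  rewrite ge0_integralD//.
  - by rewrite scal ge0_integralZl// I1 mule1.
  - exact/measurable_EFinP.
  - by move=> y _; rewrite mule_ge0.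
  - exact: emeasurable_funM.
have : e%:E * \int[leb]_y ((t y)%:E * (q y)%:E) + e%:E <= (2 ^+ n)%:E + (e * n%:R)%:E.
  rewrite -I2 -I3; apply: ge0_le_integral => //.
  - by move=> y _; rewrite lee_fin; apply: addr_ge0; apply: mulr_ge0;
      rewrite ?(ltW e0)// mulr_ge0.
  - apply/measurable_EFinP; apply: measurable_funD; apply: measurable_funM => //.
    exact: measurable_funM.
  - apply/measurable_EFinP; apply: measurable_funD => //; exact: measurable_funM.
  - by move=> y _; rewrite lee_fin.
have : (2 ^+ n <= e)%R.
  rewrite /e -[n%:R]mulr1 mulrC expRM_natr lerXn2r ?nnegrE ?expR_ge0//.
  exact: expR_ge1Dx.
set I := \int[leb]_y _ => e2 H.
have : e%:E * I <= (e * n%:R)%:E.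
  rewrite -(leeD2rE (x := e%:E))// (le_trans H)// -!EFinD lee_fin.
  by rewrite addrC lerD2l.
by rewrite EFinM lee_pmul2l.
Qed.

End moments.

Lemma ge0_integral_gibbs2 (f : 'rV[R]_n -> R) (c c' : R)
    (mu gam : probability 'rV[R]_n R) (F : phase -> \bar R) :
  measurable_fun setT f -> is_gibbs f c mu ->
  is_gibbs (fun z => sqnorm2 z / 2)%R c' gam ->
  measurable_fun setT F -> (forall w, 0 <= F w) ->
  \int[mu \x gam]_w F w =
  \int[leb \x leb]_w (F w * (c * c' * expR (- energy f w))%:E).
Proof.
move=> mf muE gamE mF F0.
have ms : measurable_fun setT (fun z : 'rV[R]_n => sqnorm2 z / 2)%R.
  by apply: measurable_funM => //; exact: measurable_sqnorm2.
have c0 := gibbs_const_ge0 muE; have c'0 := gibbs_const_ge0 gamE.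
rewrite fubini_tonelli1//.
rewrite (@ge0_integral_gibbs1 f c mu)//; last 2 first.
- exact: measurable_fun_fubini_tonelli_F.
- by move=> y; apply: integral_ge0.
have mE : measurable_fun setT (fun w => (c * c' * expR (- energy f w))%:E).
  apply/measurable_EFinP; apply: measurable_funM => //.
  have mN : measurable_fun setT (fun w : phase => - energy f w)%R.
    by apply: measurableT_comp => //; exact: measurable_energy.
  exact: (measurableT_comp (@measurable_expR R) mN).
rewrite fubini_tonelli1//; last 2 first.
- exact: emeasurable_funM.
- by move=> w; rewrite mule_ge0// lee_fin !mulr_ge0 ?expR_ge0.
apply: eq_integral => y _; rewrite /fubini_F.
have mFy : measurable_fun setT (fun z => F (y, z)) by exact: measurableT_comp.
rewrite (@ge0_integral_gibbs1 _ c' gam ms gamE)//.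
rewrite -ge0_integralZr//.
- apply: eq_integral => z _; rewrite -muleA -EFinM; congr (_ * _%:E).
  by rewrite /energy /= opprD expRD; ring.
- apply: emeasurable_funM => //; apply/measurable_EFinP.
  exact: (measurable_gibbs_density c' ms).
- by move=> z _; rewrite mule_ge0// lee_fin mulr_ge0 ?expR_ge0.
- by rewrite lee_fin mulr_ge0 ?expR_ge0.
Qed.

End gibbs.

(** * Blocks of independent gaussians *)

Section gaussian_blocks.
Local Open Scope ereal_scope.
Context (R : realType) d (O : measurableType d) (P : probability O R).
Variable xi : nat -> {RV P >-> R}.
Hypothesis xi_iid : iid_std_gaussian xi.

Definition block (a k : nat) (w : O) : 'rV[R]_k := \row_(j < k) xi (a + j)%N w.

Lemma measurable_block a k : measurable_fun setT (block a k).
Proof.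
by apply/measurable_fun_rVP => i; under eq_fun do rewrite mxE; exact: measurable_funP.
Qed.

Definition block_prob a k : probability 'rV[R]_k R :=
  distribution P (mfun_of (@measurable_block a k)).

Lemma block_joint_box a k (B : 'I_a -> set R) (C : 'I_k -> set R) :
  (forall i, measurable (B i)) -> (forall i, measurable (C i)) ->
  P (block 0 a @^-1` rV_box B `&` block a k @^-1` rV_box C) =
  (\prod_(i < a) normal_prob 0 1 (B i)) * (\prod_(j < k) normal_prob 0 1 (C j)).
Proof.
move=> mB mC.
(* The sides of [B] followed by those of [C], and the whole line from index a + k on. *)
pose D (i : nat) : set R := oapp B (oapp C setT (insub (i - a)%N)) (insub i).
have mD i : measurable (D i).
  by rewrite /D; case: (insub i : option _) => [j|] //=; case: (insub _ : option _) => [j|] /=.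
have Dl (i : 'I_a) : D i = B i by rewrite /D valK.
have Dr (j : 'I_k) : D (a + j)%N = C j.
  rewrite /D (_ : insub (a + j)%N = None :> option 'I_a).
    by rewrite /= addKn valK.
  by rewrite insubF// ltnNge leq_addr.
have := @xi_iid (a + k)%N D mD.
rewrite big_split_ord /=; under eq_bigr do rewrite Dl.
under [X in _ = _ * X -> _]eq_bigr do rewrite Dr.
move=> <-; congr (P _); apply/seteqP; split => w /=.
  move=> [Bw Cw] i ik; case: (ltnP i a) => ia.
    by have := Bw (Ordinal ia); rewrite mxE -Dl.
  have ja : (i - a < k)%N by rewrite ltn_subLR.
  by have := Cw (Ordinal ja); rewrite mxE -Dr /= subnKC.
move=> H; split => i; rewrite mxE.
  by rewrite add0n -Dl; apply: H; rewrite (leq_trans (ltn_ord i))// leq_addr.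
by rewrite -Dr; apply: H; rewrite ltn_add2l.
Qed.

Lemma block_box0 a (B : 'I_a -> set R) : (forall i, measurable (B i)) ->
  P (block 0 a @^-1` rV_box B) = \prod_(i < a) normal_prob 0 1 (B i).
Proof.
move=> mB; have := @block_joint_box a 0 B (fun=> setT) mB (fun=> measurableT).
rewrite big_ord0 mule1 => <-; congr (P _); apply/seteqP; split => w; last by case.
by move=> ?; split => // -[].
Qed.

Lemma block_box a k (C : 'I_k -> set R) : (forall i, measurable (C i)) ->
  P (block a k @^-1` rV_box C) = \prod_(i < k) normal_prob 0 1 (C i).
Proof.
move=> mC; have := @block_joint_box a k (fun=> setT) C (fun=> measurableT) mC.
rewrite [X in _ = X * _]big1 ?mul1e; last by move=> i _; exact: probability_setT.
by move=> <-; congr (P _); apply/seteqP; split => w; [move=> ?; split|case].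
Qed.

Let mpre a k A : measurable A -> measurable (block a k @^-1` A).
Proof. by move=> mA; rewrite -[X in measurable X]setTI; exact: measurable_block. Qed.

Let P_nng (A : set O) : {nonneg R} := NngNum (fine_ge0 (measure_ge0 P A)).

Let scaled_imageE (A : set O) dS (S : measurableType dS) (X : O -> S)
    (mX : measurable_fun setT X) (B : set S) : measurable A ->
  mscale (P_nng A) (image_measure P mX) B = P A * P (X @^-1` B).
Proof. by move=> mA; rewrite /mscale /= fineK// fin_num_measure. Qed.

Let restr_imageE (Z : set O) (mZ : measurable Z) dS (S : measurableType dS) (X : O -> S)
    (mX : measurable_fun setT X) (B : set S) :
  image_measure (mrestr P mZ) mX B = P (X @^-1` B `&` Z).
Proof. by []. Qed.

(** Uniqueness on boxes is used twice: with a box as second event it extends the product formula to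
    all [A], and then with [A] fixed to all [B]. *)
Lemma block_indep a k A B : measurable A -> measurable B ->
  P (block 0 a @^-1` A `&` block a k @^-1` B) =
  P (block 0 a @^-1` A) * P (block a k @^-1` B).
Proof.
move=> mA; move: B.
have box C : (forall i, measurable (C i)) ->
    P (block 0 a @^-1` A `&` block a k @^-1` rV_box C) =
    P (block 0 a @^-1` A) * P (block a k @^-1` rV_box C).
  move=> mC; have mZ := mpre a (measurable_rV_box mC).
  move: A mA.
  pose m1 := image_measure (mrestr P mZ) (@measurable_block 0 a).
  pose m2 := mscale (P_nng (block a k @^-1` rV_box C)) (image_measure P (@measurable_block 0 a)).
  move=> A mA; have : m1 A = m2 A.
    apply: rV_probability_unique mA.
      rewrite /m1 /image_measure /pushforward /mrestr /=.
      exact: le_lt_trans (probability_le1 P (measurableI _ _ (mpre 0 measurableT) mZ)) (ltry _).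
    move=> B mB; rewrite [RHS]scaled_imageE//.
    by rewrite [LHS]restr_imageE block_joint_box// block_box0// block_box// muleC.
  by rewrite [LHS]restr_imageE [RHS]scaled_imageE// muleC.
move=> B mB; have mZ := mpre 0 mA.
pose m1 := image_measure (mrestr P mZ) (@measurable_block a k).
pose m2 := mscale (P_nng (block 0 a @^-1` A)) (image_measure P (@measurable_block a k)).
have : m1 B = m2 B.
  apply: rV_probability_unique mB.
    rewrite /m1 /image_measure /pushforward /mrestr /=.
    exact: le_lt_trans (probability_le1 P (measurableI _ _ (mpre a measurableT) mZ)) (ltry _).
  move=> C mC; rewrite [RHS]scaled_imageE; last exact: mpre.
  by rewrite [LHS]restr_imageE setIC box.
rewrite [RHS]scaled_imageE; last exact: mpre.
by rewrite [LHS]restr_imageE setIC.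
Qed.

(** Applied with the current iterate as function [G] of the past samples and with the next velocity
    as the fresh block. *)
Lemma block_product_law dS (S : measurableType dS) a k (G : 'rV[R]_a -> S)
    (mG : measurable_fun setT (G \o block 0 a)) (D : set (S * 'rV[R]_k)) :
  measurable_fun setT G -> measurable D ->
  P [set w | D (G (block 0 a w), block a k w)] =
  (distribution P (mfun_of mG) \x block_prob a k) D.
Proof.
move=> mG' mD.
have mpair : measurable_fun setT (fun w => (G (block 0 a w), block a k w)).
  by apply/measurable_fun_pairP; split => //; exact: measurable_block.
apply/esym; move: D mD.
apply: (@product_measure_unique _ _ _ _ _ _ _ (image_measure P mpair)) => A B mA mB.
have mGA : measurable (G @^-1` A) by rewrite -[X in measurable X]setTI; exact: mG'.
exact: (block_indep mGA mB).
Qed.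

(** The velocity is itself Gibbs distributed, for the potential |z|^2 / 2, so the results on Gibbs
    measures apply to it as well. *)
Lemma block_gibbs a k :
  is_gibbs (fun z => sqnorm2 z / 2)%R (normal_peak 1 ^+ k)%R (block_prob a k).
Proof.
pose p (z : 'rV[R]_k) : R := (normal_peak 1 ^+ k * expR (- (sqnorm2 z / 2)))%R.
have pE z : p z = (\prod_(i < k) normal_pdf 0 1 (z ord0 i))%R.
  rewrite normal_pdfE ?oner_neq0// big_split /= prodr_const card_ord; congr (_ * _)%R.
  rewrite -expR_sum; congr expR; rewrite mulrC mulr_sumr -sumrN; apply: eq_bigr => i _.
  by rewrite subr0 expr1n mulrC mulNr.
have mp : measurable_fun setT p.
  rewrite (_ : p = fun z => \prod_(i < k) normal_pdf 0 1 (z ord0 i))%R; last exact/funext.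
  apply: measurable_prod => i _.
  exact: (measurableT_comp (measurable_normal_pdf 0 1) (@measurable_rV_coord _ _ _ i)).
have p0 z : (0 <= p z)%R by rewrite pE; apply: prodr_ge0 => i _; exact: normal_pdf_ge0.
move=> A mA; have : block_prob a k A = density_measure (lebesgue_rV R k) mp p0 A.
  apply: rV_probability_unique mA; first exact: le_lt_trans (probability_le1 (block_prob a k) measurableT) (ltry _).
  move=> B mB; rewrite [LHS]block_box//.
  rewrite [RHS](_ : _ = \int[lebesgue_rV R k]_(x in rV_box B) (p x)%:E)// integral_mkcond.
  pose q i x : R := (normal_pdf 0 1 x * \1_(B i) x)%R.
  have mq i : measurable_fun setT (q i).
    by apply: measurable_funM => //; exact: measurable_normal_pdf.
  have q0 i x : (0 <= q i x)%R by rewrite mulr_ge0// normal_pdf_ge0.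
  have -> : (fun z => (p z)%:E) \_ (rV_box B) =
      (fun z => (\prod_(i < k) q i (z ord0 i))%:E).
    apply/funext => z; rewrite /patch big_split /= -pE; case: ifPn => zB.
      rewrite big1 ?mulr1// => i _; rewrite indicE mem_set//.
      by move: zB; rewrite inE; exact.
    have [i ziB] : exists i, ~ B i (z ord0 i).
      by apply/existsNP => H; move: zB; rewrite notin_setE; apply.
    by rewrite (bigD1 i)//= indicE memNset// mul0r mulr0.
  rewrite ge0_integral_rV_prod//; apply: eq_bigr => i _.
  rewrite /normal_prob integral_mkcond; apply: eq_integral => x _.
  rewrite /patch /q indicE; case: ifPn => _; first by rewrite mulr1.
  by rewrite mulr0.
by [].
Qed.

End gaussian_blocks.

(** * The uniform variable that decides on acceptance *)

Section uniform.
Local Open Scope ereal_scope.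
Variable R : realType.

Definition unif : probability (measurableTypeR R) R := uniform_prob (@ltr01 R).

Lemma unif_lt (a : R) : (0 <= a <= 1)%R -> unif [set u | (u < a)%R] = a%:E.
Proof.
move=> /andP[a0 a1]; rewrite /unif /= /uniform_prob integral_uniform_pdf.
have -> : [set u : R | (u < a)%R] `&` `[0%R, 1%R] = `[0%R, a[%classic.
  apply/seteqP; split => u /=; rewrite !in_itv /=.
    by move=> [ua /andP[-> _]].
  by move=> /andP[u0 ua]; split => //; rewrite u0 (le_trans (ltW ua)).
rewrite (eq_integral (cst 1)); last first.
  move=> u; rewrite inE /= in_itv /= => /andP[u0 ua].
  by rewrite /uniform_pdf u0 (le_trans (ltW ua))//= subr0 invr1.
rewrite integral_cst//= mul1e lebesgue_measure_itv /= lte_fin.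
by case: ltP => [_|a0']; [rewrite oppr0 adde0|rewrite (@le_anti _ _ a 0%R) ?a0' ?a0].
Qed.

Lemma ge0_integral_unif_if (p a b : R) : (0 <= p <= 1)%R -> (0 <= a)%R -> (0 <= b)%R ->
  \int[unif]_u (if (u < p)%R then a else b)%:E = (p * a + (1 - p) * b)%:E.
Proof.
move=> p01 a0 b0.
have mL : measurable ([set u | (u < p)%R] : set (measurableTypeR R)).
  by rewrite (_ : [set _ | _] = `]-oo, p[%classic)//; apply/seteqP; split => u /=; rewrite in_itv.
pose L := [set u : measurableTypeR R | (u < p)%R].
have E u : (if (u < p)%R then a else b)%:E =
    a%:E * (\1_L u)%:E + b%:E * (\1_(~` L) u)%:E :> \bar R.
  rewrite -!EFinM -EFinD !indicE; case: ifPn => up.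
    have uL : L u by [].
    have nL : ~ (~` L) u by apply.
    by rewrite (mem_set uL) (memNset nL) mulr1 mulr0 addr0.
  have nL : ~ L u by apply/negP.
  by rewrite (memNset nL) (mem_set (nL : (~` L) u)) mulr0 mulr1 add0r.
have mC : measurable (~` L) by exact: measurableC.
have mI (X : set (measurableTypeR R)) : measurable X ->
    measurable_fun setT (fun u => (\1_X u)%:E : \bar R).
  by move=> mX; apply/measurable_EFinP; exact: measurable_indic.
have I0 (X : set (measurableTypeR R)) u : 0 <= (\1_X u)%:E :> \bar R by rewrite lee_fin.
under eq_integral do rewrite E.
have mI1 := mI _ mL; have mI2 := mI _ mC.
rewrite ge0_integralD//; last 4 first.
- by move=> u _; rewrite mule_ge0// lee_fin.
- by apply: emeasurable_funM.
- by move=> u _; rewrite mule_ge0// lee_fin.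
- by apply: emeasurable_funM.
rewrite !ge0_integralZl ?lee_fin// !integral_indic// !setIT.
have UL : unif L = p%:E by exact: unif_lt.
have UC : unif (~` L) = (1 - p)%:E by rewrite probability_setC// UL.
suff : a%:E * unif L + b%:E * unif (~` L) = (p * a + (1 - p) * b)%:E by [].
by rewrite UL UC -!EFinM -EFinD mulrC (mulrC b).
Qed.

End uniform.

Section stationary_step.
Local Open Scope ereal_scope.
Variables (R : realType) (n : nat) (f : 'rV[R]_n -> R) (g : 'rV[R]_n -> 'rV[R]_n).
Variables (c c' : R) (pi gam : probability 'rV[R]_n R).
Hypothesis mf : measurable_fun setT f.
Hypothesis mg : measurable_fun setT g.
Hypothesis piE : is_gibbs f c pi.
Hypothesis gamE : is_gibbs (fun z => sqnorm2 z / 2)%R c' gam.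
Notation phase := ('rV[R]_n * 'rV[R]_n)%type.

(** [metropolis_stationary] after normalization: the density of [pi \x gam] is c c' exp (-
    energy). *)
Lemma metropolis_law (h : R) (k : nat) (A : set 'rV[R]_n) : measurable A ->
  \int[pi \x gam]_w (accept g f h k w * \1_A (proposal g h k w).1 +
    (1 - accept g f h k w) * \1_A w.1)%:E = pi A.
Proof.
move=> mA.
have mI : measurable_fun setT (fun w : phase => \1_A w.1 : R).
  by apply: measurableT_comp => //; exact: measurable_fst.
have mIp : measurable_fun setT (fun w => \1_A (proposal g h k w).1 : R).
  exact: (measurableT_comp mI (measurable_proposal mg h k)).
have ma := measurable_accept mg mf h k.
pose F w : R := (accept g f h k w * \1_A (proposal g h k w).1 +
    (1 - accept g f h k w) * \1_A w.1)%R.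
have mF : measurable_fun setT F.
  apply: measurable_funD; apply: measurable_funM => //; exact: measurable_funB.
have F0 w : (0 <= F w)%R.
  by rewrite addr_ge0// mulr_ge0// ?subr_ge0 ?accept_ge0 ?accept_le1.
have cc0 : (0 <= c * c')%R.
  by rewrite mulr_ge0 ?(gibbs_const_ge0 piE) ?(gibbs_const_ge0 gamE).
have mE : measurable_fun setT (fun w => expR (- energy f w))%R.
  have mN : measurable_fun setT (fun w : phase => - energy f w)%R.
    by apply: measurableT_comp => //; exact: measurable_energy.
  exact: (measurableT_comp (@measurable_expR R) mN).
have pull (G : phase -> R) : measurable_fun setT G -> (forall w, 0 <= G w)%R ->
    \int[pi \x gam]_w (G w)%:E =
    (c * c')%:E * \int[lebesgue_rV R n \x lebesgue_rV R n]_w (G w * expR (- energy f w))%:E.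
  move=> mG G0.
  rewrite (ge0_integral_gibbs2 (f := f) (c := c) (c' := c'))//; last exact/measurable_EFinP.
  rewrite -ge0_integralZl ?lee_fin//.
  - by apply: eq_integral => w _; rewrite -!EFinM; congr EFin; ring.
  - by apply/measurable_EFinP; exact: measurable_funM.
  - by move=> w _; rewrite lee_fin mulr_ge0 ?expR_ge0.
rewrite pull// (metropolis_stationary mg mf h k mA) -pull//.
have mAT : measurable (A `*` setT : set phase) by exact: measurableX.
transitivity ((pi \x gam) (A `*` setT)); last first.
  by rewrite product_measure1E// -[RHS]mule1; congr (_ * _); exact: probability_setT.
transitivity (\int[pi \x gam]_w (\1_(A `*` setT : set phase) w)%:E); last first.
  by rewrite integral_indic// setIT.
apply: eq_integral => -[y z] _; congr EFin.
by rewrite !indicE /=; congr (nat_of_bool _)%:R; rewrite in_setX in_setT andbT.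
Qed.

End stationary_step.

(** * The coupling of one iteration *)

Section coupling_space.
Local Open Scope ereal_scope.
Variables (R : realType) (n : nat) (mu pi gam : probability 'rV[R]_n R).
Notation phase := ('rV[R]_n * 'rV[R]_n)%type.
Variable G : probability phase R.
Hypothesis Gmp : is_coupling mu pi G.

(* A point ((x, y), (z, u)) carries the two positions, the shared velocity and
   the uniform variable that decides on acceptance. *)
Notation space := (phase * ('rV[R]_n * measurableTypeR R))%type.
Let noise : probability ('rV[R]_n * measurableTypeR R)%type R := gam \x unif R.
Definition coupling_space : probability space R := G \x noise.

Lemma coupling_space_law (D : set phase) : measurable D ->
  coupling_space [set t | D (t.1.1, t.2.1)] = (mu \x gam) D.
Proof.
move=> mD.
have mp : measurable_fun setT (fun t : space => (t.1.1, t.2.1)).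
  apply/measurable_fun_pairP; split.
    exact: (measurableT_comp measurable_fst measurable_fst).
  exact: (measurableT_comp measurable_fst measurable_snd).
apply/esym; move: D mD.
apply: (@product_measure_unique _ _ _ _ _ _ _ (image_measure coupling_space mp)) => A B mA mB.
transitivity (coupling_space ((A `*` setT) `*` (B `*` setT))).
  rewrite /image_measure /pushforward; congr (coupling_space _).
  by apply/seteqP; split => -[[x y] [z u]] /=; [move=> [? ?]; split; split|move=> [[? _] [? _]]; split].
have mAT : measurable (A `*` setT : set phase) by exact: measurableX.
have mBT : measurable (B `*` setT : set ('rV[R]_n * measurableTypeR R)) by exact: measurableX.
transitivity (G (A `*` setT) * noise (B `*` setT)).
  exact: product_measure1E.
congr (_ * _); first exact: (Gmp mA).1.
transitivity (gam B * unif R setT); first exact: product_measure1E.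
by rewrite probability_setT mule1.
Qed.

Lemma ge0_integral_coupling_space1 (F : phase -> \bar R) : measurable_fun setT F ->
  (forall w, 0 <= F w) ->
  \int[coupling_space]_t F t.1 = \int[G]_w F w.
Proof.
move=> mF F0; apply/esym.
apply: (@ge0_integral_law _ _ _ _ R (@fst phase _) coupling_space G F) => //.
move=> A mA; transitivity (coupling_space (A `*` setT)); last first.
  by congr (coupling_space _); apply/seteqP; split => -[w t] /=; [case|split].
rewrite [RHS]product_measure1E// -[LHS]mule1; congr (_ * _).
by apply/esym; exact: (@probability_setT _ _ _ noise).
Qed.

(** Forgetting the first position leaves a stationary point with independent velocity and uniform
    variable, whatever the coupling [G]. *)
Lemma ge0_integral_coupling_space2 (F : phase * measurableTypeR R -> \bar R) :
  measurable_fun setT F -> (forall w, 0 <= F w) ->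
  \int[coupling_space]_t F ((t.1.2, t.2.1), t.2.2) =
  \int[pi \x gam]_w \int[unif R]_u F (w, u).
Proof.
move=> mF F0.
pose F' (t : 'rV[R]_n * ('rV[R]_n * measurableTypeR R)) := F ((t.1, t.2.1), t.2.2).
have ma : measurable_fun setT
    (fun t : 'rV[R]_n * ('rV[R]_n * measurableTypeR R) => ((t.1, t.2.1), t.2.2)).
  apply/measurable_fun_pairP; split; last exact: (measurableT_comp measurable_snd measurable_snd).
  apply/measurable_fun_pairP; split; first exact: measurable_fst.
  exact: (measurableT_comp measurable_fst measurable_snd).
have mF' : measurable_fun setT F' by exact: (measurableT_comp mF ma).
have F'0 t : 0 <= F' t by exact: F0.
have mp : measurable_fun setT (fun t : space => (t.1.2, t.2)).
  apply/measurable_fun_pairP; split; last exact: measurable_snd.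
  exact: (measurableT_comp measurable_snd measurable_fst).
have law D : measurable D ->
    (pi \x noise) D = coupling_space ((fun t : space => (t.1.2, t.2)) @^-1` D).
  move: D; apply: (@product_measure_unique _ _ _ _ _ _ _ (image_measure coupling_space mp)) => A B mA mB.
  transitivity (coupling_space ((setT `*` A) `*` B)).
    rewrite /image_measure /pushforward; congr (coupling_space _).
    by apply/seteqP; split => -[[x y] zu] /=; [move=> [? ?]; split|move=> [[_ ?] ?]; split].
  have mTA : measurable (setT `*` A : set phase) by exact: measurableX.
  transitivity (G (setT `*` A) * noise B).
    exact: product_measure1E.
  by congr (_ * _); exact: (Gmp mA).2.
transitivity (\int[pi \x noise]_t F' t).
  by rewrite (ge0_integral_law mp law mF' F'0).
have mFw w : measurable_fun setT (fun u => F (w, u)) by exact: measurableT_comp.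
have mFI : measurable_fun setT (fun w => \int[unif R]_u F (w, u)).
  exact: (measurable_fun_fubini_tonelli_F (m2 := unif R) F).
have FI0 w : 0 <= \int[unif R]_u F (w, u) by exact: integral_ge0.
rewrite (fubini_tonelli1 F')// (fubini_tonelli1 (fun w => \int[unif R]_u F (w, u)))//.
apply: eq_integral => y _; rewrite /fubini_F.
have mF'y : measurable_fun setT (fun t => F' (y, t)) by exact: measurableT_comp.
by rewrite (fubini_tonelli1 (fun t => F' (y, t))).
Qed.

End coupling_space.

(** * Displacement and rejection cost at stationarity *)

Section stationary_moments.
Local Open Scope ereal_scope.
Variables (R : realType) (n : nat) (f : 'rV[R]_n -> R) (g : 'rV[R]_n -> 'rV[R]_n).
Variables (m M : R) (x0 : 'rV[R]_n) (c c' : R) (pi gam : probability 'rV[R]_n R).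
Hypothesis fg : smooth_strongly_convex f g m M.
Hypothesis x0min : forall y, (f x0 <= f y)%R.
Hypothesis mf : measurable_fun setT f.
Hypothesis mg : measurable_fun setT g.
Hypothesis piE : is_gibbs f c pi.
Hypothesis gamE : is_gibbs (fun z => sqnorm2 z / 2)%R c' gam.
Variables (h : R) (k : nat).
Let T := (k%:R * h)%R.
Hypothesis h0 : (0 <= h)%R.
Hypothesis MT : (M * T ^+ 2 <= 4^-1)%R.
Notation phase := ('rV[R]_n * 'rV[R]_n)%type.

Let m0 : (0 < m)%R. Proof. by case: fg. Qed.
Let M0 : (0 < M)%R. Proof. by case: fg => ? /(lt_le_trans _) + _; apply. Qed.
Let T0 : (0 <= T)%R. Proof. by rewrite mulr_ge0. Qed.
Let gL := gradient_lipschitz fg.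

Let normal_convex :
  smooth_strongly_convex (fun z : 'rV[R]_n => sqnorm2 z / 2)%R id 1 1.
Proof.
split => // x y; rewrite (_ : sqnorm2 y = sqnorm2 (x + (y - x))); last by rewrite addrC subrK.
by rewrite (sqnorm2D x) /=; apply/andP; split; lra.
Qed.

Let mnorm : measurable_fun setT (fun z : 'rV[R]_n => sqnorm2 z / 2)%R.
Proof. by apply: measurable_funM => //; exact: measurable_sqnorm2. Qed.

Lemma gibbs_sqdist : \int[pi]_y (sqnorm2 (y - x0))%:E <= (4 * n%:R / m)%:E.
Proof.
have mF : measurable_fun setT (fun y => f y - f x0)%R by exact: measurable_funB.
apply: (@le_trans _ _ (\int[pi]_y ((2 / m)%:E * (f y - f x0)%:E))).
  apply: ge0_le_integral => //.
  - by move=> y _; rewrite lee_fin sqnorm2_ge0.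
  - apply/measurable_EFinP; apply: measurable_sqnorm2; apply: measurable_rV_add => //.
  - by apply: emeasurable_funM => //; apply/measurable_EFinP.
  - move=> y _; rewrite -EFinM lee_fin mulrAC ler_pdivlMr// mulrC.
    by have := sqdist_argmin_le fg x0min y; lra.
rewrite ge0_integralZl//.
- have -> : (4 * n%:R / m = 2 / m * (2 * n%:R))%R by field; rewrite gt_eqF.
  rewrite [leRHS]EFinM; apply: lee_wpmul2l; first by rewrite lee_fin divr_ge0// ltW.
  exact: (gibbs_moment mf piE fg x0min).
- exact/measurable_EFinP.
- by move=> y _; rewrite lee_fin subr_ge0.
- by rewrite lee_fin divr_ge0// ltW.
Qed.

Let gibbs_sqgradient : \int[pi]_y (sqnorm2 (g y))%:E <= (4 * M * n%:R)%:E.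
Proof.
have mF : measurable_fun setT (fun y => f y - f x0)%R by exact: measurable_funB.
have MM0 : (0 <= 2 * M)%R by rewrite mulr_ge0// ltW.
apply: (@le_trans _ _ (\int[pi]_y ((2 * M)%:E * (f y - f x0)%:E))).
  apply: ge0_le_integral => //.
  - by move=> y _; rewrite lee_fin sqnorm2_ge0.
  - by apply/measurable_EFinP; apply: measurable_sqnorm2.
  - by apply: emeasurable_funM => //; apply/measurable_EFinP.
  - by move=> y _; rewrite -EFinM lee_fin; exact: (sqnorm2_gradient_le fg x0min y).
rewrite ge0_integralZl//.
- have -> : (4 * M * n%:R = 2 * M * (2 * n%:R))%R by ring.
  rewrite [leRHS]EFinM; apply: lee_wpmul2l; first by rewrite lee_fin.
  exact: (gibbs_moment mf piE fg x0min).
- exact/measurable_EFinP.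
- by move=> y _; rewrite lee_fin subr_ge0.
Qed.

Let normal_sqnorm : \int[gam]_z (sqnorm2 z)%:E <= (4 * n%:R)%:E.
Proof.
have H : forall y : 'rV[R]_n, (sqnorm2 (0 : 'rV[R]_n) / 2 <= sqnorm2 y / 2)%R.
  by move=> y; rewrite sqnorm20 mul0r divr_ge0// sqnorm2_ge0.
have := gibbs_moment mnorm gamE normal_convex H.
have -> : \int[gam]_z (sqnorm2 z)%:E =
    2%:E * \int[gam]_z (sqnorm2 z / 2 - sqnorm2 (0 : 'rV[R]_n) / 2)%:E.
  rewrite -ge0_integralZl//.
  - by apply: eq_integral => z _; rewrite -EFinM sqnorm20; congr EFin; field.
  - by apply/measurable_EFinP; exact: measurable_funB.
  - by move=> z _; rewrite lee_fin subr_ge0.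
move=> /(lee_wpmul2l _) -/(_ 2%:E) H2; apply: le_trans (H2 _) _; first by rewrite lee_fin.
by rewrite -EFinM lee_fin; lra.
Qed.

Lemma measurable_sqspeed : measurable_fun setT (fun w : phase => verlet_speed g T w.1 w.2 ^+ 2)%R.
Proof.
apply: measurable_funX; apply: measurable_funM => //; apply: measurable_funD.
  apply: (measurableT_comp (continuous_measurable_fun (@sqrt_continuous R))); apply: measurable_sqnorm2.
  exact: measurable_snd.
apply: measurable_funM => //; apply: (measurableT_comp (continuous_measurable_fun (@sqrt_continuous R))).
apply: measurable_sqnorm2; exact: (measurableT_comp mg measurable_fst).
Qed.

Lemma speed_moment :
  \int[pi \x gam]_w (verlet_speed g T w.1 w.2 ^+ 2)%:E <= (40 * n%:R)%:E.
Proof.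
have mspeed := measurable_sqspeed.
have ms2 : measurable_fun setT (fun z : 'rV[R]_n => (sqnorm2 z)%:E).
  by apply/measurable_EFinP; exact: measurable_sqnorm2.
have msg : measurable_fun setT (fun y : 'rV[R]_n => (sqnorm2 (g y))%:E).
  by apply/measurable_EFinP; exact: measurable_sqnorm2.
have ms2w : measurable_fun setT (fun w : phase => (sqnorm2 w.2)%:E).
  exact: (measurableT_comp ms2 measurable_snd).
have msgw : measurable_fun setT (fun w : phase => (sqnorm2 (g w.1))%:E).
  exact: (measurableT_comp msg measurable_fst).
have s0 (v : 'rV[R]_n) : 0 <= (sqnorm2 v)%:E by rewrite lee_fin sqnorm2_ge0.
have T20 : 0 <= (8 * T ^+ 2)%:E by rewrite lee_fin mulr_ge0 ?sqr_ge0.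
apply: (@le_trans _ _ (\int[pi \x gam]_w (8%:E * (sqnorm2 w.2)%:E +
    (8 * T ^+ 2)%:E * (sqnorm2 (g w.1))%:E))).
  apply: ge0_le_integral => //.
  - by move=> w _; rewrite lee_fin sqr_ge0.
  - exact/measurable_EFinP.
  - by apply: emeasurable_funD; exact: emeasurable_funM.
  - move=> w _; rewrite -!EFinM -EFinD lee_fin /verlet_speed.
    rewrite -(sqr_enorm w.2) -(sqr_enorm (g w.1)).
    have := sqr_ge0 (enorm w.2 - T * enorm (g w.1))%R; lra.
rewrite ge0_integralD//; last 4 first.
- by move=> w _; rewrite mule_ge0.
- exact: emeasurable_funM.
- by move=> w _; rewrite mule_ge0.
- exact: emeasurable_funM.
rewrite !ge0_integralZl//.
have -> : \int[pi \x gam]_w (sqnorm2 w.2)%:E = \int[gam]_z (sqnorm2 z)%:E.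
  apply/esym; apply: (@ge0_integral_law _ _ _ _ R (@snd _ _) (pi \x gam) gam
    (fun z => (sqnorm2 z)%:E)) => // A mA.
  transitivity ((pi \x gam) (setT `*` A)).
    rewrite product_measure1E// -[LHS]mul1e; congr (_ * _); apply/esym; exact: probability_setT.
  by congr ((pi \x gam)%E _); apply/seteqP; split => -[y z] /=; [case|split].
have -> : \int[pi \x gam]_w (sqnorm2 (g w.1))%:E = \int[pi]_y (sqnorm2 (g y))%:E.
  apply/esym; apply: (@ge0_integral_law _ _ _ _ R (@fst _ _) (pi \x gam) pi
    (fun y => (sqnorm2 (g y))%:E)) => // A mA.
  transitivity ((pi \x gam) (A `*` setT)).
    rewrite product_measure1E// -[LHS]mule1; congr (_ * _); apply/esym; exact: probability_setT.
  by congr ((pi \x gam)%E _); apply/seteqP; split => -[y z] /=; [case|split].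
(* This is 32 n + 32 M T^2 n, hence the constant 40. *)
apply: (@le_trans _ _ (8%:E * (4 * n%:R)%:E + (8 * T ^+ 2)%:E * (4 * M * n%:R)%:E)).
  by apply: leeD; apply: lee_wpmul2l => //; rewrite lee_fin.
rewrite -!EFinM -EFinD lee_fin.
have n0 : (0 <= n%:R :> R)%R by [].
by have := ler_wpM2r n0 MT; lra.
Qed.

(* The energy error of the fine integrator tends to 0, hence so does the cost of
   the rejected moves. *)
Let rejection (i : nat) (w : phase) : R :=
  ((1 - accept g f (h / 2 ^+ i) (k * 2 ^ i) w) *
    sqnorm2 ((proposal g (h / 2 ^+ i) (k * 2 ^ i) w).1 - w.1))%R.

Let fine_T i : ((k * 2 ^ i)%N%:R * (h / 2 ^+ i) = T)%R.
Proof.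
rewrite natrM natrX /T; field.
by rewrite expf_neq0// pnatr_eq0.
Qed.

Let fine_h0 i : (0 <= h / 2 ^+ i)%R.
Proof. by rewrite divr_ge0// exprn_ge0. Qed.

(** A bound uniform in [i]; its right-hand side is the dominating function of [rejection_limit]. *)
Let displacement i w :
  (sqnorm2 ((proposal g (h / 2 ^+ i) (k * 2 ^ i) w).1 - w.1) <=
  T ^+ 2 * verlet_speed g T w.1 w.2 ^+ 2)%R.
Proof.
case: w => y z; rewrite /proposal /flip /= -sqr_enorm -exprMn.
have S0 : (0 <= verlet_speed g T y z)%R := verlet_speed_ge0 g T0 y z.
have TS : (0 <= T * verlet_speed g T y z)%R by apply: mulr_ge0; [exact: T0|exact: S0].
rewrite ler_sqr ?nnegrE ?enorm_ge0//.
have le_T : ((k * 2 ^ i)%N%:R * (h / 2 ^+ i) <= T)%R by rewrite fine_T.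
apply: le_trans (verlet_displacement M0 gL T0 MT y z (fine_h0 i) le_T (leqnn _)) _.
by rewrite mulrA fine_T.
Qed.

Let rejection_ge0 i w : (0 <= rejection i w)%R.
Proof. by rewrite mulr_ge0 ?sqnorm2_ge0// subr_ge0 accept_le1. Qed.

Let mrejection i : measurable_fun setT (rejection i).
Proof.
apply: measurable_funM.
  by apply: measurable_funB => //; exact: measurable_accept.
apply: measurable_sqnorm2; apply: measurable_rV_add.
  exact: (measurableT_comp measurable_fst (measurable_proposal mg _ _)).
by apply: measurable_rV_opp; exact: measurable_fst.
Qed.

Let reject_le (x : R) : (1 - Num.min 1 (expR x) <= `|x|)%R.
Proof.
have := expR_ge1Dx x; have := ler_norm (- x)%R; rewrite normrN.
by rewrite /Num.min; case: ifP => [_|_]; have := normr_ge0 x; lra.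
Qed.

Let energy_const (w : phase) : R :=
  (M * verlet_speed g T w.1 w.2 ^+ 2 +
    (2 * (enorm (g w.1) + M * T * enorm w.2)) ^+ 2)%R.

Let rejection_le i w : (rejection i w <=
  (T * h * energy_const w * (T ^+ 2 * verlet_speed g T w.1 w.2 ^+ 2)) / 2 ^+ i)%R.
Proof.
have le_T : ((k * 2 ^ i)%N%:R * (h / 2 ^+ i) <= T)%R by rewrite fine_T.
have H : (1 - accept g f (h / 2 ^+ i) (k * 2 ^ i) w <= T * (h / 2 ^+ i) * energy_const w)%R.
  apply: le_trans (reject_le _) _.
  rewrite distrC /proposal energy_flip; case: w => y z.
  apply: le_trans (verlet_energy fg T0 MT y z (fine_h0 i) le_T) _.
  by rewrite mulrA expr2 mulrA fine_T.
have a0 : (0 <= 1 - accept g f (h / 2 ^+ i) (k * 2 ^ i) w)%R by rewrite subr_ge0 accept_le1.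
apply: le_trans (ler_pM a0 (sqnorm2_ge0 _) H (displacement i w)) _.
rewrite le_eqVlt; apply/orP; left; apply/eqP.
by move: (energy_const w) (verlet_speed _ _ _ _) => e s; rewrite -!mulrA; congr (_ * _)%R; ring.
Qed.

(** The explicit bound [rejection_le] is of fourth order in velocity and gradient, whereas the
    moments bounded above are of second order. It therefore serves only for pointwise convergence,
    and dominated convergence does the rest. *)
Lemma rejection_limit (eta : R) : (0 < eta)%R ->
  exists i, \int[pi \x gam]_w (rejection i w)%:E <= eta%:E.
Proof.
move=> eta0; have mspeed := measurable_sqspeed.
pose dom w : \bar R := (T ^+ 2 * verlet_speed g T w.1 w.2 ^+ 2)%:E.
have mdom : measurable_fun setT dom.
  by apply/measurable_EFinP; apply: measurable_funM.
have [] := @dominated_convergence _ _ R (pi \x gam)%E setT measurableT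
  (fun i w => (rejection i w)%:E) (cst 0) dom.
- by move=> i; apply/measurable_EFinP; exact: mrejection.
- exact: measurable_cst.
- apply: aeW => w _; apply/fine_cvgP; split; first exact: nearW.
  rewrite /=; pose K := (T * h * energy_const w * (T ^+ 2 * verlet_speed g T w.1 w.2 ^+ 2))%R.
  apply: (@squeeze_cvgr _ _ _ _ (cst 0%R) (fun i => K / 2 ^+ i)%R).
  + by apply: nearW => i /=; rewrite rejection_ge0 rejection_le.
  + exact: cvg_cst.
  + have H : ((2^-1 : R) ^+ i)%R @[i --> \oo] --> (0%R : R).
      by apply: cvg_expr; rewrite ger0_norm ?invr_ge0// invf_lt1// ltr1n.
    have -> : (fun i => K / 2 ^+ i)%R = (fun i => (2^-1) ^+ i * K)%R.
      by apply/funext => i; rewrite exprVn mulrC.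
    by rewrite -(mul0r K); exact: cvgMr_tmp.
- apply/integrableP; split => //.
  have dom0 w : 0 <= dom w by rewrite lee_fin; apply: mulr_ge0; exact: sqr_ge0.
  under eq_integral do rewrite gee0_abs//.
  rewrite /dom; under eq_integral do rewrite EFinM.
  rewrite ge0_integralZl//; last 3 first.
  + exact/measurable_EFinP.
  + by move=> w _; rewrite lee_fin sqr_ge0.
  + by rewrite lee_fin sqr_ge0.
  apply: (@le_lt_trans _ _ ((T ^+ 2)%:E * (40 * n%:R)%:E)); last by rewrite -EFinM ltry.
  by apply: lee_wpmul2l; [rewrite lee_fin sqr_ge0|exact: speed_moment].
- apply: aeW => w i _; rewrite gee0_abs; last by rewrite lee_fin rejection_ge0.
  rewrite lee_fin -[leRHS]mul1r; apply: ler_pM.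
  + by rewrite subr_ge0 accept_le1.
  + exact: sqnorm2_ge0.
  + by rewrite gerBl accept_ge0.
  + exact: displacement.
- move=> _ _; rewrite integral0 => H.
  have /fine_cvgP[fin] := H.
  move=> /cvgrPdist_le /(_ _ eta0) near_eta.
  have [i [fi ei]] : exists i, \int[pi \x gam]_w (rejection i w)%:E \is a fin_num /\
      (`|0 - fine (\int[pi \x gam]_w (rejection i w)%:E)| <= eta)%R.
    by have [N _ HN] := filterI fin near_eta; exists N; apply: HN => /=.
  exists i; rewrite -(fineK fi) lee_fin (le_trans _ ei)// sub0r normrN; exact: ler_norm.
Qed.

End stationary_moments.

(** * One iteration of the coupling *)

Section coupling_step.
Local Open Scope ereal_scope.
Variables (R : realType) (n : nat) (f : 'rV[R]_n -> R) (g : 'rV[R]_n -> 'rV[R]_n).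
Variables (m M : R) (x0 : 'rV[R]_n) (c c' : R) (pi gam : probability 'rV[R]_n R).
Hypothesis fg : smooth_strongly_convex f g m M.
Hypothesis x0min : forall y, (f x0 <= f y)%R.
Hypothesis mf : measurable_fun setT f.
Hypothesis mg : measurable_fun setT g.
Hypothesis piE : is_gibbs f c pi.
Hypothesis gamE : is_gibbs (fun z => sqnorm2 z / 2)%R c' gam.
Variables (h : R) (k : nat).
Let T := (k%:R * h)%R.
Hypothesis h0 : (0 <= h)%R.
Hypothesis MT : (M * T ^+ 2 <= 4^-1)%R.
Notation phase := ('rV[R]_n * 'rV[R]_n)%type.

Let m0 : (0 < m)%R. Proof. by case: fg. Qed.
Let M0 : (0 < M)%R. Proof. by case: fg => ? /(lt_le_trans _) + _; apply. Qed.
Let T0 : (0 <= T)%R. Proof. by rewrite mulr_ge0. Qed.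
Let gL := gradient_lipschitz fg.

(** The first point makes the coarse Verlet move of the algorithm, the second one the Metropolis
    move of a fine integrator, which keeps its law equal to [pi]. The level [i] of refinement is
    taken from [rejection_limit]. *)
Lemma coupling_step (mu mu' : probability 'rV[R]_n R) (G : probability phase R)
    (C t eta : R) :
  is_coupling mu pi G ->
  (forall A, measurable A -> mu' A = (mu \x gam) [set w | A (verlet g h k w).1]) ->
  \int[G]_w (sqnorm2 (w.1 - w.2))%:E <= C%:E -> (0 < t)%R -> (0 < eta)%R ->
  exists2 G' : probability phase R, is_coupling mu' pi G' &
    \int[G']_w (sqnorm2 (w.1 - w.2))%:E <=
    ((1 + t) * (1 - m * T ^+ 2 / 4) * C +
     (1 + t^-1) * (2 * ((M * h * T ^+ 2) ^+ 2 * (40 * n%:R) + eta)))%:E.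
Proof.
move=> Gmp mu'E GC t0 eta0.
have [i Hi] := rejection_limit fg x0min mf mg piE gamE h0 MT eta0.
pose al := accept g f (h / 2 ^+ i) (k * 2 ^ i).
pose pr := proposal g (h / 2 ^+ i) (k * 2 ^ i).
have mal : measurable_fun setT al by exact: measurable_accept.
have mpr : measurable_fun setT (fun w => (pr w).1).
  exact: (measurableT_comp measurable_fst (measurable_proposal mg _ _)).
have al01 w : (0 <= al w <= 1)%R by rewrite accept_ge0 accept_le1.
pose space := (phase * ('rV[R]_n * measurableTypeR R))%type.
pose xz (s : space) : phase := (s.1.1, s.2.1).
pose yz (s : space) : phase := (s.1.2, s.2.1).
have mxz : measurable_fun setT xz.
  apply/measurable_fun_pairP; split; first exact: (measurableT_comp measurable_fst measurable_fst).
  exact: (measurableT_comp measurable_fst measurable_snd).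
have myz : measurable_fun setT yz.
  apply/measurable_fun_pairP; split; first exact: (measurableT_comp measurable_snd measurable_fst).
  exact: (measurableT_comp measurable_fst measurable_snd).
pose move_x (s : space) := (verlet g h k (xz s)).1.
pose move_y (s : space) := if (s.2.2 < al (yz s))%R then (pr (yz s)).1 else (yz s).1.
have mmx : measurable_fun setT move_x.
  apply: (measurableT_comp measurable_fst).
  exact: (measurableT_comp (measurable_verlet mg h k) mxz).
have mmy : measurable_fun setT move_y.
  apply: measurable_fun_ifT.
  - apply: measurable_fun_ltr; last exact: (measurableT_comp mal myz).
    exact: (measurableT_comp measurable_snd measurable_snd).
  - exact: (measurableT_comp mpr myz).
  - exact: (measurableT_comp measurable_fst myz).
have mth : measurable_fun setT (fun s => (move_x s, move_y s)).
  by apply/measurable_fun_pairP; split.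
(* From here on only these three marginals of the space are known; its product structure is
   hidden. *)
have [CS [law_xz int_xy int_yzu]] : exists CS : probability space R,
    [/\ forall D : set phase, measurable D ->
          CS [set s | D (s.1.1, s.2.1)] = (mu \x gam) D,
        forall F : phase -> \bar R, measurable_fun setT F -> (forall w, 0 <= F w) ->
          \int[CS]_s F s.1 = \int[G]_w F w &
        forall F : phase * measurableTypeR R -> \bar R,
          measurable_fun setT F -> (forall w, 0 <= F w) ->
          \int[CS]_s F ((s.1.2, s.2.1), s.2.2) = \int[pi \x gam]_w \int[unif R]_u F (w, u)].
  exists (coupling_space gam G); split.
  - exact: (coupling_space_law gam Gmp).
  - exact: ge0_integral_coupling_space1.
  - exact: (ge0_integral_coupling_space2 gam Gmp).
pose G' : probability phase R := distribution CS (mfun_of mth).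
exists G'.
- move=> A mA; split.
  + rewrite mu'E//.
    rewrite -[RHS]law_xz; first by congr (CS _); apply/seteqP; split => s /=; [case|split].
    have -> : [set w | A (verlet g h k w).1] = (fun w => (verlet g h k w).1) @^-1` A by [].
    rewrite -[X in measurable X]setTI.
    exact: (measurableT_comp measurable_fst (measurable_verlet mg h k)).
  + rewrite -(metropolis_law mf mg piE gamE (h / 2 ^+ i) (k * 2 ^ i) mA).
    have mI (X : phase -> 'rV[R]_n) : measurable_fun setT X ->
        measurable_fun setT (fun wu : phase * measurableTypeR R => \1_A (X wu.1) : R).
      by move=> mX; exact: (measurableT_comp (measurable_indic mA) (measurableT_comp mX measurable_fst)).
    pose F (wu : phase * measurableTypeR R) : R :=
      if (wu.2 < al wu.1)%R then \1_A (pr wu.1).1 else \1_A wu.1.1.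
    have mF : measurable_fun setT F.
      apply: measurable_fun_ifT.
      * apply: measurable_fun_ltr; first exact: measurable_snd.
        exact: (measurableT_comp mal measurable_fst).
      * exact: (mI (fun w => (pr w).1)).
      * by apply: (mI fst); exact: measurable_fst.
    have mFE : measurable_fun setT (fun wu => (F wu)%:E) by apply/measurable_EFinP.
    have F0 wu : 0 <= (F wu)%:E by rewrite lee_fin /F; case: ifP.
    transitivity (\int[CS]_s (F (yz s, s.2.2))%:E).
      have mB : measurable (move_y @^-1` A) by rewrite -[X in measurable X]setTI; exact: mmy.
      transitivity (CS (move_y @^-1` A)).
        by congr (CS _); apply/seteqP; split => s /=; [case|split].
      transitivity (\int[CS]_s (\1_(move_y @^-1` A) s)%:E).
        have E := @integral_indic _ _ R CS setT measurableT _ mB.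
        by rewrite setIT in E; exact: esym E.
      apply: eq_integral => s _; congr EFin.
      have -> : \1_(move_y @^-1` A) s = \1_A (move_y s) :> R.
        by rewrite !indicE; congr (nat_of_bool _)%:R; apply/idP/idP; rewrite !inE.
      by rewrite /F /move_y /=; case: ifP.
    rewrite (int_yzu (fun wu => (F wu)%:E))//; apply: eq_integral => w _.
    by rewrite /F /=; apply: ge0_integral_unif_if.
have T2MT : ((k%:R * h) ^+ 2 * M <= 3^-1)%R by have := MT; rewrite -/T; lra.
pose r := (m * T ^+ 2 / 4)%R.
pose S (w : phase) : R := (verlet_speed g T w.1 w.2 ^+ 2)%R.
pose rej (wu : phase * measurableTypeR R) : R :=
  if (wu.2 < al wu.1)%R then 0%R else sqnorm2 ((pr wu.1).1 - wu.1.1).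
have S0 w : (0 <= S w)%R by exact: sqr_ge0.
have rej0 wu : (0 <= rej wu)%R by rewrite /rej; case: ifP => // _; exact: sqnorm2_ge0.
have mrej : measurable_fun setT rej.
  apply: measurable_fun_ifT => //.
    apply: measurable_fun_ltr; first exact: measurable_snd.
    exact: (measurableT_comp mal measurable_fst).
  apply: measurable_sqnorm2; apply: measurable_rV_add.
    exact: (measurableT_comp mpr measurable_fst).
  by apply: measurable_rV_opp; exact: (measurableT_comp measurable_fst measurable_fst).
pose a1 := ((1 + t) * (1 - r))%R; pose b1 := ((1 + t^-1) * 2)%R.
pose q := ((M * h * T ^+ 2) ^+ 2)%R.
have r1 : (r <= 1)%R.
  have [_ mM _] := fg; have T20 : (0 <= T ^+ 2)%R := sqr_ge0 T.
  by have := ler_wpM2r T20 mM; have := MT; rewrite /r; lra.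
have a10 : (0 <= a1)%R by apply: mulr_ge0; [rewrite addr_ge0// ltW|rewrite subr_ge0].
have ti0 : (0 < t^-1)%R by rewrite invr_gt0.
have b10 : (0 <= b1)%R by apply: mulr_ge0 => //; rewrite addr_ge0// ltW.
have q0 : (0 <= q)%R by exact: sqr_ge0.
have pw s : (sqnorm2 (move_x s - move_y s) <= a1 * sqnorm2 (s.1.1 - s.1.2) +
    b1 * (q * S (yz s) + rej (yz s, s.2.2)))%R.
  case: s => -[x y] [z u]; rewrite /move_x /move_y /rej /xz /yz /=.
  (* Four points are compared in a chain: [p1] to [p2] by contraction, [p2] to the fine end point
     [p3] by refinement, and [p3] to [y'] by rejection. Young's inequality with parameter [t]
     protects the contraction from the other two. *)
  set p1 := (verlet g h k (x, z)).1; set p2 := (verlet g h k (y, z)).1.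
  set p3 := (pr (y, z)).1; set y' := if _ then _ else _.
  have H1 : (sqnorm2 (p1 - p2) <= (1 - r) * sqnorm2 (x - y))%R.
    exact: (verlet_contraction fg x y z T2MT).
  have H2 : (sqnorm2 (p2 - p3) <= q * S (y, z))%R.
    have le_T : (k%:R * h <= T)%R by [].
    have := verlet_refine M0 gL T0 MT y z i h0 le_T.
    rewrite -/p2 -[(verlet _ _ _ _).1]/p3 => H.
    have S1 : (0 <= verlet_speed g T y z)%R := verlet_speed_ge0 g T0 y z.
    have B0 : (0 <= M * h * verlet_speed g T y z * T ^+ 2)%R.
      apply: mulr_ge0; last exact: sqr_ge0.
      by do 2![apply: mulr_ge0 => //]; exact: ltW.
    have {}H : (enorm (p2 - p3) <= M * h * verlet_speed g T y z * T ^+ 2)%R.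
      apply: le_trans H _; rewrite -[leRHS]mulr1; apply: ler_wpM2l => //.
    rewrite -sqr_enorm (_ : (q * S (y, z) = (M * h * verlet_speed g T y z * T ^+ 2) ^+ 2)%R).
      by rewrite ler_sqr ?nnegrE ?enorm_ge0.
    by rewrite /q /S /=; ring.
  have H3 : (sqnorm2 (p3 - y') = if (u < al (y, z))%R then 0 else sqnorm2 (p3 - y))%R.
    by rewrite /y'; case: ifP => _; rewrite ?subrr ?sqnorm20.
  rewrite -H3 (_ : p1 - y' = (p1 - p2) + ((p2 - p3) + (p3 - y')))%R; last first.
    by rewrite !addrA !subrK.
  apply: le_trans (sqnorm2D_young _ _ t0) _; apply: lerD.
    by rewrite /a1 -mulrA; apply: ler_wpM2l => //; rewrite addr_ge0// ltW.
  rewrite /b1 -mulrA; apply: ler_wpM2l; first by rewrite addr_ge0// ltW.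
  by apply: le_trans (sqnorm2D_le _ _) _; rewrite ler_pM2l// lerD2r.
have mD (X Y : space -> 'rV[R]_n) : measurable_fun setT X -> measurable_fun setT Y ->
    measurable_fun setT (fun s => (sqnorm2 (X s - Y s))%:E).
  move=> mX mY; apply/measurable_EFinP; apply: measurable_sqnorm2.
  by apply: measurable_rV_add => //; exact: measurable_rV_opp.
have mDw : measurable_fun setT (fun w : phase => (sqnorm2 (w.1 - w.2))%:E).
  apply/measurable_EFinP; apply: measurable_sqnorm2; apply: measurable_rV_add.
    exact: measurable_fst.
  by apply: measurable_rV_opp; exact: measurable_snd.
have -> : \int[G']_w (sqnorm2 (w.1 - w.2))%:E =
    \int[CS]_s (sqnorm2 (move_x s - move_y s))%:E.
  apply: (@ge0_integral_law _ _ _ _ R (fun s => (move_x s, move_y s)) CS G'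
    (fun w => (sqnorm2 (w.1 - w.2))%:E)) => // w.
  by rewrite lee_fin sqnorm2_ge0.
have mS : measurable_fun setT (fun s => (S (yz s))%:E).
  by apply/measurable_EFinP; exact: (measurableT_comp (measurable_sqspeed mg h k) myz).
have mR : measurable_fun setT (fun s : space => (rej (yz s, s.2.2))%:E).
  apply/measurable_EFinP; apply: (measurableT_comp mrej).
  apply/measurable_fun_pairP; split => //; exact: (measurableT_comp measurable_snd measurable_snd).
have mXY : measurable_fun setT (fun s : space => (sqnorm2 (s.1.1 - s.1.2))%:E).
  exact: (measurableT_comp mDw measurable_fst).
apply: (@le_trans _ _ (\int[CS]_s (a1%:E * (sqnorm2 (s.1.1 - s.1.2))%:E +
    b1%:E * (q%:E * (S (yz s))%:E + (rej (yz s, s.2.2))%:E)))).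
  apply: ge0_le_integral => //.
  - by move=> s _; rewrite lee_fin sqnorm2_ge0.
  - exact: mD.
  - apply: emeasurable_funD; apply: emeasurable_funM => //.
    by apply: emeasurable_funD => //; exact: emeasurable_funM.
  - by move=> s _; have := pw s; rewrite -lee_fin; exact.
have xy0 s : 0 <= (sqnorm2 (s.1.1 - s.1.2) : R)%:E by rewrite lee_fin sqnorm2_ge0.
have S0E s : 0 <= (S (yz s))%:E by rewrite lee_fin.
have R0E (s : space) : 0 <= (rej (yz s, s.2.2))%:E by rewrite lee_fin.
have a1E : 0 <= a1%:E by rewrite lee_fin.
have b1E : 0 <= b1%:E by rewrite lee_fin.
have qE : 0 <= q%:E by rewrite lee_fin.
have mqS : measurable_fun setT (fun s => q%:E * (S (yz s))%:E) by exact: emeasurable_funM.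
have mqSR : measurable_fun setT (fun s : space => q%:E * (S (yz s))%:E + (rej (yz s, s.2.2))%:E).
  exact: emeasurable_funD.
have qS0 s : 0 <= q%:E * (S (yz s))%:E by rewrite mule_ge0.
have qSR0 (s : space) : 0 <= q%:E * (S (yz s))%:E + (rej (yz s, s.2.2))%:E by rewrite adde_ge0.
rewrite ge0_integralD//; last 4 first.
- by move=> s _; rewrite mule_ge0.
- exact: emeasurable_funM.
- by move=> s _; rewrite mule_ge0.
- exact: emeasurable_funM.
rewrite ge0_integralZl// (ge0_integralZl _ _ mqSR)// ge0_integralD// ge0_integralZl//.
have EG : \int[CS]_s (sqnorm2 (s.1.1 - s.1.2))%:E <= C%:E.
  apply: le_trans GC; rewrite le_eqVlt; apply/orP; left; apply/eqP.
  apply: (int_xy (fun w => (sqnorm2 (w.1 - w.2))%:E)) => // w.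
  by rewrite lee_fin sqnorm2_ge0.
have ES : \int[CS]_s (S (yz s))%:E <= (40 * n%:R)%:E.
  apply: le_trans (speed_moment fg x0min mf mg piE gamE MT).
  rewrite (int_yzu (fun wu => (S wu.1)%:E))//; last 2 first.
  - by apply/measurable_EFinP; exact: (measurableT_comp (measurable_sqspeed mg h k) measurable_fst).
  - by move=> w; rewrite lee_fin.
  rewrite le_eqVlt; apply/orP; left; apply/eqP; apply: eq_integral => w _ /=.
  by rewrite integral_cst// -[RHS]mule1; congr (_ * _); exact: probability_setT.
have ER : \int[CS]_s (rej (yz s, s.2.2))%:E <= eta%:E.
  apply: le_trans Hi; rewrite (int_yzu (fun wu => (rej wu)%:E))//; last exact/measurable_EFinP.
  rewrite le_eqVlt; apply/orP; left; apply/eqP; apply: eq_integral => w _.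
  rewrite /rej /= ge0_integral_unif_if ?sqnorm2_ge0//.
  by rewrite mulr0 add0r.
apply: (@le_trans _ _ (a1%:E * C%:E + b1%:E * (q%:E * (40 * n%:R)%:E + eta%:E))).
  apply: leeD; apply: lee_wpmul2l => //.
  by apply: leeD => //; exact: lee_wpmul2l.
rewrite -[leLHS]/((a1 * C + b1 * (q * (40 * n%:R) + eta))%R%:E) lee_fin le_eqVlt; apply/orP; left; apply/eqP.
by rewrite /a1 /b1 /q /r; ring.
Qed.

End coupling_step.

(** * Programs for the random access machine *)

Section runs.
Variables (R : realType) (d : nat) (g : 'rV[R]_d -> 'rV[R]_d) (w : nat -> R).
Implicit Types (c : cmd) (s : state R) (Q : state R -> Prop).

(** Total correctness with a postcondition, which allows programs to be executed symbolically from
    the front. *)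
Definition runs c s Q := exists2 s', exec g w c s s' & Q s'.

Lemma runs_seq c1 c2 s Q : runs c1 s (fun s1 => runs c2 s1 Q) -> runs (Seq c1 c2) s Q.
Proof. by move=> [s1 e1 [s2 e2 q]]; exists s2 => //; exact: exec_seq e1 e2. Qed.

Lemma runs_instr i s Q : Q (step g w i s) -> runs (Instr i) s Q.
Proof. by move=> q; eexists; [exact: exec_instr|]. Qed.

Lemma runs_while b c (K : nat) (I : nat -> state R -> Prop) s Q :
  (forall j s, I j s -> holds b s = (j < K)%N) ->
  (forall j s, (j < K)%N -> I j s -> runs c (tick 1 s) (I j.+1)) ->
  (forall s, I K s -> Q (tick 1 s)) ->
  I 0%N s -> runs (While b c) s Q.
Proof.
move=> Ib Ic IQ.
suff H j s1 : (j <= K)%N -> I (K - j)%N s1 -> runs (While b c) s1 Q.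
  by move=> I0; apply: (H K) => //; rewrite subnn.
elim: j s1 => [|j IH] s1 jK Is.
  rewrite subn0 in Is; exists (tick 1 s1); last exact: IQ.
  by apply: exec_while_end; rewrite (Ib _ _ Is) ltnn.
have lt : (K - j.+1 < K)%N by lia.
have [s2 e2 I2] := Ic _ _ lt Is.
have [|s3 e3 q3] := IH s2 (ltnW jK); first by rewrite (_ : K - j = (K - j.+1).+1)%N//; lia.
by exists s3 => //; apply: exec_while e2 e3; rewrite (Ib _ _ Is).
Qed.

Lemma main_loop_count b c (K : nat) (I : nat -> state R -> Prop) s :
  (forall j s, I j s -> holds b s = (j < K)%N) ->
  (forall j s, (j < K)%N -> I j s -> runs c (tick 1 s) (I j.+1)) ->
  I 0%N s -> exists2 s', main_loop g w b c K s (tick 1 s') & I K s'.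
Proof.
move=> Ib Ic.
suff H j s1 : (j <= K)%N -> I (K - j)%N s1 ->
    exists2 s', main_loop g w b c j s1 (tick 1 s') & I K s'.
  by move=> I0; apply: (H K) => //; rewrite subnn.
elim: j s1 => [|j IH] s1 jK Is.
  rewrite subn0 in Is; exists s1 => //.
  by apply: main_loop_end; rewrite (Ib _ _ Is) ltnn.
have lt : (K - j.+1 < K)%N by lia.
have [s2 e2 I2] := Ic _ _ lt Is.
have [|s3 e3 q3] := IH s2 (ltnW jK); first by rewrite (_ : K - j = (K - j.+1).+1)%N//; lia.
by exists s3 => //; apply: main_loop_iter e2 e3; rewrite (Ib _ _ Is).
Qed.

(* Cells 0, 1, 2 hold eps, m2, M2. Three blocks of d cells follow, for position,
   velocity and gradient, and then twelve scalars. Registers 1, 2, 3 point to the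
   blocks, registers 4, ..., 15 to the scalars, register 16 holds 1, and register 17
   points to a scratch cell. *)
Definition regval (r : nat) : nat :=
  if r == 0%N then d else if (r < 4)%N then (r.-1 * d + 3)%N
  else if r == 16%N then 1%N else (3 * d + 3 + (r - 4))%N.

(** The number of samples is exact because it is the position in the random stream; the time is only
    an upper bound. Registers from 18 on are left free for loop counters and addresses. *)
Record layout (env : nat -> R) (vec : nat -> 'rV[R]_d) (sc : nat -> R)
    (k t q : nat) (s : state R) : Prop := Layout {
  layout_reg : forall r, (r < 18)%N -> nreg s r = regval r;
  layout_env : forall a, (a < 3)%N -> rmem s a = env a;
  layout_vec : forall b (j : 'I_d), (b < 3)%N -> rmem s (b * d + 3 + j)%N = vec b ord0 j;
  layout_sc : forall i, (i < 12)%N -> rmem s (3 * d + 3 + i)%N = sc i;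
  layout_draws : draws s = k;
  layout_time : (time s <= t)%N;
  layout_queries : queries s = q }.

Variable env : nat -> R.
Implicit Types (vec : nat -> 'rV[R]_d) (sc : nat -> R).

Lemma layout_tick vec sc k t q s n :
  layout env vec sc k t q s -> layout env vec sc k (t + n) q (tick n s).
Proof. by case: s => ? ? ? ? ? [*]; split => //=; rewrite leq_add2r. Qed.

Lemma layout_le vec sc k t t' q s : (t <= t')%N ->
  layout env vec sc k t q s -> layout env vec sc k t' q s.
Proof. by move=> tt [*]; split => //; exact: leq_trans tt. Qed.

Lemma layout_set_nat vec sc k t q s r n : (18 <= r)%N ->
  layout env vec sc k t q s -> layout env vec sc k t q (set_nat s r n).
Proof.
move=> r18 [Hr ? ? ? ? ? ?]; split => //= r' r'18; rewrite /upd; case: eqP => [|_].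
  by lia.
exact: Hr.
Qed.

Lemma layout_ext vec vec' sc sc' k t q s :
  (forall b, (b < 3)%N -> vec b = vec' b) -> (forall i, (i < 12)%N -> sc i = sc' i) ->
  layout env vec sc k t q s -> layout env vec' sc' k t q s.
Proof.
move=> V S [? ? Hv Hs ? ? ?]; split => //.
- by move=> b j b3; rewrite Hv// V.
- by move=> i i12; rewrite Hs// S.
Qed.

Definition operand (sc : nat -> R) (a : addr) : R :=
  match a with Dir i => env i | Ind r => sc (r - 4)%N end.

Definition is_operand (a : addr) : bool :=
  match a with Dir i => (i < 3)%N | Ind r => (4 <= r < 16)%N end.

Lemma get_operand vec sc k t q s a : is_operand a ->
  layout env vec sc k t q s -> get_real s a = operand sc a.
Proof.
case: a => [i|r] /= ia [Hr He ? Hs ? ? ?]; rewrite /get_real /=; first exact: He.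
case/andP: ia => r4 r16.
have -> : nreg s r = (3 * d + 3 + (r - 4))%N.
  rewrite Hr; last by lia.
  by rewrite /regval; case: eqP => [|_]; [lia|case: ltnP => [|_]; [lia|case: eqP => // ?; lia]].
by apply: Hs; lia.
Qed.

Lemma layout_set_scalar vec sc k t q s i (x : R) : (i < 12)%N ->
  layout env vec sc k t q s ->
  layout env vec (upd sc i x) k t q (set_real s (Ind (i + 4)) x).
Proof.
move=> i12 [Hr He Hv Hs Hd Ht Hq].
have E : nreg s (i + 4) = (3 * d + 3 + i)%N.
  rewrite Hr; last by lia.
  rewrite /regval; case: eqP => [|_]; first by lia.
  by case: ltnP => [|_]; [lia|case: eqP => ?; lia].
split => //=; rewrite E.
- by move=> a a3; rewrite /upd; case: eqP => [|_]; [lia|exact: He].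
- move=> b j b3; rewrite /upd; case: eqP => [|_]; last exact: Hv.
  by have := ltn_ord j; case: b b3 => [|[|[|]]]//; lia.
- move=> i' i'12; rewrite /upd eqn_add2l; case: eqP => [_|_] //; exact: Hs.
Qed.

Lemma layout_set_vec vec sc k t q s b (j : 'I_d) (a : addr) (x : R) : (b < 3)%N ->
  loc s a = (b * d + 3 + j)%N ->
  layout env vec sc k t q s ->
  layout env (upd vec b (\row_i if i == j then x else vec b ord0 i)) sc k t q
    (set_real s a x).
Proof.
move=> b3 E [Hr He Hv Hs Hd Ht Hq]; have jd := ltn_ord j.
split => //=; rewrite E.
- by move=> a' a3; rewrite /upd; case: eqP => [|_]; [lia|exact: He].
- move=> b' j' b'3; have j'd := ltn_ord j'; rewrite /upd.
  case: (eqVneq b' b) => [->|bb].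
    rewrite mxE eqn_add2l -val_eqE /=.
    by case: eqP => // _; exact: Hv.
  case: eqP => [|_]; last exact: Hv.
  by move: bb; case: b b3 {E} => [|[|[|]]]//; case: b' b'3 => [|[|[|]]]//; lia.
- move=> i i12; rewrite /upd; case: eqP => [|_]; last exact: Hs.
  by case: b b3 {E} => [|[|[|]]]//; lia.
Qed.

Lemma store_in (mm : nat -> R) b (x : 'rV[R]_d) (j : 'I_d) : store mm b x (b + j)%N = x ord0 j.
Proof. by rewrite /store leq_addr addKn valK. Qed.

Lemma store_out (mm : nat -> R) b (x : 'rV[R]_d) a :
  ((a < b) || (b + d <= a))%N -> store mm b x a = mm a.
Proof.
move=> H; rewrite /store; case: ifP => // ba; rewrite insubF//.
by apply/negbTE; rewrite -leqNgt; lia.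
Qed.

Lemma layout_grad vec sc k t q s b b' : (b < 3)%N -> (b' < 3)%N ->
  layout env vec sc k t q s ->
  layout env (upd vec b' (g (vec b))) sc k (t + d) q.+1 (step g w (Grad (Ind b.+1) (Ind b'.+1)) s).
Proof.
move=> b3 b'3 [Hr He Hv Hs Hd Ht Hq].
have E r : (r < 3)%N -> nreg s r.+1 = (r * d + 3)%N.
  by move=> r3; rewrite Hr; [rewrite /regval /= ltnS r3|lia].
split => //=; rewrite ?E ?leq_add2r ?Hq//.
- by move=> a a3; rewrite store_out ?He//; lia.
- have -> : load d (rmem s) (b * d + 3) = vec b.
    by apply/rowP => j; rewrite mxE Hv.
  move=> b1 j b13; rewrite /upd; case: (eqVneq b1 b') => [->|bb]; first by rewrite store_in.
  rewrite store_out ?Hv//; have := ltn_ord j.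
  by move: bb; case: b' b'3 {E} => [|[|[|]]]//; case: b1 b13 => [|[|[|]]]//; lia.
- move=> i i12; rewrite store_out ?Hs//.
  by case: b' b'3 {E} => [|[|[|]]]//; lia.
Qed.

End runs.

Notation cell i := (Ind (i + 4)).

Definition seqs (cs : seq cmd) : cmd := foldr Seq Skip cs.

Inductive scalar_instr :=
  | SBin of binop & nat & addr & addr
  | SUn of unop & nat & addr
  | SConst of nat & rat
  | SDim of nat.

Definition scalar_code (i : scalar_instr) : cmd :=
  Instr match i with
  | SBin o i a b => RealBin o (cell i) a b
  | SUn o i a => RealUn o (cell i) a
  | SConst i q => RealConst (cell i) q
  | SDim i => RealOfNat (cell i) 0
  end.

Definition scalar_ok (i : scalar_instr) : bool :=
  match i with
  | SBin _ i a b => [&& (i < 12)%N, is_operand a & is_operand b]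
  | SUn _ i a => (i < 12)%N && is_operand a
  | SConst i _ => (i < 12)%N
  | SDim i => (i < 12)%N
  end.

Definition gauss_loop : cmd :=
  Seq (Instr (NatConst 18 0))
    (While (NatLt 18 0)
      (seqs [:: Instr (NatAdd 19 2 18); Instr (Gauss (Ind 19)); Instr (NatAdd 18 18 16)])).

(* Block [b'] := block [b'] op (cell [i]) * block [b]. *)
Definition axpy_loop (o : binop) (i b b' : nat) : cmd :=
  Seq (Instr (NatConst 18 0))
    (While (NatLt 18 0)
      (seqs [:: Instr (NatAdd 19 b.+1 18); Instr (NatAdd 20 b'.+1 18);
        Instr (RealBin Mul (Ind 17) (cell i) (Ind 19));
        Instr (RealBin o (Ind 20) (Ind 20) (Ind 17));
        Instr (NatAdd 18 18 16)])).

(** * Correctness and cost of the scalar and vector routines *)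

Section vector_programs.
Variables (R : realType) (d : nat) (g : 'rV[R]_d -> 'rV[R]_d) (w : nat -> R).
Variable env : nat -> R.
Implicit Types (vec : nat -> 'rV[R]_d) (sc : nat -> R).
Notation runs := (runs g w).

Lemma runs_skip s Q : Q s -> runs Skip s Q.
Proof. by move=> q; exists s => //; exact: exec_skip. Qed.

Lemma runs_cons c cs s Q : runs c s (fun s1 => runs (seqs cs) s1 Q) -> runs (seqs (c :: cs)) s Q.
Proof. exact: runs_seq. Qed.

Lemma runs_step i cs s Q : runs (seqs cs) (step g w i s) Q -> runs (seqs (Instr i :: cs)) s Q.
Proof. by move=> H; apply: runs_cons; exact: runs_instr. Qed.

Definition scalar_eval (sc : nat -> R) (i : scalar_instr) : nat -> R :=
  match i with
  | SBin o i a b => upd sc i (eval_binop o (operand env sc a) (operand env sc b))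
  | SUn o i a => upd sc i (eval_unop o (operand env sc a))
  | SConst i q => upd sc i (ratr q)
  | SDim i => upd sc i d%:R
  end.

Lemma runs_scalars (prog : seq scalar_instr) cs vec sc k t q s Q : all scalar_ok prog ->
  layout env vec sc k t q s ->
  (forall s', layout env vec (foldl scalar_eval sc prog) k (t + size prog) q s' ->
    runs (seqs cs) s' Q) ->
  runs (seqs (map scalar_code prog ++ cs)) s Q.
Proof.
elim: prog sc t s => [|i prog IH] sc t s /=; first by rewrite addn0 => _ L; apply.
move=> /andP[iok pok] L HQ.
apply: runs_step; apply: (IH (scalar_eval sc i) (t + 1)%N) => //; last first.
  by move=> s' L'; apply: HQ; rewrite (_ : t + (size prog).+1 = t + 1 + size prog)%N//; lia.
clear HQ; case: i iok => [op i a b|op i a|i qq|i] /=.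
- move=> /and3P[i12 oa ob]; apply: layout_tick.
  by rewrite (get_operand oa L) (get_operand ob L); exact: layout_set_scalar.
- move=> /andP[i12 oa]; apply: layout_tick.
  by rewrite (get_operand oa L); exact: layout_set_scalar.
- by move=> i12; apply: layout_tick; exact: layout_set_scalar.
- move=> i12; apply: layout_tick; have -> : nreg s 0 = d by rewrite (layout_reg L).
  exact: layout_set_scalar.
Qed.

Lemma runs_scalar (i : scalar_instr) vec sc k t q s Q : scalar_ok i ->
  layout env vec sc k t q s ->
  (forall s', layout env vec (scalar_eval sc i) k (t + 1) q s' -> Q s') ->
  runs (scalar_code i) s Q.
Proof.
move=> iok L HQ.
have := @runs_scalars [:: i] [::] vec sc k t q s Q; rewrite /= iok => /(_ isT L) [].
  by move=> s' /HQ q'; exact: runs_skip.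
move=> s' e q'; exists s' => //.
by inversion e as [| |? ? ? s1 ? e1 e2| | |]; subst; inversion e2; subst.
Qed.

(** The state of a block after j rounds of a coordinatewise loop that turns [u] into [v]; the core
    of the loop invariants. *)
Let partial (j : nat) (u v : 'rV[R]_d) : 'rV[R]_d :=
  \row_i if (i < j)%N then v ord0 i else u ord0 i.

Let partial0 u v : partial 0 u v = u.
Proof. by apply/rowP => i; rewrite mxE. Qed.

Let partial_full u v : partial d u v = v.
Proof. by apply/rowP => i; rewrite mxE ltn_ord. Qed.

Let partialS (j : 'I_d) (u v : 'rV[R]_d) :
  (\row_i (if i == j then v ord0 j else partial j u v ord0 i)) = partial j.+1 u v.
Proof.
apply/rowP => i; rewrite !mxE ltnS; case: (ltngtP i j) => ij.
- by rewrite ifF//; apply/negbTE/eqP => E; move: ij; rewrite E ltnn.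
- by rewrite ifF//; apply/negbTE/eqP => E; move: ij; rewrite E ltnn.
- have -> : i = j by exact: val_inj.
  by rewrite eqxx.
Qed.

Lemma runs_gauss vec sc k t q s Q :
  layout env vec sc k t q s ->
  (forall s', layout env (upd vec 1 (\row_i w (k + i)%N)) sc (k + d) (t + 4 * d + 2) q s' -> Q s') ->
  runs gauss_loop s Q.
Proof.
move=> L HQ; apply: runs_seq; apply: runs_instr.
pose I j s := layout env (upd vec 1 (partial j (vec 1%N) (\row_i w (k + i)%N))) sc (k + j)
  (t + 4 * j + 1) q s /\ nreg s 18 = j.
apply: (@runs_while _ _ _ _ _ _ d I).
- by move=> j s1 [L1 n1] /=; rewrite n1 (layout_reg L1).
- move=> j s1 jd [L1 n1].
  do 2! apply: runs_step; apply: runs_step; apply: runs_skip; split => /=; last first.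
    by rewrite /upd /= n1 (layout_reg L1)//= addn1.
  pose j' := Ordinal jd.
  have L2 : layout env (upd vec 1 (partial j (vec 1%N) (\row_i w (k + i)%N))) sc (k + j)
      (t + 4 * j + 1 + 1 + 1) q (step g w (NatAdd 19 2 18) (tick 1 s1)).
    by apply: layout_tick; apply: layout_set_nat => //; exact: layout_tick.
  have a2 : loc (step g w (NatAdd 19 2 18) (tick 1 s1)) (Ind 19) = (1 * d + 3 + j')%N.
    by rewrite /= /upd /= (layout_reg L1)// n1.
  have L3 := layout_set_vec (w (draws s1)) (isT : (1 < 3)%N) a2 L2.
  have L4 : layout env (upd vec 1 (partial j.+1 (vec 1%N) (\row_i w (k + i)%N))) sc (k + j).+1
      (t + 4 * j + 1 + 1 + 1 + 1) q
      (step g w (Gauss (Ind 19)) (step g w (NatAdd 19 2 18) (tick 1 s1))).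
    apply: (@layout_ext _ _ _ (upd (upd vec 1 (partial j (vec 1%N) (\row_i w (k + i)%N))) 1
      (\row_i0 (if i0 == j' then w (draws s1) else
        upd vec 1 (partial j (vec 1%N) (\row_i w (k + i)%N)) 1%N ord0 i0))) _ sc) => //.
      move=> b b3; rewrite /upd; case: eqP => // _.
      rewrite -[RHS](@partialS j'); apply/rowP => i; rewrite !mxE (layout_draws L1).
      by case: eqP.
    case: L3 => A1 A2 A3 A4 A5 A6 A7; split => //=.
      by rewrite (layout_draws L1).
    by move: A6 => /=; lia.
  rewrite (_ : (t + 4 * j.+1 + 1 = t + 4 * j + 1 + 1 + 1 + 1 + 1)%N); last by lia.
  by rewrite addnS; apply: layout_tick; apply: layout_set_nat.
- move=> s1 [L1 _]; apply: HQ; rewrite (_ : (t + 4 * d + 2 = t + 4 * d + 1 + 1)%N); last by lia.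
  apply: layout_tick; apply: layout_ext L1 => // b _.
  by rewrite /upd; case: eqP => // _; rewrite partial_full.
- split => //=; rewrite muln0 !addn0; apply: layout_tick; apply: layout_set_nat => //.
  by apply: layout_ext L => // b _; rewrite /upd; case: eqP => [->|//]; rewrite partial0.
Qed.

Lemma layout_set_scratch vec sc k t q s (x : R) :
  layout env vec sc k t q s -> layout env vec sc k t q (set_real s (Ind 17) x).
Proof.
move=> [Hr He Hv Hs Hd Ht Hq].
have E : nreg s 17 = (3 * d + 16)%N by rewrite Hr//= /regval /=; lia.
split => //=; rewrite E.
- by move=> a a3; rewrite /upd; case: eqP => [|_]; [lia|exact: He].
- move=> b j b3; rewrite /upd; case: eqP => [|_]; last exact: Hv.
  by have := ltn_ord j; case: b b3 => [|[|[|]]]//; lia.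
- by move=> i i12; rewrite /upd; case: eqP => [|_]; [lia|exact: Hs].
Qed.

Lemma runs_axpy (op : binop) (i b b' : nat) vec sc k t q s Q :
  (i < 12)%N -> (b < 3)%N -> (b' < 3)%N -> b != b' ->
  layout env vec sc k t q s ->
  (forall s', layout env (upd vec b'
      (\row_l eval_binop op (vec b' ord0 l) (sc i * vec b ord0 l))) sc k
      (t + 6 * d + 2) q s' -> Q s') ->
  runs (axpy_loop op i b b') s Q.
Proof.
move=> i12 b3 b'3 bb' L HQ; apply: runs_seq; apply: runs_instr.
pose new := \row_l eval_binop op (vec b' ord0 l) (sc i * vec b ord0 l).
pose I j s := layout env (upd vec b' (partial j (vec b') new)) sc k
  (t + 6 * j + 1) q s /\ nreg s 18 = j.
have rE r s1 t1 vec1 : layout env vec1 sc k t1 q s1 -> (r < 3)%N -> nreg s1 r.+1 = (r * d + 3)%N.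
  by move=> L1 r3; rewrite (layout_reg L1); [rewrite /regval /= ltnS r3|lia].
apply: (@runs_while _ _ _ _ _ _ d I).
- by move=> j s1 [L1 n1] /=; rewrite n1 (layout_reg L1).
- move=> j s1 jd [L1 n1].
  do 4! apply: runs_step; apply: runs_step; apply: runs_skip.
  pose j' := Ordinal jd.
  set s2 := step g w (NatAdd 19 b.+1 18) (tick 1 s1).
  set s3 := step g w (NatAdd 20 b'.+1 18) s2.
  set s4 := step g w (RealBin Mul (Ind 17) (cell i) (Ind 19)) s3.
  set s5 := step g w (RealBin op (Ind 20) (Ind 20) (Ind 17)) s4.
  have L2 : layout env (upd vec b' (partial j (vec b') new)) sc k (t + 6 * j + 1 + 1 + 1) q s2.
    by apply: layout_tick; apply: layout_set_nat => //; exact: layout_tick.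
  have L3 : layout env (upd vec b' (partial j (vec b') new)) sc k (t + 6 * j + 1 + 1 + 1 + 1) q s3.
    by apply: layout_tick; apply: layout_set_nat.
  have n19 : nreg s3 19 = (b * d + 3 + j')%N.
    by rewrite /s3 /s2 /= /upd /= n1 (rE _ _ _ _ L1).
  have n20 : nreg s3 20 = (b' * d + 3 + j')%N.
    have -> : nreg s3 20 = (nreg s2 b'.+1 + nreg s2 18)%N by [].
    by rewrite (rE _ _ _ _ L2)//; congr (_ + _)%N; rewrite /s2 /= /upd /= n1.
  have L4 : layout env (upd vec b' (partial j (vec b') new)) sc k (t + 6 * j + 1 + 1 + 1 + 1 + 1) q s4.
    by apply: layout_tick; exact: layout_set_scratch.
  have n17 : nreg s3 17 = (3 * d + 16)%N by rewrite (layout_reg L3)//= /regval /=; lia.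
  have v17 : get_real s4 (Ind 17) = sc i * vec b ord0 j'.
    have -> : get_real s4 (Ind 17) = get_real s3 (cell i) * get_real s3 (Ind 19).
      by rewrite {1}/get_real /s4 /= /upd eqxx.
    have oi : is_operand (cell i) by rewrite /=; lia.
    rewrite (get_operand oi L3) /operand addnK; congr (_ * _).
    have -> : get_real s3 (Ind 19) = rmem s3 (nreg s3 19) by [].
    by rewrite n19 (layout_vec L3)// /upd (negbTE bb').
  have v20 : get_real s4 (Ind 20) = vec b' ord0 j'.
    have -> : get_real s4 (Ind 20) = rmem s4 (nreg s3 20) by [].
    by rewrite n20 (layout_vec L4)// /upd eqxx mxE ltnn.
  have a4 : loc s4 (Ind 20) = (b' * d + 3 + j')%N by exact: n20.
  have L5 : layout env (upd vec b' (partial j.+1 (vec b') new)) sc k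
      (t + 6 * j + 1 + 1 + 1 + 1 + 1 + 1) q s5.
    have H := layout_set_vec (eval_binop op (get_real s4 (Ind 20)) (get_real s4 (Ind 17))) b'3 a4 L4.
    apply: layout_tick; apply: layout_ext H => // b1 _; rewrite /upd; case: eqP => // _.
    rewrite -[RHS](@partialS j'); apply/rowP => l; rewrite !mxE eqxx v17 v20.
    by case: eqP => // _; rewrite !mxE.
  have n18 : nreg s5 18 = j by rewrite /s5 /s4 /s3 /s2 /= /upd /= n1.
  split; last first.
    have -> : nreg (step g w (NatAdd 18 18 16) s5) 18 = (nreg s5 18 + nreg s5 16)%N by [].
    by rewrite n18 (layout_reg L5)// /regval /= addn1.
  rewrite (_ : (t + 6 * j.+1 + 1 = t + 6 * j + 1 + 1 + 1 + 1 + 1 + 1 + 1)%N); last by lia.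
  by apply: layout_tick; exact: layout_set_nat.
- move=> s1 [L1 _]; apply: HQ; rewrite (_ : (t + 6 * d + 2 = t + 6 * d + 1 + 1)%N); last by lia.
  apply: layout_tick; apply: layout_ext L1 => // b1 _.
  by rewrite /upd; case: eqP => // _; rewrite partial_full.
- split => //=; rewrite muln0 !addn0; apply: layout_tick; apply: layout_set_nat => //.
  by apply: layout_ext L => // b1 _; rewrite /upd; case: eqP => [->|//]; rewrite partial0.
Qed.

End vector_programs.

(* Scalar cells: 0 the step size, 1 and 3 the bounds on the numbers of Verlet
   steps and of iterations, 2 and 4 the corresponding counters, 6 the constant 1,
   7 half the step size, 5 and 8, ..., 11 temporaries. *)
Definition increment (i : nat) : cmd := scalar_code (SBin Add i (cell i) (cell 6)).

(** The gradient at the end of a step is queried again at the start of the next, which affects only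
    the constant. The counter is a real number, so that it can be compared with a real bound without
    rounding. *)
Definition verlet_loop : cmd :=
  While (RealLt (cell 2) (cell 1))
    (seqs [:: Instr (Grad (Ind 1) (Ind 3)); axpy_loop Defs.Sub 7 2 1; axpy_loop Add 0 1 0;
      Instr (Grad (Ind 1) (Ind 3)); axpy_loop Defs.Sub 7 2 1; increment 2]).

Definition hmc_body : cmd :=
  seqs [:: gauss_loop; scalar_code (SConst 2 0%R); verlet_loop; increment 4].

Section body_program.
Variables (R : realType) (d : nat) (g : 'rV[R]_d -> 'rV[R]_d) (w : nat -> R).
Variable env : nat -> R.
Implicit Types (vec : nat -> 'rV[R]_d) (sc : nat -> R).
Notation runs := (runs g w).

Definition blocks (p : 'rV[R]_d * 'rV[R]_d) (G : 'rV[R]_d) (b : nat) : 'rV[R]_d :=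
  if b == 0%N then p.1 else if b == 1%N then p.2 else G.

(** A round costs 2 d for the gradients, 3 (6 d + 2) for the vector updates and 2 for the test and
    the counter: 20 d + 8 in all. *)
Lemma runs_verlet_loop (h : R) (K : nat) p sc k t q G s Q :
  sc 0%N = h -> sc 2%N = 0 -> sc 6%N = 1 -> sc 7%N = h / 2 ->
  (forall j, (j%:R < sc 1%N) = (j < K)%N) ->
  layout env (blocks p G) sc k t q s ->
  (forall s' G', layout env (blocks (verlet g h K p) G') (upd sc 2 K%:R) k
    (t + K * (20 * d + 8) + 1) (q + 2 * K) s' -> Q s') ->
  runs verlet_loop s Q.
Proof.
move=> s0 s2 s6 s7 HK L HQ.
pose I j s := exists G', layout env (blocks (verlet g h j p) G') (upd sc 2 j%:R) k
    (t + j * (20 * d + 8)) (q + 2 * j) s.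
apply: (@runs_while _ _ _ _ _ _ K I).
- move=> j s1 [G1 L1]; rewrite /holds.
  by rewrite (get_operand _ L1)// (get_operand _ L1)//= /upd /= HK.
- move=> j s1 jK [G1 L1].
  pose sc1 := upd sc 2 j%:R.
  pose p1 := verlet g h j p; pose p2 := kick g (h / 2) p1; pose p3 := drift h p2.
  pose p4 := kick g (h / 2) p3.
  apply: runs_step.
  have L2 := layout_grad g w (isT : (0 < 3)%N) (isT : (2 < 3)%N) (layout_tick 1 L1).
  apply: runs_cons; apply: (runs_axpy g w (i := 7) (b := 2) (b' := 1) _ _ _ _ L2) => // s3 L3.
  have {}L3 : layout env (blocks p2 (g p1.1)) sc1 k
      (t + j * (20 * d + 8) + 1 + d + 6 * d + 2) (q + 2 * j).+1 s3.
    apply: layout_ext L3 => // -[|[|[|]]] //= _; apply/rowP => l.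
    by rewrite ?/sc1 /upd /= !mxE /blocks /= s7.
  apply: runs_cons; apply: (runs_axpy g w (i := 0) (b := 1) (b' := 0) _ _ _ _ L3) => // s4 L4.
  have {}L4 : layout env (blocks p3 (g p1.1)) sc1 k
      (t + j * (20 * d + 8) + 1 + d + 6 * d + 2 + 6 * d + 2) (q + 2 * j).+1 s4.
    apply: layout_ext L4 => // -[|[|[|]]] //= _; apply/rowP => l.
    by rewrite /sc1 /upd /= !mxE /blocks /= s0.
  apply: runs_step.
  have L5 := layout_grad g w (isT : (0 < 3)%N) (isT : (2 < 3)%N) L4.
  apply: runs_cons; apply: (runs_axpy g w (i := 7) (b := 2) (b' := 1) _ _ _ _ L5) => // s6' L6.
  have {}L6 : layout env (blocks p4 (g p3.1)) sc1 k
      (t + j * (20 * d + 8) + 1 + d + 6 * d + 2 + 6 * d + 2 + d + 6 * d + 2) (q + 2 * j).+2 s6'.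
    apply: layout_ext L6 => // -[|[|[|]]] //= _; apply/rowP => l.
    by rewrite ?/sc1 /upd /= !mxE /blocks /= s7.
  apply: runs_cons; apply: (runs_scalar g w _ L6) => // s7' L7; apply: runs_skip.
  exists (g p3.1).
  have -> : (q + 2 * j.+1 = (q + 2 * j).+2)%N by lia.
  apply: layout_le (layout_ext _ _ L7) => //; first by lia.
  move=> i _; rewrite /= /sc1 /upd /=; case: eqP => // _.
  by rewrite s6 -natr1.
- move=> s1 [G1 L1]; apply: (HQ _ G1); exact: layout_tick.
- exists G; rewrite mul0n muln0 !addn0; apply: layout_ext L => // i _.
  by rewrite /upd; case: eqP => [->|].
Qed.

Lemma runs_hmc_body (h : R) (K : nat) x sc k t q vec s Q :
  sc 0%N = h -> sc 6%N = 1 -> sc 7%N = h / 2 ->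
  (forall j, (j%:R < sc 1%N) = (j < K)%N) -> vec 0%N = x ->
  layout env vec sc k t q s ->
  (forall s' vec' sc', vec' 0%N = (verlet g h K (x, \row_i w (k + i)%N)).1 ->
    (forall i, i != 2%N -> sc' i = upd sc 4 (sc 4 + 1) i) ->
    layout env vec' sc' (k + d) (t + (4 * d + K * (20 * d + 8) + 5)) (q + 2 * K) s' -> Q s') ->
  runs hmc_body s Q.
Proof.
move=> s0 s6 s7 HK vx L HQ.
apply: runs_cons; apply: (@runs_gauss _ _ g w env _ _ _ _ _ _ _ L) => s1 L1.
apply: runs_cons; apply: (runs_scalar g w _ L1) => // s2 L2.
have {}L2 : layout env (blocks (x, \row_i w (k + i)%N) (vec 2%N)) (scalar_eval d env sc (SConst 2 0))
    (k + d) (t + 4 * d + 2 + 1) q s2.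
  by apply: layout_ext L2 => // -[|[|[|]]] //= _; rewrite /upd /blocks /= vx.
apply: runs_cons.
apply: (runs_verlet_loop (h := h) (K := K) _ _ _ _ _ L2) => //; first exact: rmorph0.
move=> s3 G' L3; apply: runs_cons; apply: (runs_scalar g w _ L3) => // s4 L4; apply: runs_skip.
apply: (HQ _ _ _ _ _ (layout_le _ L4)) => //; last by lia.
by move=> i /negbTE i2; rewrite /= /upd /= i2 s6.
Qed.

End body_program.

Definition init_registers : seq instr :=
  [:: NatConst 1 3; NatAdd 2 0 1; NatAdd 3 0 2; NatAdd 4 0 3; NatConst 16 1;
      NatAdd 5 4 16; NatAdd 6 5 16; NatAdd 7 6 16; NatAdd 8 7 16; NatAdd 9 8 16;
      NatAdd 10 9 16; NatAdd 11 10 16; NatAdd 12 11 16; NatAdd 13 12 16; NatAdd 14 13 16;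
      NatAdd 15 14 16; NatAdd 17 15 16; NatAdd 17 17 16].

(* In terms of kappa = M2 / m2: cell 0 gets the integration time, cell 1 the bound on
   the number of Verlet steps, and cell 3 the bound on the number of iterations. *)
Definition init_scalars : seq scalar_instr :=
  [:: SBin Div 8 (Dir 2) (Dir 1); SUn Sqrt 9 (cell 8); SUn Sqrt 10 (cell 9); SDim 11;
      SConst 6 1%:R; SConst 5 2%:R;
      SBin Mul 0 (Dir 2) (cell 9); SUn Sqrt 0 (cell 0); SBin Mul 0 (cell 5) (cell 0);
      SBin Div 0 (cell 6) (cell 0);
      SUn Sqrt 1 (cell 11); SBin Mul 1 (cell 10) (cell 1); SConst 7 100%:R;
      SBin Mul 1 (cell 7) (cell 1); SBin Div 1 (cell 1) (Dir 0);
      SBin Div 3 (cell 11) (Dir 0); SUn Ln 3 (cell 3); SBin Mul 3 (cell 5) (cell 3);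
      SConst 7 3%:R; SBin Add 3 (cell 7) (cell 3); SBin Mul 3 (cell 9) (cell 3);
      SBin Mul 3 (cell 8) (cell 3); SConst 7 32%:R; SBin Mul 3 (cell 7) (cell 3);
      SConst 2 0%:R; SConst 4 0%:R].

(** The loop rounds the step bound up to an integer K, kept as a real number in cell 2; dividing by
    it makes K steps last exactly the integration time. *)
Definition hmc_init : cmd :=
  seqs (map Instr init_registers ++ map scalar_code init_scalars ++
    While (RealLt (cell 2) (cell 1)) (increment 2) ::
    map scalar_code [:: SBin Div 0 (cell 0) (cell 2); SBin Div 7 (cell 0) (cell 5)]).

Definition hmc : algorithm := Algorithm hmc_init (RealLt (cell 4) (cell 3)) hmc_body.

(** * Execution of the whole algorithm *)

Section hmc_run.
Variables (R : realType) (d : nat) (g : 'rV[R]_d -> 'rV[R]_d) (w : nat -> R).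
Variables (eps m M : R) (x0 : 'rV[R]_d).
Notation runs := (runs g w).
Let env := upd (upd (upd (fun=> 0) 0 eps) 1 m) 2 M.

(** With this time the contraction rate r = m T^2 / 4 is 1 / (16 kappa^(3/2)), so the factor 32 of
    [iteration_bound] makes N r / 2 at least 3 + 2 ln (d / eps). The factor 100 of [step_bound]
    makes the accumulated discretization error at most half of eps^2 / m. *)
Definition integration_time : R := 1 / (2 * Num.sqrt (M * Num.sqrt (M / m))).
Definition step_bound : R := 100 * (Num.sqrt (Num.sqrt (M / m)) * Num.sqrt d%:R) / eps.
Definition iteration_bound : R :=
  32 * (M / m * (Num.sqrt (M / m) * (3 + 2 * ln (d%:R / eps)))).

Variables K N : nat.
Hypothesis HK : forall j, (j%:R < step_bound) = (j < K)%N.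
Hypothesis HN : forall j, (j%:R < iteration_bound) = (j < N)%N.

Fixpoint iterates (n : nat) : 'rV[R]_d :=
  if n is n'.+1 then
    (verlet g (integration_time / K%:R) K (iterates n', \row_i w (n' * d + i)%N)).1
  else x0.

Let pointers (n : nat) (s : state R) :=
  (forall r, (r < n)%N -> nreg s r = regval d r) /\ nreg s 16 = 1%N.

Let pointersS n s : (4 < n < 16)%N -> pointers n s ->
  pointers n.+1 (step g w (NatAdd n n.-1 16) s).
Proof.
move=> /andP[n4 n16] [H H16]; split; last first.
  by rewrite /= /upd ifF//; apply/negbTE; lia.
move=> r; rewrite ltnS /= /upd => rn; case: eqP => [->|/eqP rn']; last first.
  by apply: H; rewrite ltn_neqAle rn'.
rewrite H ?H16; last by lia.
rewrite /regval; do ![case: eqP => ?; first by lia].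
by rewrite !ifF; lia.
Qed.

Let pointers_full s : pointers 16 s -> forall r, (r < 18)%N ->
  nreg (step g w (NatAdd 17 17 16) (step g w (NatAdd 17 15 16) s)) r = regval d r.
Proof.
move=> [H E] r r18; rewrite /= /upd /= (H 15%N)// E.
case: eqP => [->|r17]; first by rewrite /regval /=; lia.
by case: (eqVneq r 16%N) => [->|r16] //; apply: H; lia.
Qed.

Lemma runs_init_registers cs Q :
  (forall s vec sc, vec 0%N = x0 -> layout env vec sc 0 18 0 s -> runs (seqs cs) s Q) ->
  runs (seqs (map Instr init_registers ++ cs)) (input eps m M x0) Q.
Proof.
move=> H; do 18! apply: runs_step.
set mm := rmem (input eps m M x0).
apply: (H _ (fun b => load d mm (b * d + 3)) (fun i => mm (3 * d + 3 + i)%N)).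
  by apply/rowP => j; rewrite mxE /mm /= store_in.
split => //.
- have H5 : pointers 5 (step g w (NatConst 16 1) (step g w (NatAdd 4 0 3)
      (step g w (NatAdd 3 0 2) (step g w (NatAdd 2 0 1) (step g w (NatConst 1 3)
      (input eps m M x0)))))).
    by split=> //; do 5! (case=> [_|]; [rewrite /= /upd /= /regval /=; lia|]).
  have H16 : pointers 16 (step g w (NatAdd 15 14 16) (step g w (NatAdd 14 13 16)
      (step g w (NatAdd 13 12 16) (step g w (NatAdd 12 11 16) (step g w (NatAdd 11 10 16)
      (step g w (NatAdd 10 9 16) (step g w (NatAdd 9 8 16) (step g w (NatAdd 8 7 16)
      (step g w (NatAdd 7 6 16) (step g w (NatAdd 6 5 16) (step g w (NatAdd 5 4 16)
      (step g w (NatConst 16 1) (step g w (NatAdd 4 0 3)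
      (step g w (NatAdd 3 0 2) (step g w (NatAdd 2 0 1) (step g w (NatConst 1 3)
      (input eps m M x0))))))))))))))))).
    by do 11! apply: pointersS => //.
  exact: pointers_full.
- by move=> a a3 /=; rewrite store_out// a3.
- by move=> b j b3; rewrite mxE.
Qed.

Lemma runs_count (i i' : nat) (sc : nat -> R) t (n : nat) (vec : nat -> 'rV[R]_d) cs s Q :
  (i < 12)%N -> (i' < 12)%N -> (6%N != i) -> (i' != i) ->
  sc i = 0 -> sc 6%N = 1 -> (forall j, (j%:R < sc i') = (j < n)%N) ->
  layout env vec sc 0 t 0 s ->
  (forall s', layout env vec (upd sc i n%:R) 0 (t + 2 * n + 1) 0 s' -> runs (seqs cs) s' Q) ->
  runs (seqs (While (RealLt (cell i) (cell i')) (increment i) :: cs)) s Q.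
Proof.
move=> i12 i'12 i6 ii' si s6 Hn L HQ; apply: runs_cons.
have oi : is_operand (cell i) by rewrite /=; lia.
have oi' : is_operand (cell i') by rewrite /=; lia.
apply: (@runs_while _ _ g w _ _ n (fun j s => layout env vec (upd sc i j%:R) 0 (t + 2 * j) 0 s)).
- move=> j s1 L1; rewrite /holds (get_operand oi L1) (get_operand oi' L1) /operand !addnK.
  by rewrite /upd eqxx (negbTE ii') Hn.
- move=> j s1 jn L1; apply: (runs_scalar g w (i := SBin Add i (cell i) (cell 6)) _ (layout_tick 1 L1)).
    by rewrite /scalar_ok i12 oi.
  move=> s2 L2; apply: layout_le (layout_ext _ _ L2) => //; first by lia.
  move=> a _; rewrite /= addnK /upd eqxx (negbTE i6); case: eqP => // _.
  by rewrite s6 -natr1.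
- by move=> s1 L1; apply: HQ; exact: layout_tick.
- rewrite muln0 addn0; apply: layout_ext L => // a _; rewrite /upd; case: eqP => // ->.
  by rewrite si.
Qed.

Let ready (n : nat) (sc : nat -> R) := [/\ sc 0%N = integration_time / K%:R, sc 1%N = step_bound,
  sc 3%N = iteration_bound, sc 4%N = n%:R & sc 6%N = 1 /\ sc 7%N = integration_time / K%:R / 2].

(* [simpl] would normalize every copy of the nested environments. *)
Ltac eval_cells := lazy [foldl init_scalars scalar_eval upd operand
  eval_binop eval_unop subn addn Nat.sub Nat.add eq_op hasDecEq.eq_op
  Equality.eqtype_hasDecEq_mixin Equality.class Datatypes_nat__canonical__eqtype_Equality
  ssrnat.HB_unnamed_factory_1 eqn];
  rewrite ?ratr_nat //.

Lemma runs_hmc_init Q :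
  (forall s vec sc, vec 0%N = x0 -> sc 6%N = 1 -> [/\ sc 0%N = integration_time / K%:R,
    sc 1%N = step_bound, sc 3%N = iteration_bound, sc 4%N = 0 &
    sc 7%N = integration_time / K%:R / 2] ->
    layout env vec sc 0 (2 * K + 47) 0 s -> Q s) ->
  runs hmc_init (input eps m M x0) Q.
Proof.
move=> HQ; apply: runs_init_registers => s1 vec sc v0 L1.
apply: (runs_scalars _ L1) => // s2; set sc2 := foldl _ _ _ => L2.
have c0 : sc2 0%N = integration_time by rewrite /sc2 /env; eval_cells.
have c1 : sc2 1%N = step_bound by rewrite /sc2 /env; eval_cells.
have c3 : sc2 3%N = iteration_bound by rewrite /sc2 /env; eval_cells.
have c2 : sc2 2%N = 0 by rewrite /sc2 /env; eval_cells.
have c4 : sc2 4%N = 0 by rewrite /sc2 /env; eval_cells.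
have c5 : sc2 5%N = 2 by rewrite /sc2 /env; eval_cells.
have c6 : sc2 6%N = 1 by rewrite /sc2 /env; eval_cells.
move: sc2 L2 c0 c1 c2 c3 c4 c5 c6 => sc2 L2 c0 c1 c2 c3 c4 c5 c6.
apply: (runs_count (i := 2) (i' := 1) _ _ _ _ c2 c6 _ L2) => //.
  by move=> j; rewrite c1.
move=> s3 L3; rewrite -[map _ _]cats0.
apply: (runs_scalars _ L3) => // s4 L4; apply: runs_skip.
apply: (HQ _ vec _ v0 _ _ (layout_le _ L4)); rewrite /= /upd /= ?c0 ?c5//; lia.
Qed.

Lemma hmc_run : exists s, [/\ run g w hmc (input eps m M x0) N s, output d s = iterates N,
  (time s <= 2 * K + 48 + N * (4 * d + K * (20 * d + 8) + 6))%N & queries s = (N * (2 * K))%N].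
Proof.
pose I n s := exists vec sc, [/\ vec 0%N = iterates n, ready n sc &
  layout env vec sc (n * d) (2 * K + 47 + n * (4 * d + K * (20 * d + 8) + 6)) (n * (2 * K)) s].
have [s1 e1 I1] : runs hmc_init (input eps m M x0) (I 0%N).
  apply: runs_hmc_init => s vec sc v0 c6 [c0 c1 c3 c4 c7] L.
  by exists vec, sc; rewrite !mul0n addn0; split.
have [|||s2 e2 [vec [sc [v0 _ L2]]]] := @main_loop_count _ _ g w (guard hmc) hmc_body N I s1.
- move=> j s [vec [sc [_ [c0 c1 c3 c4 [c6 c7]] L]]]; rewrite /holds /=.
  by rewrite (get_operand _ L)// (get_operand _ L)//= c3 c4 HN.
- move=> j s jN [vec [sc [v0 [c0 c1 c3 c4 [c6 c7]] L]]].
  apply: (runs_hmc_body c0 c6 c7 _ v0 (layout_tick 1 L)) => [i|s' vec' sc' v' H L'].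
    by rewrite c1 HK.
  exists vec', sc'; split => //.
    by split; rewrite ?H// /upd//= c4 natr1.
  rewrite (_ : (j.+1 * d = j * d + d)%N); last by lia.
  rewrite (_ : (j.+1 * (2 * K) = j * (2 * K) + 2 * K)%N); last by lia.
  by apply: layout_le L'; lia.
- exact: I1.
exists (tick 1 s2); split.
- by exists s1.
- by rewrite -v0; apply/rowP => i; rewrite mxE /= (layout_vec L2 (b := 0)).
- by have := layout_time L2; rewrite /=; lia.
- exact: layout_queries L2.
Qed.

End hmc_run.

(** * The chain of iterates and the cost of the algorithm *)

Section chain.
Local Open Scope ereal_scope.
Context (R : realType) d (O : measurableType d) (P : probability O R).
Variable xi : nat -> {RV P >-> R}.
Hypothesis xi_iid : iid_std_gaussian xi.
Variables (n : nat) (f : 'rV[R]_n -> R) (g : 'rV[R]_n -> 'rV[R]_n).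
Variables (m M : R) (x0 : 'rV[R]_n) (K : nat).
Hypothesis fg : smooth_strongly_convex f g m M.
Hypothesis x0min : forall y, (f x0 <= f y)%R.
Hypothesis mf : measurable_fun setT f.
Hypothesis mg : measurable_fun setT g.

Let seq_of a (v : 'rV[R]_a) (i : nat) : R := oapp (v ord0) 0%R (insub i).

Lemma eq_iterates w w' j : (forall i, (i < j * n)%N -> w i = w' i) ->
  iterates g w m M x0 K j = iterates g w' m M x0 K j.
Proof.
elim: j => [//|j IH] ww' /=; rewrite IH; last by move=> i ij; apply: ww'; lia.
congr (verlet _ _ _ (_, _)).1; apply/rowP => i; rewrite !mxE; apply: ww'.
by have := ltn_ord i; lia.
Qed.

(** The iterate as a function of finitely many samples. For a = j n this exhibits it as a measurable
    function of a block that is independent of the next velocity. *)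
Let iter_of a j (v : 'rV[R]_a) := iterates g (seq_of v) m M x0 K j.

Let measurable_iter_of a j : measurable_fun setT (@iter_of a j).
Proof.
elim: j => [|j IH]; first exact: measurable_cst.
apply: (measurableT_comp measurable_fst).
apply: (measurableT_comp (measurable_verlet mg _ _)).
apply/measurable_fun_pairP; split; first exact: IH.
apply/measurable_fun_rVP => i; under eq_fun do rewrite mxE /seq_of.
by case: insub => [l|] /=; [exact: measurable_rV_coord|exact: measurable_cst].
Qed.

Let measurable_iter j :
  measurable_fun setT (iter_of j \o @block R d O P xi 0 (j * n)).
Proof. exact: (measurableT_comp (@measurable_iter_of _ _) (@measurable_block _ _ _ _ _ _ _)). Qed.

Definition chain (j : nat) : {RV P >-> 'rV[R]_n} := mfun_of (measurable_iter j).

Lemma chainE j w : chain j w = iterates g (xi^~ w) m M x0 K j.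
Proof.
apply: eq_iterates => i ij; rewrite /seq_of (insubT (fun i => i < j * n)%N ij) /=.
by rewrite mxE.
Qed.

Let T : R := integration_time m M.
Let h : R := (T / K%:R)%R.

Lemma chain_law j A : measurable A ->
  distribution P (chain j.+1) A =
  (distribution P (chain j) \x block_prob xi (j * n) n) [set w | A (verlet g h K w).1].
Proof.
move=> mA.
have mD : measurable [set w : 'rV[R]_n * 'rV[R]_n | A (verlet g h K w).1].
  rewrite -[X in measurable X]setTI.
  exact: (measurableT_comp measurable_fst (measurable_verlet mg h K)).
rewrite -(block_product_law xi_iid (measurable_iter j) (@measurable_iter_of _ _) mD).
congr (P _).
suff E w : chain j.+1 w = (verlet g h K (iter_of j (block xi 0 (j * n) w), block xi (j * n) n w)).1.
  by apply/funext => w; exact: (congr1 A (E w)).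
by rewrite chainE /= -chainE.
Qed.

Variables (c : R) (pi : probability 'rV[R]_n R).
Hypothesis piE : is_gibbs f c pi.
Hypothesis K0 : (0 < K)%N.
Hypothesis n0 : (0 < n)%N.
Notation phase := ('rV[R]_n * 'rV[R]_n)%type.

(** The chain starts from a Dirac mass at the minimizer, which is coupled with [pi] by the map from
    y to (x0, y). *)
Lemma chain0_coupling : exists2 G : probability phase R,
  is_coupling (distribution P (chain 0)) pi G &
  \int[G]_w (sqnorm2 (w.1 - w.2))%:E <= (4 * n%:R / m)%:E.
Proof.
have mp : measurable_fun setT (fun y : 'rV[R]_n => (x0, y)).
  by apply/measurable_fun_pairP; split; [exact: measurable_cst|exact: measurable_id].
exists (distribution pi (mfun_of mp)).
  move=> A mA; split; last first.
    by rewrite /distribution /pushforward; congr (pi _); apply/seteqP; split => y /=; [case|split].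
  have [Ax|Ax] := pselect (A x0).
    transitivity (pi setT).
      by rewrite /distribution /pushforward; congr (pi _); apply/seteqP; split => y /=.
    rewrite probability_setT -(@probability_setT _ _ _ P).
    by rewrite /distribution /pushforward; congr (P _); apply/seteqP; split => y /=.
  transitivity (pi set0).
    by rewrite /distribution /pushforward; congr (pi _); apply/seteqP; split => y //= [].
  rewrite measure0 -(@measure0 _ _ _ P).
  by rewrite /distribution /pushforward; congr (P _); apply/seteqP; split => y //=.
rewrite (@ge0_integral_law _ _ _ _ _ (fun y => (x0, y)) pi)//; last 2 first.
- apply/measurable_EFinP; apply: measurable_sqnorm2.
  exact: (measurable_rV_add measurable_fst (measurable_rV_opp measurable_snd)).
- by move=> y; rewrite lee_fin sqnorm2_ge0.
under eq_integral do rewrite /= -sqnorm2N opprB.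
exact: (gibbs_sqdist fg x0min mf piE).
Qed.

Let r : R := (m * T ^+ 2 / 4)%R.
Let B : R := ((M * h * T ^+ 2) ^+ 2 * (40 * n%:R))%R.

(** Young's parameter r / 2 leaves the factor (1 + r / 2) (1 - r) <= 1 - r / 2. With the rejection
    cost [eta] taken equal to [B], an iteration adds 4 B + 8 B / r, at most 12 B / r because r <=
    1/16; this is r / 2 times 24 B / r^2, so that this quantity survives the recursion. *)
Lemma chain_coupling j : exists2 G : probability phase R,
  is_coupling (distribution P (chain j)) pi G &
  \int[G]_w (sqnorm2 (w.1 - w.2))%:E <=
    ((1 - r / 2) ^+ j * (4 * n%:R / m) + 24 * B / r ^+ 2)%:E.
Proof.
have [m0 mM _] := fg.
have M0 : (0 < M)%R by exact: lt_le_trans mM.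
have k1 : (1 <= M / m)%R by rewrite ler_pdivlMr// mul1r.
have s1 : (1 <= Num.sqrt (M / m))%R by rewrite -[leLHS]sqrtr1 ler_sqrt// (le_trans _ k1).
have s0 : (0 < Num.sqrt (M / m))%R by exact: lt_le_trans s1.
have Ms : (0 < M * Num.sqrt (M / m))%R by rewrite mulr_gt0.
have T0 : (0 < T)%R by rewrite /T /integration_time divr_gt0// mulr_gt0// sqrtr_gt0.
have T2 : (M * T ^+ 2 = 1 / (4 * Num.sqrt (M / m)))%R.
  rewrite /T /integration_time expr_div_n exprMn sqr_sqrtr ?ltW// expr1n.
  by field; rewrite !gt_eqF.
have MT : (M * T ^+ 2 <= 4^-1)%R.
  by rewrite T2 div1r lef_pV2 ?posrE// ?mulr_gt0//; lra.
have Kr : (0 < K%:R :> R)%R by rewrite ltr0n.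
have h0 : (0 < h)%R by rewrite divr_gt0.
have KT : (K%:R * h = T)%R by rewrite /h mulrC divfK// gt_eqF.
have r0 : (0 < r)%R by rewrite divr_gt0// mulr_gt0// exprn_gt0.
have r1 : (r <= 1 / 16)%R.
  have : (m * T ^+ 2 <= M * T ^+ 2)%R by rewrite ler_wpM2r ?sqr_ge0.
  by move=> H; rewrite /r; move: MT H; set a := (M * _)%R; set b := (m * _)%R; lra.
have B0 : (0 < B)%R.
  apply: mulr_gt0; last by rewrite mulr_gt0 ?ltr0n.
  by apply: exprn_gt0; apply: mulr_gt0; [exact: mulr_gt0|exact: exprn_gt0].
elim: j => [|j [G Gc Gb]].
  have [G Gc Gb] := chain0_coupling; exists G => //.
  apply: (le_trans Gb); rewrite lee_fin expr0 mul1r lerDl.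
  by rewrite divr_ge0 ?mulr_ge0 ?sqr_ge0// ltW.
have hge0 : (0 <= h)%R by exact: ltW.
have MT' : (M * (K%:R * h) ^+ 2 <= 4^-1)%R by rewrite KT.
have t0 : (0 < r / 2)%R by rewrite divr_gt0.
have [G' Gc' Gb'] := coupling_step fg x0min mf mg piE
  (@block_gibbs _ _ _ _ _ xi_iid (j * n) n) hge0 MT' Gc (@chain_law j) Gb t0 B0.
exists G' => //; apply: (le_trans Gb'); rewrite lee_fin KT -/r -/B.
set C := (_ ^+ j * _)%R.
have C0 : (0 <= C)%R.
  by apply: mulr_ge0; [apply: exprn_ge0; lra|rewrite divr_ge0 ?mulr_ge0// ltW].
have E : (24 * B / r ^+ 2 = (24 * B / r) / r)%R by field; rewrite gt_eqF.
set D := (24 * B / r ^+ 2)%R in E *.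
have D0 : (0 <= D)%R by rewrite divr_ge0 ?mulr_ge0 ?sqr_ge0// ltW.
have BD : (B / r = D * r / 24)%R by rewrite E; field; rewrite gt_eqF.
have -> : ((1 + (r / 2)^-1) * (2 * (B + B)) = 4 * B + 8 * (B / r))%R.
  by field; rewrite gt_eqF.
have Br : (B <= B / r / 16)%R.
  rewrite -[leLHS](divfK (lt0r_neq0 r0)); apply: ler_wpM2l; last by lra.
  by rewrite divr_ge0// ltW.
have -> : ((1 - r / 2) ^+ j.+1 * (4 * n%:R / m) = (1 - r / 2) * C)%R by rewrite exprS -mulrA.
have rD := mulr_ge0 (ltW r0) D0.
have rCD := mulr_ge0 (mulr_ge0 (ltW r0) (ltW r0)) (addr_ge0 C0 D0).
rewrite BD in Br *; lra.
Qed.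

End chain.

(** The ceiling of [b], characterized by the test with which the program counts up to it. *)
Lemma ex_count (R : realType) (b : R) : 0 < b -> exists K : nat,
  [/\ (0 < K)%N, b <= K%:R, K%:R <= b + 1 & forall j : nat, (j%:R < b) = (j < K)%N].
Proof.
move=> b0; have /ex_minnP[K bK Kmin] : exists n : nat, b <= n%:R.
  by exists (Num.Def.archi_bound b); rewrite ltW// archi_boundP// ltW.
have K0 : (0 < K)%N by rewrite -(ltr0n R); exact: lt_le_trans bK.
exists K; split => //.
  case: K K0 bK Kmin => // K _ _ Kmin; rewrite -natr1 lerD2r leNgt; apply/negP => /ltW /Kmin.
  by rewrite ltnn.
move=> j; rewrite ltNge (ltnNge j); congr negb; apply/idP/idP => [/Kmin//|Kj].
by rewrite (le_trans bK)// ler_nat.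
Qed.

(** The initialization takes at most 50 K d and is charged to the iterations, of which there is at
    least one; an iteration itself takes at most 40 K d. *)
Lemma total_time_le (d K N : nat) : (0 < d)%N -> (0 < K)%N -> (0 < N)%N ->
  (2 * K + 48 + N * (4 * d + K * (20 * d + 8) + 6) <= N * (K * d * 90))%N.
Proof.
move=> d0 K0 N0; have Ku : (K <= K * d)%N by rewrite leq_pmulr.
have du : (d <= K * d)%N by rewrite leq_pmull.
have E : (K * (20 * d + 8) = 20 * (K * d) + 8 * K)%N by lia.
have -> : (K * d * 90 = K * d * 50 + K * d * 40)%N by rewrite -mulnDr.
rewrite E (mulnDr N (_ * 50)); move: (K * d)%N Ku du => u Ku du.
apply: leq_add; last by rewrite leq_mul2l; apply/orP; right; lia.
by apply: (@leq_trans (u * 50)%N); [lia|rewrite leq_pmull].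
Qed.

(** * Numerical bounds on error, iterations, time and queries *)

Section costs.
Variables (R : realType) (d : nat) (eps m M : R).
Hypothesis d0 : (0 < d)%N.
Hypothesis m0 : 0 < m.
Hypothesis mM : m <= M.
Hypothesis eps0 : 0 < eps.
Hypothesis epsd : eps < Num.sqrt d%:R.
Let k := M / m.
Let s := Num.sqrt k.
Let q := Num.sqrt s.
Let z := Num.sqrt d%:R : R.

Let k1 : 1 <= k.
Proof. by rewrite /k ler_pdivlMr// mul1r. Qed.

Let s1 : 1 <= s.
Proof. by rewrite /s -[leLHS]sqrtr1 ler_sqrt// (le_trans _ k1). Qed.

Let q1 : 1 <= q.
Proof. by rewrite /q -[leLHS]sqrtr1 ler_sqrt// (le_trans _ s1). Qed.

Let d1 : 1 <= d%:R :> R.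
Proof. by rewrite ler1n. Qed.

Let z1 : 1 <= z.
Proof. by rewrite /z -[leLHS]sqrtr1 ler_sqrt// (le_trans _ d1). Qed.

Let s2 : s ^+ 2 = k.
Proof. by rewrite sqr_sqrtr// (le_trans _ k1). Qed.

Let q2 : q ^+ 2 = s.
Proof. by rewrite sqr_sqrtr// (le_trans _ s1). Qed.

Let z2 : z ^+ 2 = d%:R.
Proof. by rewrite sqr_sqrtr. Qed.

Let gt0_1 (x : R) : 1 <= x -> 0 < x.
Proof. exact: lt_le_trans. Qed.

Let k0 := gt0_1 k1.
Let s0 := gt0_1 s1.
Let q0 := gt0_1 q1.
Let z0 := gt0_1 z1.
Let dr0 := gt0_1 d1.

Let deps : 1 < d%:R / eps.
Proof. by rewrite ltr_pdivlMr// mul1r (lt_le_trans epsd)// -/z -z2 ler_eXnr. Qed.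

Let lnd : 0 < ln (d%:R / eps).
Proof. by rewrite ln_gt0. Qed.

Lemma step_bound_ge100 : 100 <= step_bound d eps m M.
Proof.
rewrite /step_bound -/k -/s -/q -/z -mulrA ler_peMr// ler_pdivlMr// mul1r.
by rewrite (le_trans (ltW epsd))// -/z ler_peMl// ltW.
Qed.

Lemma iteration_bound_gt0 : 0 < iteration_bound d eps m M.
Proof.
have l0 : 0 < 3 + 2 * ln (d%:R / eps) by have := lnd; lra.
by apply: mulr_gt0 => //; apply: mulr_gt0 k0 (mulr_gt0 s0 l0).
Qed.

Variables K N : nat.
Hypothesis K0 : (0 < K)%N.
Hypothesis N0 : (0 < N)%N.

Let T := integration_time m M.
Let h := T / K%:R.
Let r := m * T ^+ 2 / 4.
Let B := (M * h * T ^+ 2) ^+ 2 * (40 * d%:R).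

Lemma error_le : step_bound d eps m M <= K%:R -> iteration_bound d eps m M <= N%:R ->
  (1 - r / 2) ^+ N * (4 * d%:R / m) + 24 * B / r ^+ 2 <= eps ^+ 2 / m.
Proof.
move=> bK bN.
have Kr : 0 < K%:R :> R by rewrite ltr0n.
have mE : M = k * m by rewrite /k divfK// gt_eqF.
have Ms0 : 0 < M * s by rewrite mE (mulr_gt0 (mulr_gt0 k0 m0) s0).
have ks0 : 0 < k * s := mulr_gt0 k0 s0.
have T2 : T ^+ 2 = 1 / (4 * (k * m * s)).
  rewrite /T /integration_time -/k -/s expr_div_n exprMn sqr_sqrtr ?ltW// expr1n mE.
  by rewrite -natrX.
have rE : r = 1 / (16 * (k * s)).
  by rewrite /r T2; field; rewrite !gt_eqF.
have BE : 24 * B / r ^+ 2 = 3840 * (s * d%:R) / (m * K%:R ^+ 2).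
  have -> : B = (M * T ^+ 2) ^+ 2 * T ^+ 2 / K%:R ^+ 2 * (40 * d%:R).
    by rewrite /B /h; field; rewrite gt_eqF.
  rewrite rE T2 mE; move: s2 => /esym s2'.
  have s00 : s != 0 by rewrite gt_eqF.
  have m00 : m != 0 by rewrite gt_eqF.
  have K00 : K%:R != 0 :> R by rewrite gt_eqF.
  by rewrite s2'; field; rewrite s00 m00 K00.
(* The step bound gives eps^2 K^2 >= 10000 sqrt kappa d, and 3840 / 10000 < 1/2. *)
have half1 : 24 * B / r ^+ 2 <= eps ^+ 2 / m / 2.
  rewrite BE.
  have K2 : 10000 * (s * d%:R) <= eps ^+ 2 * K%:R ^+ 2.
    have H : 100 * (q * z) <= eps * K%:R.
      by rewrite [leRHS]mulrC -ler_pdivrMr.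
    rewrite -exprMn -q2 -z2.
    have -> : 10000 * (q ^+ 2 * z ^+ 2) = (100 * (q * z)) ^+ 2 by ring.
    by rewrite ler_sqr// nnegrE ltW// ?mulr_gt0.
  have -> : 3840 * (s * d%:R) / (m * K%:R ^+ 2) = 3840 * (s * d%:R) / K%:R ^+ 2 / m.
    by field; rewrite !gt_eqF.
  have -> : eps ^+ 2 / m / 2 = eps ^+ 2 / 2 / m by field; rewrite gt_eqF.
  rewrite ler_pM2r ?invr_gt0// ler_pdivrMr ?exprn_gt0//.
  have : 0 <= s * d%:R by rewrite ltW// mulr_gt0.
  move: K2; set a := s * _; set b := eps ^+ 2 * _ => K2 a0.
  have -> : eps ^+ 2 / 2 * K%:R ^+ 2 = b / 2 by rewrite /b; ring.
  lra.
have r0 : 0 < r by rewrite rE divr_gt0// mulr_gt0.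
(* The power is at most exp (- N r / 2) <= exp (-3) (eps / d)^2, where exp (-3) <= 1/8 absorbs the
   factor 4 of the initial cost and one factor 1 / d absorbs its dimension. *)
have half2 : (1 - r / 2) ^+ N * (4 * d%:R / m) <= eps ^+ 2 / m / 2.
  have rl : r <= 1.
    rewrite rE ler_pdivrMr; last by rewrite mulr_gt0.
    have : 1 <= k * s by rewrite -[leLHS]mul1r ler_pM.
    lra.
  have e1 : 1 - r / 2 <= expR (- (r / 2)) by exact: expR_ge1Dx.
  have e2 : (1 - r / 2) ^+ N <= expR (- (N%:R * (r / 2))).
    rewrite -[X in expR X]mulrN expRM_natl; apply: lerXn2r => //; rewrite nnegrE ?expR_ge0//; lra.
  have e3 : 3 + 2 * ln (d%:R / eps) <= N%:R * (r / 2).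
    rewrite rE.
    have -> : N%:R * (1 / (16 * (k * s)) / 2) = N%:R / (32 * (k * s)).
      by field; rewrite !gt_eqF.
    rewrite ler_pdivlMr; last by rewrite mulr_gt0.
    apply: le_trans bN.
    rewrite /iteration_bound -/k -/s le_eqVlt; apply/orP; left; apply/eqP; ring.
  have e4 : (1 - r / 2) ^+ N <= expR (- 3) * (eps / d%:R) ^+ 2.
    apply: (le_trans e2).
    have -> : expR (- 3) * (eps / d%:R) ^+ 2 = expR (- (3 + 2 * ln (d%:R / eps))).
      rewrite (opprD 3) expRD; congr (_ * _).
      by rewrite -[X in expR X]mulrN expRM_natl expRN lnK ?invf_div// posrE (lt_trans _ deps).
    by rewrite ler_expR lerN2.
  have e5 : expR (- 3) <= 1 / 8 :> R.
    rewrite expRN div1r lef_pV2 ?posrE ?expR_gt0//.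
    have -> : 3 = 3%:R * 1 :> R by rewrite mulr1.
    rewrite expRM_natl; have -> : 8 = 2 ^+ 3 :> R by rewrite -natrX.
    apply: lerXn2r; rewrite ?nnegrE ?expR_ge0//.
    by have := expR_ge1Dx (1 : R); lra.
  have dm0 : 0 < 4 * d%:R / m by rewrite divr_gt0// mulr_gt0.
  apply: (@le_trans _ _ (1 / 8 * (eps / d%:R) ^+ 2 * (4 * d%:R / m))).
    by rewrite ler_pM2r//; apply: (le_trans e4); rewrite ler_wpM2r// sqr_ge0.
  have -> : 1 / 8 * (eps / d%:R) ^+ 2 * (4 * d%:R / m) = eps ^+ 2 / m / 2 * (1 / d%:R).
    by field; rewrite !gt_eqF.
  rewrite ler_piMr ?ler_pdivrMr ?mul1r//.
  by rewrite !divr_ge0 ?sqr_ge0// ltW.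
by rewrite [leRHS]splitr lerD.
Qed.

Lemma iterations_le : N%:R <= iteration_bound d eps m M + 1 ->
  N%:R <= 10000 * (k `^ (3 / 2) * logO (d%:R / eps)).
Proof.
move=> bN; apply: (le_trans bN).
have -> : k `^ (3 / 2) = k * s.
  rewrite (_ : 3 / 2 = 1 + 2^-1 :> R); last by lra.
  by rewrite powRD ?gt_eqF ?implybT// powRr1 ?powR12_sqrt// ltW.
have l1 : 1 <= logO (d%:R / eps) by rewrite /logO le_max lexx.
have l2 : ln (d%:R / eps) <= logO (d%:R / eps) by rewrite /logO le_max lexx orbT.
rewrite /iteration_bound -/k -/s; move: (logO _) l1 l2 => L l1 l2.
have ks : 1 <= k * s by rewrite -[leLHS]mul1r ler_pM.
have -> : 32 * (k * (s * (3 + 2 * ln (d%:R / eps)))) = 32 * (k * s * (3 + 2 * ln (d%:R / eps))) by ring.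
have H : k * s * (3 + 2 * ln (d%:R / eps)) <= k * s * (5 * L).
  by rewrite ler_pM2l ?gt0_1//; lra.
have H' : 1 <= k * s * L by rewrite -[leLHS]mul1r ler_pM.
lra.
Qed.

(** As the step bound is at least 100, rounding it up costs at most one percent, hence the 101
    below. *)
Hypothesis bK : K%:R <= step_bound d eps m M + 1.

Let K_le : K%:R <= 101 * (q * z / eps).
Proof.
have := step_bound_ge100; have E : step_bound d eps m M = 100 * (q * z / eps).
  by rewrite /step_bound -/k -/s -/q -/z; ring.
by move: bK; rewrite E; lra.
Qed.

Let powR_quarter : k `^ (1 / 4) = q.
Proof.
rewrite (_ : 1 / 4 = 2^-1 * 2^-1 :> R); last by lra.
by rewrite powRrM !powR12_sqrt// ?sqrtr_ge0// ltW.
Qed.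

Let logO_ge1 x : 1 <= logO x :> R.
Proof. by rewrite /logO le_max lexx. Qed.

Lemma queries_le : (N * (2 * K))%:R <= N%:R *
  (10000 * (k `^ (1 / 4) * d%:R `^ (1 / 2) / eps * logO (k * d%:R / eps))).
Proof.
rewrite natrM ler_pM2l ?ltr0n// powR_quarter div1r powR12_sqrt// -/z.
have := logO_ge1 (k * d%:R / eps); move: (logO _) => L L1.
rewrite natrM; have H : q * z / eps <= q * z / eps * L.
  by rewrite ler_peMr// divr_ge0 ?mulr_ge0// ltW.
have : 0 <= q * z / eps by rewrite divr_ge0 ?mulr_ge0// ltW.
by move: K_le H; set a := q * z / eps; set b := a * L; lra.
Qed.

Lemma time_le t : (t <= 2 * K + 48 + N * (4 * d + K * (20 * d + 8) + 6))%N ->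
  t%:R <= N%:R *
  (10000 * (k `^ (1 / 4) * d%:R `^ (3 / 2) / eps * logO (k * d%:R / eps))).
Proof.
move=> tle.
have tle' := leq_trans tle (total_time_le d0 K0 N0).
have : t%:R <= (N * (K * d * 90))%:R :> R by rewrite ler_nat.
rewrite natrM => /le_trans; apply; rewrite ler_pM2l ?ltr0n// powR_quarter.
have -> : d%:R `^ (3 / 2) = d%:R * z :> R.
  rewrite (_ : 3 / 2 = 1 + 2^-1 :> R); last by lra.
  by rewrite powRD ?gt_eqF ?implybT// powRr1 ?powR12_sqrt// ltW.
have := logO_ge1 (k * d%:R / eps); move: (logO _) => L L1.
rewrite !natrM; have -> : q * (d%:R * z) / eps * L = d%:R * (q * z / eps * L) by ring.
rewrite (_ : K%:R * d%:R * 90 = d%:R * (K%:R * 90)); last by ring.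
rewrite (mulrCA 10000) ler_pM2l//.
have H : q * z / eps <= q * z / eps * L.
  by rewrite ler_peMr// divr_ge0 ?mulr_ge0// ltW.
have : 0 <= q * z / eps by rewrite divr_ge0 ?mulr_ge0// ltW.
by move: K_le H; set a := q * z / eps; set b := a * L; lra.
Qed.

End costs.

Lemma W2_le (R : realType) d (mu nu : set 'rV[R]_d -> \bar R)
    (G : probability ('rV[R]_d * 'rV[R]_d)%type R) (a : R) :
  is_coupling mu nu G -> 0 <= a ->
  (\int[G]_z (sqnorm2 (z.1 - z.2))%:E <= (a ^+ 2)%:E)%E -> (W2 mu nu <= a%:E)%E.
Proof.
move=> Gc a0 Ga; rewrite /W2 (_ : a%:E = (a ^+ 2)%:E `^ (1 / 2))%E; last first.
  by rewrite poweR_EFin div1r powR12_sqrt ?sqr_ge0// sqrtr_sqr ger0_norm.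
have inf0 : (0 <= ereal_inf [set \int[g]_z (sqnorm2 (z.1 - z.2))%:E
    | g in [set g : probability ('rV[R]_d * 'rV[R]_d)%type R | is_coupling mu nu g]])%E.
  apply: le_ereal_inf_tmp => _ [g _ <-]; apply: integral_ge0 => z _.
  by rewrite lee_fin sqnorm2_ge0.
apply: gt0_ler_poweR; rewrite ?in_itv/= ?leey ?andbT ?lee_fin ?sqr_ge0 ?divr_ge0//.
by apply: le_trans Ga; apply: ereal_inf_lbound; exists G.
Qed.

(** * From the hypotheses on [f] to those of the analysis *)

Section twice_differentiable.
Variables (R : realType) (d : nat) (f : 'rV[R]_d -> R).
Hypothesis df2 : twice_differentiable f.

Lemma twice_differentiable_measurable : measurable_fun setT f.
Proof.
by apply: continuous_rV_measurable => x; apply: differentiable_continuous; exact: df2.1.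
Qed.

Lemma gradient_measurable : measurable_fun setT (gradient f).
Proof.
apply/measurable_fun_rVP => i; apply: continuous_rV_measurable => x.
have gx : {for x, continuous (gradient f)} by apply: differentiable_continuous; exact: df2.2.
exact: (continuous_comp gx (@coord_continuous R 1 d ord0 i (gradient f x))).
Qed.

Lemma hessian_smooth_strongly_convex m M : (0 < d)%N -> 0 < m ->
  (forall x, loewner_le m%:M (hessian f x) /\ loewner_le (hessian f x) M%:M) ->
  smooth_strongly_convex f (gradient f) m M.
Proof.
move=> d0 m0 mM; split => // [|x y]; last first.
  by apply/andP; split; [exact: strong_convexity|exact: descent].
(* Comparing both quadratic bounds at a single nonzero displacement gives m <= M; the all-ones
   vector is nonzero because d > 0. *)
have := le_trans (strong_convexity df2 mM 0 (const_mx 1)) (descent df2 mM 0 (const_mx 1)).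
rewrite subr0 ler_pM2r; first by lra.
rewrite /sqnorm2 (eq_bigr (fun=> 1)) => [|i _]; last by rewrite mxE expr1n.
by rewrite sumr_const card_ord ltr0n.
Qed.

End twice_differentiable.

Theorem mainTheorem4 (R : realType) :
  exists (A : algorithm) (C : R),
    0 < C /\
    forall (d : nat) (f : 'rV[R]_d -> R) (m2 M2 eps : R) (x0 : 'rV[R]_d),
      let kappa := M2 / m2 in
      twice_differentiable f ->
      0 < m2 ->
      (forall x, loewner_le m2%:M (hessian f x) /\
                 loewner_le (hessian f x) M2%:M) ->
      0 < eps -> eps < Num.sqrt d%:R ->
      (forall y, f x0 <= f y) ->
    forall (dO : measure_display) (O : measurableType dO) (P : probability O R)
      (xi : nat -> {RV P >-> R}),
      iid_std_gaussian xi ->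
    exists X : {RV P >-> 'rV[R]_d},
      (forall w : O, exists (N : nat) (s : state R),
        [/\ run (gradient f) (fun n => xi n w) A (input eps m2 M2 x0) N s,
            output d s = X w,
            N%:R <= C * (kappa `^ (3 / 2) * logO (d%:R / eps)),
            (time s)%:R <= N%:R *
              (C * (kappa `^ (1 / 4) * d%:R `^ (3 / 2) / eps *
                    logO (kappa * d%:R / eps))) &
            (queries s)%:R <= N%:R *
              (C * (kappa `^ (1 / 4) * d%:R `^ (1 / 2) / eps *
                    logO (kappa * d%:R / eps)))]) /\
      (forall (dO' : measure_display) (O' : measurableType dO')
         (Q : probability O' R) (Y : {RV Q >-> 'rV[R]_d}),
         has_density_propto Y (fun x => expR (- f x)) ->
         (W2 (distribution P X) (distribution Q Y) <=
            (eps / Num.sqrt m2)%:E)%E).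
Proof.
exists hmc, 10000; split; first by rewrite ltr0n.
move=> d f m M eps x0 k df2 m0 mM eps0 epsd x0min dO O P xi xi_iid.
(* In dimension 0 no [eps] lies strictly between 0 and sqrt d. *)
have d0 : (0 < d)%N.
  by case: d epsd {f x0 k df2 mM x0min} => //; rewrite sqrtr0 => /(lt_trans eps0); rewrite ltxx.
have fg := hessian_smooth_strongly_convex df2 d0 m0 mM; have [_ mleM _] := fg.
have mf := twice_differentiable_measurable df2; have mg := gradient_measurable df2.
have b0 : 0 < step_bound d eps m M.
  exact: lt_le_trans (step_bound_ge100 d0 m0 mleM eps0 epsd).
have [K [K0 bK Kb HK]] := ex_count b0.
have [N [N0 bN Nb HN]] := ex_count (iteration_bound_gt0 d0 m0 mleM eps0 epsd).
(* The output is fixed before [Y] is given: the target law enters only through the coupling. *)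
exists (chain xi m M x0 K mg N); split => [w|dO' O' Q Y [c Yc]].
  have [s [Hrun Hout Htime Hq]] := hmc_run (gradient f) (fun n => xi n w) x0 HK HN.
  exists N, s; split => //.
  - by rewrite Hout chainE.
  - exact: iterations_le Nb.
  - exact: time_le Kb _ Htime.
  - by rewrite Hq; exact: queries_le.
have Yg : is_gibbs f c (distribution Q Y) by exact: Yc.
have [G Gc Gb] := chain_coupling xi_iid fg x0min mf mg Yg K0 d0 N.
apply: (W2_le Gc); first by rewrite divr_ge0 ?sqrtr_ge0// ltW.
apply: (le_trans Gb); rewrite lee_fin.
have -> : (eps / Num.sqrt m) ^+ 2 = eps ^+ 2 / m by rewrite expr_div_n sqr_sqrtr// ltW.
exact: error_le.
Qed.
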